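(* In the setting of the context, there is a probability measure $\mu$ on $\mathbb{R}$, independent of $p$, with unbounded support, which is uniquely determined by its moments $M_k=\int x^k\,d\mu(x)=\lim_{N\to\infty}M_k(N)$, such that the empirical spectral measures $\mu_{A,N}$ converge weakly to $\mu$ in probability: for every bounded continuous $f:\mathbb{R}\to\mathbb{R}$ and every $\varepsilon>0$, \[ \lim_{N\to\infty}\mathrm{Prob}\Big(\Big|\int f\,d\mu_{A,N}-\int f\,d\mu\Big|>\varepsilon\Big)=0 . \]
   Context: Let $p$ be a probability density on $\mathbb{R}$ with mean $0$, variance $1$ and finite moments of all orders. For $N\ge 1$, let $b_1,\dots,b_{N-1}$ be independent random variables with density $p$, set $b_0=0$, and let $A=A_N$ be the $N\times N$ real symmetric Toeplitz matrix with entries $a_{ij}=b_{|i-j|}$ ($1\le i,j\le N$). Let $\lambda_1(A),\dots,\lambda_N(A)$ be its eigenvalues. The empirical spectral measure is $\mu_{A,N}=\frac1N\sum_{i=1}^N\delta_{\lambda_i(A)/\sqrt N}$. For an integer $k\ge 0$ define $M_k(A,N)=\int x^k\,d\mu_{A,N}(x)=N^{-(k/2+1)}\,\mathrm{Trace}(A^k)$, and $M_k(N)=\mathbb{E}[M_k(A,N)]$. *)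

(* Defs.v *)
From HB Require Import structures.
From mathcomp Require Import all_boot all_order all_algebra.
From mathcomp Require Import all_classical all_reals all_analysis.
Set Implicit Arguments. Unset Strict Implicit. Unset Printing Implicit Defensive.
Import Order.TTheory GRing.Theory Num.Theory.
Import numFieldNormedType.Exports.
Local Open Scope classical_set_scope.
Local Open Scope ring_scope.

Section Toeplitz.
Variable R : realType.

Definition toeplitz (N : nat) (b : nat -> R) : 'M[R]_N :=
  \matrix_(i < N, j < N)
    (if i == j :> nat then 0 else b (maxn i j - minn i j)%N).

Definition is_spectrum (N : nat) (A : 'M[R]_N) (lam : 'I_N -> R) : Prop :=
  char_poly A = \prod_(i < N) ('X - (lam i)%:P).

(* A choice of the list of eigenvalues of A (exists for real symmetric A;
   any choice gives the same empirical measure). *)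
Definition eigvals (N : nat) (A : 'M[R]_N) : 'I_N -> R :=
  match pselect (exists lam, is_spectrum A lam) with
  | left H => proj1_sig (boolp.constructive_indefinite_description H)
  | right _ => fun _ => 0
  end.

Definition empirical_integral (N : nat) (A : 'M[R]_N) (f : R -> R) : R :=
  (N%:R)^-1 * \sum_(i < N) f (eigvals A i / Num.sqrt (N%:R)).

(* M_k(A,N) = N^{-(k/2+1)} Trace(A^k) = N^{-1} (sqrt N)^{-k} Trace(A^k). *)
Definition moment_AN (N k : nat) (A : 'M[R]_N) : R :=
  (N%:R)^-1 * (Num.sqrt (N%:R))^-k * \tr (A ^+ k).

Definition msupport (mu : set R -> \bar R) : set R :=
  [set x | forall e : R, 0 < e -> (0 < mu (ball x e))%E].

End Toeplitz.

Definition mutually_independent {d} {T : measurableType d} {R : realType}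
  (P : probability T R) (I : set nat) (X : nat -> T -> R) : Prop :=
  forall (s : seq nat) (B : nat -> set R),
    uniq s -> (forall j, j \in s -> I j) -> (forall j, measurable (B j)) ->
    P [set w | forall j, j \in s -> B j (X j w)] =
    (\prod_(j <- s) P (X j @^-1` B j))%E.

(* Main.v *)
(** The trace of A^k is a sum, over closed walks of length k in {0, ..., N-1}, of products
    of entries b_|i-j|.  In expectation, after normalization, only the walks in which every
    step length occurs exactly twice (and no step is trivial) survive.  Such a walk of
    length 2m is determined by a combinatorial pattern together with m+1 integers of [0, N)
    (its starting point and its step lengths), subject to inequalities 0 <= a(x) < N and
    to one closing equation a(x) = 0.  The closing equation holds identically or costs a factor 1/N, and the
    number of integer solutions of the inequalities, divided by N^(m+1), converges because
    it hardly changes when the cube [0, N)^(m+1) is subdivided.  Hence M_2m exists and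
    depends on nothing but m.  The variance of the moments tends to 0, since a pair of
    closed walks sharing a step length either has few distinct step lengths or satisfies
    a nontrivial linear relation.

    The bounds m!/2^m <= M_2m <= 8^m m! give unbounded support and determinacy.  For
    determinacy, and for every passage from moments to bounded continuous functions, the
    same principle is used: a class of functions that contains the polynomials, is stable
    under linear combinations, and contains f as soon as |f - g| <= q with g in the class,
    q a polynomial and M(q) arbitrarily small, contains all bounded continuous functions.
    It is reached through the functions x^j exp(-m c x^2) with c small, which are Taylor
    expanded one factor exp(-c x^2) at a time.

    The measure mu itself is read off the limit functional of the averaged empirical
    measures of random sign matrices, which need no probability space, via its
    distribution function. *)

Require Import Defs.
From HB Require Import structures.
From mathcomp Require Import all_boot all_order all_algebra.
From mathcomp Require Import zify ring lra.
Set Implicit Arguments. Unset Strict Implicit. Unset Printing Implicit Defensive.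
Import Order.TTheory GRing.Theory Num.Theory.

Local Open Scope ring_scope.

(** * Integer points of polytopes *)

(** No volume is computed for the limits of the normalized counts. Passing from N to M N replaces
    each integer point by a block, and only the points within bounded distance of a facet, O(N^m)
    out of N^(m+1), can have a block that straddles it; this makes the normalized counts a Cauchy
    sequence. In 8^m m!, there are 4^m choices of directions, and 2^m m! comes from words in which
    every letter has even multiplicity. The bound m!/2^m comes from joining a walk of length m to
    the reverse of another with the same start, end and set of step lengths: about N^(m+1) walks
    share at most N^(m+1) 2^m / m! such triples, the end being determined by the start, the set and
    the subset of upward steps. A bounded function is in general no uniform limit of polynomials on
    the line, so errors are measured by the moment functional of a polynomial majorant. The n-th
    Taylor remainder of exp(-c x^2) is at most (c x^2)^n / n!, which moments growing like m! keep
    small for small c. Random signs suffice because the limit moments depend only on the mean and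
    variance of the entries, so the measure is there before any density is given. *)

Section LatticeCount.
Variable I : finType.
Implicit Types (N M : nat) (a : {ffun I -> int}).

Definition lin N a (x : {ffun I -> 'I_N}) : int := \sum_i a i * (x i)%:Z.

Lemma linD N a b x : @lin N (a + b) x = lin a x + lin b x.
Proof.
by rewrite /lin -big_split; apply: eq_bigr => i _; rewrite ffunE mulrDl.
Qed.

Lemma linN N a x : @lin N (- a) x = - lin a x.
Proof.
by rewrite /lin -sumrN; apply: eq_bigr => i _; rewrite ffunE mulNr.
Qed.

Lemma linB N a b x : @lin N (a - b) x = lin a x - lin b x.
Proof. by rewrite linD linN. Qed.

Lemma lin0 N x : @lin N 0 x = 0.
Proof. by rewrite /lin big1// => i _; rewrite ffunE mul0r. Qed.

Definition delta (j : I) : {ffun I -> int} := [ffun i => (i == j)%:R].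

Lemma lin_delta N j x : @lin N (delta j) x = (x j)%:Z.
Proof.
rewrite /lin (bigD1 j)//= ffunE eqxx mul1r big1 ?addr0// => i ij.
by rewrite ffunE (negbTE ij) mul0r.
Qed.

(** The equation recovers coordinate [i0] from the others, so overwriting it by an arbitrary value
    is injective on pairs (value, solution). The factor N on the left is the saving of one power of
    N, kept in [nat]. *)
Lemma card_hyperplane N a i0 (c : int) : a i0 != 0 ->
  (N * #|[set x : {ffun I -> 'I_N} | lin a x == c]| <= N ^ #|I|)%N.
Proof.
move=> ai0; set H := [set x | _].
pose g (z : 'I_N * {ffun I -> 'I_N}) : {ffun I -> 'I_N} :=
  [ffun i => if i == i0 then z.1 else z.2 i].
have ginj : {in setX [set: 'I_N] H &, injective g}.
  move=> [t x] [t' x']; rewrite !inE/= => /eqP hx /eqP hx' gg.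
  have tt' : t = t' by have /ffunP/(_ i0) := gg; rewrite !ffunE eqxx.
  have xx i : i != i0 -> x i = x' i.
    by move=> ii0; have /ffunP/(_ i) := gg; rewrite !ffunE (negbTE ii0).
  congr pair => //; apply/ffunP => i; case: (eqVneq i i0) => [->|/xx//].
  have : lin a x = lin a x' by rewrite hx hx'.
  rewrite /lin (bigD1 i0)//= [in RHS](bigD1 i0)//=.
  rewrite [X in _ + X](eq_bigr (fun i => a i * (x' i)%:Z)); last first.
    by move=> j /xx->.
  by move/addIr/(mulfI ai0) => -[/val_inj].
have := card_in_imset ginj; rewrite cardsX cardsT card_ord => <-.
by rewrite (leq_trans (max_card _))// card_ffun card_ord.
Qed.

Lemma card_window N a i0 (c : int) (K : nat) : a i0 != 0 ->
  (N * #|[set x : {ffun I -> 'I_N} | (c <= lin a x < c + K%:Z)%R]| <= K * N ^ #|I|)%N.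
Proof.
move=> ai0; elim: K => [|K IH].
  rewrite mul0n leqn0 muln_eq0 cards_eq0; apply/orP; right.
  by apply/eqP/setP => x; rewrite !inE; apply/negP; lia.
have -> : [set x : {ffun I -> 'I_N} | c <= lin a x < c + K.+1%:Z] =
   [set x : {ffun I -> 'I_N} | c <= lin a x < c + K%:Z] :|:
   [set x : {ffun I -> 'I_N} | lin a x == c + K%:Z].
  by apply/setP => x; rewrite !inE; apply/idP/idP; lia.
rewrite mulSn addnC (leq_trans (leq_mul (leqnn N) (leq_card_setU _ _)))//.
by rewrite mulnDr leq_add// (card_hyperplane _ _ ai0).
Qed.

Lemma blow_subproof N M (q : 'I_N) (r : 'I_M) : (q * M + r < M * N)%N.
Proof. by case: q r => q hq [r hr] /=; nia. Qed.

(* Subdivides [0, M N) into N blocks of length M: q is the block, r the place in it. *)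
Definition blow N M (q : {ffun I -> 'I_N}) (r : {ffun I -> 'I_M}) :
  {ffun I -> 'I_(M * N)} := [ffun i => Ordinal (blow_subproof (q i) (r i))].

Lemma blow_inj N M q r q' r' : @blow N M q r = blow q' r' -> q = q' /\ r = r'.
Proof.
move=> e; have h i : q i = q' i /\ r i = r' i.
  have /ffunP/(_ i)/(congr1 val) := e; rewrite !ffunE /=.
  case: (q i) (q' i) (r i) (r' i) => [a ha] [b hb] [u hu] [v hv] /= huv.
  have M0 : (0 < M)%N by lia.
  split; apply/val_inj => /=.
    by have := congr1 (divn^~ M) huv; rewrite /= !divnMDl// !divn_small// !addn0.
  by have := congr1 (modn^~ M) huv; rewrite /= !modnMDl !modn_small.
by split; apply/ffunP => i; have [] := h i.
Qed.

Lemma blow_surj N M (x : {ffun I -> 'I_(M * N)}) :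
  exists q r, x = @blow N M q r.
Proof.
have hq i : (x i %/ M < N)%N by rewrite ltn_divLR; case: (x i) => /= m; nia.
have hr i : (x i %% M < M)%N by rewrite ltn_mod; case: (x i) => /= m; nia.
exists [ffun i => Ordinal (hq i)], [ffun i => Ordinal (hr i)].
by apply/ffunP => i; apply/val_inj; rewrite !ffunE/= -divn_eq.
Qed.

Lemma lin_blow N M a q r : lin a (@blow N M q r) = M%:Z * lin a q + lin a r.
Proof.
rewrite /lin mulr_sumr -big_split; apply: eq_bigr => i _.
by rewrite !ffunE/= PoszD PoszM; ring.
Qed.

Lemma card_blow N M (Q : {set {ffun I -> 'I_N}}) :
  #|[set blow z.1 z.2 | z in setX Q [set: {ffun I -> 'I_M}]]| =
  (M ^ #|I| * #|Q|)%N.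
Proof.
rewrite card_in_imset; first by rewrite cardsX cardsT card_ffun card_ord mulnC.
by move=> [q r] [q' r'] _ _ /= /blow_inj[-> ->].
Qed.

Definition height a : nat := (\sum_i absz (a i))%N.

Lemma lin_height N a (x : {ffun I -> 'I_N}) : `|lin a x| <= (N * height a)%:Z.
Proof.
rewrite /lin (le_trans (ler_norm_sum _ _ _))//.
rewrite /height big_distrr/= -natz natr_sum ler_sum// => i _.
rewrite normrM natz -abszE mulnC PoszM ler_pM//; case: (x i) => m /=; lia.
Qed.

Definition in_range N a (x : {ffun I -> 'I_N}) := (0 <= lin a x < N%:Z).

Definition range_set N (F : seq {ffun I -> int}) :=
  [set x : {ffun I -> 'I_N} | all (fun a => in_range a x) F].

(** The points whose block may straddle a facet. By [lin_blow] and [lin_height] the offset r moves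
    [M * lin a q] by at most [M * height a], so it can matter only if [lin a q] is within [height a]
    of 0 or of N. *)
Definition edge_set N a :=
  [set x : {ffun I -> 'I_N} |
    (- (height a)%:Z <= lin a x < - (height a)%:Z + (2 * height a)%:Z) ||
    (N%:Z - (height a)%:Z <= lin a x < N%:Z - (height a)%:Z + (2 * height a).+1%:Z)].

Lemma card_edge_set N a i0 : a i0 != 0 ->
  (N * #|edge_set N a| <= (4 * height a).+1 * N ^ #|I|)%N.
Proof.
move=> ai0; have -> : edge_set N a =
   [set x : {ffun I -> 'I_N} | - (height a)%:Z <= lin a x < - (height a)%:Z + (2 * height a)%:Z]
  :|: [set x : {ffun I -> 'I_N} | N%:Z - (height a)%:Z <= lin a x < N%:Z - (height a)%:Z + (2 * height a).+1%:Z].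
  by apply/setP => x; rewrite !inE.
rewrite (leq_trans (leq_mul (leqnn N) (leq_card_setU _ _)))// mulnDr.
rewrite (leq_trans (leq_add (card_window _ _ _ ai0) (card_window _ _ _ ai0)))//.
lia.
Qed.

Lemma blow_in_range N M a q r : (0 < M)%N -> q \notin edge_set N a ->
  in_range a (@blow N M q r) = in_range a q.
Proof.
move=> M0; rewrite inE /in_range lin_blow => hq.
have := lin_height a r; move: hq; set h := height a; set l := lin a q; set l' := lin a r.
by move=> /norP[h1 h2] h3; apply/idP/idP; rewrite PoszM; nia.
Qed.

(** The zero form is left out because [card_edge_set] asks for a nonzero coefficient; its value 0 is
    the same on every block. *)
Definition bad_edges N F := \bigcup_(a <- [seq a <- F | a != 0]) edge_set N a.

Lemma card_bad_edges N F :
  (N * #|bad_edges N F| <= \sum_(a <- F) (4 * height a).+1 * N ^ #|I|)%N.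
Proof.
rewrite /bad_edges; elim: F => [|a F IH]; first by rewrite !big_nil cards0 muln0.
rewrite /= big_cons; case: eqVneq => [->|a0] /=.
  by rewrite (leq_trans IH)// leq_addl.
rewrite big_cons (leq_trans (leq_mul (leqnn N) (leq_card_setU _ _)))//.
rewrite mulnDr leq_add//.
have /existsP[i ai] : [exists i, a i != 0].
  apply: contraNT a0 => /existsPn h; apply/eqP/ffunP => i; rewrite ffunE.
  by apply/eqP; have := h i; rewrite negbK.
exact: card_edge_set ai.
Qed.

Lemma notin_bad_edges N F q a : q \notin bad_edges N F -> a \in F -> a != 0 ->
  q \notin edge_set N a.
Proof.
move=> + aF a0; apply: contraNN => qa; rewrite /bad_edges.
have : a \in [seq a <- F | a != 0] by rewrite mem_filter a0.
elim: [seq a <- F | a != 0] => // b s IH; rewrite inE big_cons inE.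
by move=> /predU1P[<-|/IH->]; rewrite ?qa// orbT.
Qed.

Lemma blow_range_set N M F q r : (0 < M)%N -> q \notin bad_edges N F ->
  (@blow N M q r \in range_set (M * N) F) = (q \in range_set N F).
Proof.
move=> M0 hq; rewrite !inE; apply/eq_in_all => a aF.
case: (eqVneq a 0) => [->|a0]; last first.
  by rewrite blow_in_range//; exact: notin_bad_edges hq aF a0.
rewrite /in_range !lin0; case: N q r {hq} => [|N] q r; rewrite ?muln0//.
by rewrite !lexx/=; lia.
Qed.

Lemma card_range_blow_le N M F : (0 < M)%N ->
  (#|range_set (M * N) F| <= M ^ #|I| * (#|range_set N F| + #|bad_edges N F|))%N.
Proof.
move=> M0; apply: leq_trans (leq_mul (leqnn _) (leq_card_setU _ _)).
rewrite -card_blow; apply/subset_leq_card/fintype.subsetP => x.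
have [q [r ->]] := blow_surj x => hx.
apply/imsetP; exists (q, r) => //; rewrite !inE andbT/=.
case: (boolP (q \in bad_edges N F)) => [|hq]; first by rewrite orbT.
by move: hx; rewrite blow_range_set// inE => ->.
Qed.

Lemma card_range_blow_ge N M F : (0 < M)%N ->
  (M ^ #|I| * #|range_set N F| <= #|range_set (M * N) F| + M ^ #|I| * #|bad_edges N F|)%N.
Proof.
move=> M0.
have h1 : (#|range_set N F| <= #|range_set N F :\: bad_edges N F| + #|bad_edges N F|)%N.
  by rewrite -(cardsID (bad_edges N F)) addnC leq_add2l subset_leq_card// subsetIr.
rewrite (leq_trans (leq_mul (leqnn _) h1))// mulnDr leq_add2r.
rewrite -card_blow; apply/subset_leq_card/fintype.subsetP => x.
move=> /imsetP[[q r]]; rewrite !inE/= andbT => /andP[hq hq'] ->.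
by have := @blow_range_set N M F q r M0 hq; rewrite !inE hq'.
Qed.

(** With c(N) the cardinal of [range_set N F], this is |c(M N) / (M N)^n - c(N) / N^n| <= C / N for
    n = #|I|, with denominators cleared. *)
Lemma range_scaling F : exists C : nat, forall N M, (0 < M)%N -> (0 < N)%N ->
  (N * #|range_set (M * N) F| <= N * M ^ #|I| * #|range_set N F| + C * (M * N) ^ #|I|)%N /\
  (N * M ^ #|I| * #|range_set N F| <= N * #|range_set (M * N) F| + C * (M * N) ^ #|I|)%N.
Proof.
exists (\sum_(a <- F) (4 * height a).+1)%N => N M M0 N0.
have := card_bad_edges N F; rewrite -big_distrl/= expnMn.
have := card_range_blow_le N F M0; have := card_range_blow_ge N F M0.
set c := #|range_set N F|; set c' := #|range_set (M * N) F|.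
set b := #|bad_edges _ _|; set S := (\sum_(_ <- _) _)%N.
set Mn := (M ^ _)%N; set Nn := (N ^ _)%N => h1 h2 h3.
have h4 : (Mn * (N * b) <= S * (Mn * Nn))%N by nia.
by split; nia.
Qed.

End LatticeCount.

(** * Walks and their step lengths *)

Section MapIn.
Variables (T1 T2 : eqType) (f : T1 -> T2).
Implicit Types s : seq T1.

Lemma mem_map_in s1 s x : {subset s1 <= s} -> x \in s -> {in s &, injective f} ->
  (f x \in map f s1) = (x \in s1).
Proof.
move=> ss xs fi; apply/mapP/idP => [[y ys1 /fi ->//]|xs1]; first exact: ss.
by exists x.
Qed.

Lemma undup_map_in s1 s : {subset s1 <= s} -> {in s &, injective f} ->
  undup (map f s1) = map f (undup s1).
Proof.
move=> + fi; elim: s1 => //= x s1 IH ss.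
have ss1 : {subset s1 <= s} by move=> y ys; apply: ss; rewrite inE ys orbT.
rewrite (mem_map_in ss1) ?ss ?mem_head//.
by case: ifP => _ /=; rewrite IH.
Qed.

Lemma index_map_in s1 s x : {subset s1 <= s} -> x \in s -> {in s &, injective f} ->
  index (f x) (map f s1) = index x s1.
Proof.
move=> + xs fi; elim: s1 => //= y s1 IH ss.
rewrite (inj_in_eq fi)//; last by apply: ss; rewrite mem_head.
by rewrite IH// => z zs; apply: ss; rewrite inE zs orbT.
Qed.

Lemma count_map_in s1 s x : {subset s1 <= s} -> x \in s -> {in s &, injective f} ->
  count_mem (f x) (map f s1) = count_mem x s1.
Proof.
move=> + xs fi; elim: s1 => //= y s1 IH ss.
rewrite (inj_in_eq fi)//; last by apply: ss; rewrite mem_head.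
by rewrite IH// => z zs; apply: ss; rewrite inE zs orbT.
Qed.

End MapIn.

Lemma size_count_undup (T : eqType) (s : seq T) :
  size s = (\sum_(d <- undup s) count_mem d s)%N.
Proof.
have /perm_size := perm_count_undup s; rewrite size_flatten => <-.
rewrite sumnE /shape !big_map.
by apply: eq_bigr => x _; rewrite size_nseq.
Qed.

Lemma size_undup2 (T : eqType) (s : seq T) :
  all (fun d => 2 <= count_mem d s)%N s -> (2 * size (undup s) <= size s)%N.
Proof.
move=> /allP h; rewrite [leqRHS]size_count_undup -sum1_size big_distrr/=.
rewrite big_seq [leqRHS]big_seq leq_sum// => d; rewrite mem_undup => /h; lia.
Qed.

Lemma size_undup2_eq (T : eqType) (s : seq T) :
  all (fun d => 2 <= count_mem d s)%N s -> (size s <= 2 * size (undup s))%N ->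
  all (fun d => count_mem d s == 2) s.
Proof.
move=> /allP h hs; apply/allP => d ds; apply: contraTT hs => cd.
rewrite -ltnNge [ltnRHS]size_count_undup -sum1_size big_distrr/=.
have ds' : d \in undup s by rewrite mem_undup.
rewrite (bigD1_seq d)//= ?undup_uniq// [ltnRHS](bigD1_seq d)//= ?undup_uniq//.
have := h _ ds; rewrite leq_eqVlt eq_sym (negbTE cd)/= => cd3.
rewrite -addSn leq_add// big_seq_cond [leqRHS]big_seq_cond leq_sum// => e /andP[].
by rewrite mem_undup => /h; lia.
Qed.

Lemma size_undup2_all (T : eqType) (s : seq T) :
  all (fun d => count_mem d s == 2) s -> size s = (2 * size (undup s))%N.
Proof.
move=> /allP h; rewrite [LHS]size_count_undup -sum1_size big_distrr/=.
by rewrite big_seq [RHS]big_seq; apply: eq_bigr => d; rewrite mem_undup => /h/eqP.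
Qed.

Definition sint (b : bool) (d : nat) : int := if b then d%:Z else - d%:Z.

Section Walk.
Variable N : nat.
Implicit Types (v a b : 'I_N) (p : seq 'I_N).

Definition lab a b : nat := (maxn a b - minn a b)%N.
Definition sgn a b : bool := (a <= b)%N.
Definition labels v p := pairmap lab v p.
Definition signs v p := pairmap sgn v p.

Lemma size_labels v p : size (labels v p) = size p.
Proof. exact: size_pairmap. Qed.

Lemma size_signs v p : size (signs v p) = size p.
Proof. exact: size_pairmap. Qed.

Lemma lab_lt a b : (lab a b < N)%N.
Proof. by rewrite /lab; case: a b => [a ha] [b hb] /=; lia. Qed.

Lemma labels_lt v p : all (fun d => d < N)%N (labels v p).
Proof. by elim: p v => //= a p IH v; rewrite lab_lt IH. Qed.

Lemma step_eq a b : b%:Z = a%:Z + sint (sgn a b) (lab a b).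
Proof. by rewrite /sint /sgn /lab; case: ifP; lia. Qed.

Definition steps (z : seq (bool * nat)) := [seq sint y.1 y.2 | y <- z].

(** A walk is recovered from its start, signs and step lengths as a sequence of partial sums. *)
Lemma positions v p :
  scanl +%R v%:Z (steps (zip (signs v p) (labels v p))) = [seq (i : 'I_N)%:Z | i <- p].
Proof. by elim: p v => //= a p IH v; rewrite -step_eq IH. Qed.

Lemma walk_inj v p p' : labels v p = labels v p' -> signs v p = signs v p' -> p = p'.
Proof.
move=> hl hs; have := positions v p; rewrite hl hs positions => h.
have hi : injective (fun i : 'I_N => i%:Z) by move=> i j [] /val_inj.
exact: (inj_map hi).
Qed.

Lemma last_pos v p : (last v p)%:Z = v%:Z + \sum_(x <- steps (zip (signs v p) (labels v p))) x.
Proof.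
elim: p v => [|a p IH] v /=; first by rewrite big_nil addr0.
by rewrite IH big_cons addrA -step_eq.
Qed.

(** Steps must be nonzero because [sgn] gives a trivial step the sign [true], so a pair (false, 0)
    could not be read off any walk. *)
Lemma walk_realize v (z : seq (bool * nat)) :
  all (fun u : int => 0 <= u < N%:Z) (scanl +%R v%:Z (steps z)) ->
  all (fun y => 0 < y.2)%N z ->
  exists p, [/\ size p = size z, labels v p = unzip2 z & signs v p = unzip1 z].
Proof.
elim: z v => [|[b d] z IH] v /=; first by exists [::].
move=> /andP[hu hs] /andP[d0 hz].
have hw : (absz (v%:Z + sint b d)%R < N)%N by lia.
have [a ha] : exists a : 'I_N, a%:Z = v%:Z + sint b d.
  by exists (Ordinal hw); rewrite /=; lia.
rewrite -ha in hs; have [p [sp lp gp]] := IH _ hs hz.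
exists (a :: p); split => /=; rewrite ?sp//.
  by rewrite -lp; congr cons; rewrite /lab; move: ha; rewrite /sint; case: b {hu hw} => /=; lia.
by rewrite -gp; congr cons; rewrite /sgn; move: ha; rewrite /sint; case: b {hu hw} => /=; lia.
Qed.

(* A word s preceded by the starting points st of the walks it comes from is recorded
   as a pattern kap (positions of the letters in st ++ undup s) and the values x. *)
Definition kap n o (s : seq nat) : seq 'I_n.+1 :=
  [seq inord (o + index d (undup s))%N | d <- s].

Definition vals n (v0 : 'I_N) (st : seq 'I_N) (s : seq nat) : {ffun 'I_n.+1 -> 'I_N} :=
  [ffun i : 'I_n.+1 => insubd v0 (nth 0 (map val st ++ undup s) i)].

Lemma size_kap n o s : size (kap n o s) = size s.
Proof. exact: size_map. Qed.

Lemma kap_val n o (s : seq nat) d : (o + size (undup s) <= n.+1)%N -> d \in s ->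
  val (inord (o + index d (undup s)) : 'I_n.+1) = (o + index d (undup s))%N.
Proof.
move=> hn ds; rewrite /= inordK//.
have : (index d (undup s) < size (undup s))%N by rewrite index_mem mem_undup.
lia.
Qed.

Lemma vals_kap n v0 st s : (size st + size (undup s) <= n.+1)%N ->
  all (fun d => d < N)%N s ->
  [seq val (vals n v0 st s i) | i <- kap n (size st) s] = s.
Proof.
move=> hn /allP hs; rewrite -map_comp -[RHS]map_id; apply/eq_in_map => d ds /=.
rewrite ffunE kap_val// nth_cat size_map ltnNge leq_addr/= addKn nth_index ?mem_undup//.
by rewrite insubdK// unfold_in hs.
Qed.

Lemma vals_start n v0 st s (i : 'I_n.+1) : (i < size st)%N ->
  vals n v0 st s i = nth v0 st i.
Proof.
move=> hi; apply/val_inj; rewrite ffunE nth_cat size_map hi (nth_map v0)//.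
by rewrite insubdK// unfold_in/=.
Qed.

End Walk.

(** Counting by an encoding: K is the combinatorial part, [Q k] the values allowed for the pattern
    k. The factor c carries a power of N saved by a linear relation between the values. *)
Lemma card_sigma_le (A : finType) (K B : finType) (P : pred A) (Q : K -> {set B})
    (f : A -> K * B) (c n : nat) :
  {in P &, injective f} -> (forall a, P a -> (f a).2 \in Q (f a).1) ->
  (forall k, c * #|Q k| <= n)%N ->
  (c * #|P| <= #|K| * n)%N.
Proof.
move=> fi fQ hn.
have h1 : (#|P| <= \sum_k #|Q k|)%N.
  have -> : (\sum_k #|Q k|)%N = #|[set z : K * B | z.2 \in Q z.1]|.
    rewrite -sum1_card (eq_bigl (fun z => true && (z.2 \in Q z.1))); last by move=> z; rewrite inE.
    rewrite -(pair_big_dep xpredT (fun k b => b \in Q k) (fun=> fun=> 1%N))/=.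
    by apply: eq_bigr => k _; rewrite sum1_card.
  rewrite -(card_in_imset fi); apply/subset_leq_card/fintype.subsetP => z.
  by move=> /imsetP[a Pa ->]; rewrite inE fQ.
rewrite (leq_trans (leq_mul (leqnn c) h1))// big_distrr/= -sum_nat_const.
exact: leq_sum.
Qed.

(** * Encoding and counting walks by their distinct step lengths *)

Notation walk N k := ('I_N * k.-tuple 'I_N)%type.

Section WalkCount.
Variables N k : nat.
Implicit Types w : walk N k.

Definition wl w := labels w.1 w.2.
Definition ws w := signs w.1 w.2.
Definition closed_walk w := last w.1 w.2 == w.1.

Lemma size_wl w : size (wl w) = k.
Proof. by rewrite size_labels size_tuple. Qed.

Lemma size_ws w : size (ws w) = k.
Proof. by rewrite size_signs size_tuple. Qed.

Lemma wl_lt w : all (fun d => d < N)%N (wl w).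
Proof. exact: labels_lt. Qed.

Lemma wlws_inj w w' : w.1 = w'.1 -> wl w = wl w' -> ws w = ws w' -> w = w'.
Proof.
case: w w' => [v p] [v' p'] /= <-; rewrite /wl /ws /= => hl hs.
by congr pair; apply/val_inj/(walk_inj hl hs).
Qed.

Lemma kap_tupleP n o (w : walk N k) : size (@kap n o (wl w)) == k.
Proof. by rewrite size_kap size_wl. Qed.

Lemma ws_tupleP w : size (ws w) == k.
Proof. by rewrite size_ws. Qed.

Definition enc1 r w : (k.-tuple 'I_r.+1 * k.-tuple bool) * {ffun 'I_r.+1 -> 'I_N} :=
  (Tuple (@kap_tupleP r 1 w), Tuple (ws_tupleP w), vals r w.1 [:: w.1] (wl w)).

Lemma enc1_inj r : {in [pred w | size (undup (wl w)) <= r]%N &, injective (enc1 r)}.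
Proof.
move=> w w'; rewrite !inE => hw hw' [hk hs hv].
have s0 : (0 < size [:: w.1])%N by [].
have hw1 : w.1 = w'.1.
  by have /ffunP/(_ ord0) := hv; rewrite !vals_start.
apply: wlws_inj => //.
rewrite -(@vals_kap N r w.1 [:: w.1] (wl w)) ?wl_lt//.
by rewrite hv [kap _ _ _]hk (@vals_kap N r w'.1 [:: w'.1] (wl w')) ?wl_lt.
Qed.

(** Patterns and signs range over a set independent of N; only the r + 1 values, the start and at
    most r step lengths, bring powers of N. *)
Lemma card_few_labels r :
  (#|[pred w | size (undup (wl w)) <= r]%N| <=
   #|{: k.-tuple 'I_r.+1 * k.-tuple bool}| * N ^ r.+1)%N.
Proof.
rewrite -[X in (X <= _)%N]mul1n.
apply: (@card_sigma_le _ _ _ _ (fun=> [set: {ffun 'I_r.+1 -> 'I_N}]) (enc1 r)).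
- exact: enc1_inj.
- by move=> w _; rewrite inE.
- by move=> _; rewrite mul1n cardsT card_ffun !card_ord.
Qed.

Definition pl (z : walk N k * walk N k) := wl z.1 ++ wl z.2.
Definition ps (z : walk N k * walk N k) := ws z.1 ++ ws z.2.

Lemma pkap_tupleP n z : size (@kap n 2 (pl z)) == (k + k)%N.
Proof. by rewrite size_kap size_cat !size_wl. Qed.

Lemma ps_tupleP z : size (ps z) == (k + k)%N.
Proof. by rewrite size_cat !size_ws. Qed.

Lemma pl_lt z : all (fun d => d < N)%N (pl z).
Proof. by rewrite all_cat !wl_lt. Qed.

(** Both walks are encoded as one word with a common pattern, so that shared step lengths become
    shared coordinates; two coordinates are kept for the two starts. *)
Definition enc2 r z : ((k + k).-tuple 'I_r.+2 * (k + k).-tuple bool) * {ffun 'I_r.+2 -> 'I_N} :=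
  (Tuple (@pkap_tupleP r.+1 z), Tuple (ps_tupleP z), vals r.+1 z.1.1 [:: z.1.1; z.2.1] (pl z)).

Lemma enc2_inj r : {in [pred z | size (undup (pl z)) <= r]%N &, injective (enc2 r)}.
Proof.
move=> z z'; rewrite !inE => hz hz' [hk hs hv].
have hz1 : z.1.1 = z'.1.1.
  by have /ffunP/(_ (@Ordinal r.+2 0 isT)) := hv; rewrite !vals_start.
have hz2 : z.2.1 = z'.2.1.
  by have /ffunP/(_ (@Ordinal r.+2 1 isT)) := hv; rewrite !vals_start.
have hl : pl z = pl z'.
  rewrite -(@vals_kap N r.+1 z.1.1 [:: z.1.1; z.2.1] (pl z)) ?pl_lt//.
  by rewrite hv [kap _ _ _]hk (@vals_kap N r.+1 z'.1.1 [:: z'.1.1; z'.2.1] (pl z')) ?pl_lt.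
move/eqP: hl; rewrite eqseq_cat ?size_wl// => /andP[/eqP hl1 /eqP hl2].
move/eqP: hs; rewrite eqseq_cat ?size_ws// => /andP[/eqP hs1 /eqP hs2].
move: z z' {hz hz' hk hv} hz1 hz2 hl1 hl2 hs1 hs2 => [z1 z2] [z1' z2'] /= *.
by congr pair; apply: wlws_inj.
Qed.

Lemma card_few_pair_labels r :
  (#|[pred z | size (undup (pl z)) <= r]%N| <=
   #|{: (k + k).-tuple 'I_r.+2 * (k + k).-tuple bool}| * N ^ r.+2)%N.
Proof.
rewrite -[X in (X <= _)%N]mul1n.
apply: (@card_sigma_le _ _ _ _ (fun=> [set: {ffun 'I_r.+2 -> 'I_N}]) (enc2 r)).
- exact: enc2_inj.
- by move=> w _; rewrite inE.
- by move=> _; rewrite mul1n cardsT card_ffun !card_ord.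
Qed.

End WalkCount.

(** * Partial sums of a walk as linear forms in its values *)

Lemma map_zip_snd (A B C : Type) (f : B -> C) (s : seq A) (t : seq B) :
  [seq (y.1, f y.2) | y <- zip s t] = zip s (map f t).
Proof. by elim: s t => [|a s IH] [|b t] //=; rewrite IH. Qed.

Section ClosingForm.
Variable I : finType.
Implicit Types (y : bool * I) (z : seq (bool * I)).

Definition fstep y : {ffun I -> int} := if y.1 then delta y.2 else - delta y.2.
Definition fsteps z := [seq fstep y | y <- z].

Lemma lin_fstep N (x : {ffun I -> 'I_N}) y : lin (fstep y) x = sint y.1 (x y.2).
Proof. by rewrite /fstep /sint; case: ifP => _; rewrite ?linN lin_delta. Qed.

Lemma lin_sum N (x : {ffun I -> 'I_N}) (s : seq {ffun I -> int}) :
  lin (\sum_(a <- s) a) x = \sum_(a <- s) lin a x.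
Proof.
elim: s => [|a s IH]; first by rewrite !big_nil lin0.
by rewrite !big_cons linD IH.
Qed.

Lemma lin_fsteps N (x : {ffun I -> 'I_N}) z :
  lin (\sum_(a <- fsteps z) a) x =
  \sum_(e <- steps [seq (y.1, val (x y.2)) | y <- z]) e.
Proof.
rewrite lin_sum /fsteps /steps !big_map; apply: eq_bigr => y _.
by rewrite lin_fstep.
Qed.

Lemma lin_scanl N (x : {ffun I -> 'I_N}) a z :
  [seq lin b x | b <- scanl +%R a (fsteps z)] =
  scanl +%R (lin a x) (steps [seq (y.1, val (x y.2)) | y <- z]).
Proof.
elim: z a => //= y z IH a; rewrite IH linD lin_fstep.
by [].
Qed.

(* The coefficient of i in the sum of the steps has the parity of the number of steps labelled i. *)
Lemma closing_parity z i : exists c : int,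
  (\sum_(a <- fsteps z) a) i = (count_mem i (unzip2 z))%:Z + 2 * c.
Proof.
elim: z => [|[b j] z [c hc]]; first by exists 0; rewrite big_nil ffunE.
rewrite big_cons ffunE {}hc /fstep/= eq_sym.
case: b; rewrite ?ffunE/=; case: eqVneq => _ /=.
- by exists c; rewrite addrA -PoszD.
- by exists c; lia.
- by exists (c - 1); rewrite add1n; lia.
- by exists c; lia.
Qed.

(** By parity the coefficient of a letter used once is odd. *)
Lemma closing_neq0 z i : count_mem i (unzip2 z) = 1%N -> \sum_(a <- fsteps z) a != 0.
Proof.
move=> h; apply/eqP => e; have [c] := closing_parity z i; rewrite e h ffunE; lia.
Qed.

End ClosingForm.

(** * Pairs of closed walks sharing a step length *)

Section LinkedPairs.
Variable k : nat.

(** The pairs that can contribute to the covariance: without a common letter independence factors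
    the expectation, and a letter occurring only once makes it vanish by centering. *)
Definition linked N := [pred z : walk N k * walk N k |
  [&& closed_walk z.1, closed_walk z.2, has (mem (wl z.1)) (wl z.2) &
      all (fun d => 2 <= count_mem d (pl z))%N (pl z)]].

Definition tight N := [pred z : walk N k * walk N k |
  [&& linked N z, size (undup (pl z)) == k & all (fun d => count_mem d (pl z) == 2) (pl z)]].

Let form (c : (k + k).-tuple 'I_k.+2 * (k + k).-tuple bool) : {ffun 'I_k.+2 -> int} :=
  \sum_(a <- fsteps (zip (take k c.2) (take k c.1))) a.

(** A length shared by the two walks occurs twice in all, hence exactly once in the first. Its
    coefficient in the closing form of the first walk is then odd, and the relation that the values
    satisfy is not trivial. *)
Lemma tight_form N (z : walk N k * walk N k) : tight N z ->
  form (enc2 k z).1 != 0 /\ lin (form (enc2 k z).1) (enc2 k z).2 = 0.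
Proof.
move=> /andP[/and4P[c1 c2 /hasP[d /= d2 d1] _] /andP[/eqP sz /allP all2]].
set phi := fun d => inord (2 + index d (undup (pl z))) : 'I_k.+2.
have sub : {subset wl z.1 <= pl z} by move=> e; rewrite mem_cat => ->.
have hn : (2 + size (undup (pl z)) <= k.+2)%N by rewrite sz.
have tk : take k (kap k.+1 2 (pl z)) = map phi (wl z.1).
  by rewrite /kap -map_take take_size_cat ?size_wl.
have ts : take k (ps z) = ws z.1 by rewrite take_size_cat ?size_ws.
rewrite /form /= tk ts.
have phi_inj : {in pl z &, injective phi}.
  move=> a b az bz /(congr1 val); rewrite (kap_val hn az) (kap_val hn bz).
  move=> /eqP; rewrite eqn_add2l => /eqP.
  rewrite -(mem_undup (pl z)) in az; rewrite -(mem_undup (pl z)) in bz.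
  by move=> /(congr1 (nth 0%N (undup (pl z)))); rewrite !nth_index.
split.
  apply: (@closing_neq0 _ _ (phi d)).
  rewrite unzip2_zip ?size_map ?size_wl ?size_ws//.
  rewrite (count_map_in sub (sub _ d1) phi_inj).
  have := all2 _ (sub _ d1); rewrite /pl count_cat => /eqP.
  have p1 : (0 < count_mem d (wl z.1))%N by rewrite -has_count has_pred1.
  have p2 : (0 < count_mem d (wl z.2))%N by rewrite -has_count has_pred1.
  by move: p1 p2; set a := count_mem _ _; set b := count_mem _ _; lia.
rewrite lin_fsteps.
have -> : [seq (y.1, val (vals k.+1 z.1.1 [:: z.1.1; z.2.1] (pl z) y.2)) |
             y <- zip (ws z.1) (map phi (wl z.1))] = zip (ws z.1) (wl z.1).
  have := @vals_kap N k.+1 z.1.1 [:: z.1.1; z.2.1] (pl z) hn (pl_lt z).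
  move=> /(congr1 (take k)); rewrite -map_take tk [RHS]take_size_cat ?size_wl//.
  by move=> h; rewrite (map_zip_snd (fun i => val (vals k.+1 z.1.1 [:: z.1.1; z.2.1] (pl z) i))) h.
have := last_pos z.1.1 z.1.2; rewrite (eqP c1) => /eqP.
by rewrite -[X in X == _]addr0 (inj_eq (addrI _)) => /eqP <-.
Qed.

(** At most k - 1 distinct lengths leave k + 1 free values. With k distinct lengths there are k + 2
    values, but [tight_form] confines them to a hyperplane. Both counts are O(N^(k+1)). *)
Lemma card_linked : exists C, forall N, (N * #|linked N| <= C * N ^ k.+2)%N.
Proof.
exists (#|{: (k + k).-tuple 'I_k.+2 * (k + k).-tuple bool}| +
  #|{: (k + k).-tuple 'I_k.-1.+2 * (k + k).-tuple bool}|)%N => N.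
case: (posnP k) => k0.
  rewrite (eq_card0 (A := linked N)) ?muln0// => z; rewrite !inE; apply/negP.
  move=> /and4P[_ _ + _]; have : size (wl z.2) = 0%N by rewrite size_wl k0.
  by move/size0nil ->.
have h : (#|linked N| <= #|tight N| + #|[pred z : walk N k * walk N k | size (undup (pl z)) <= k.-1]%N|)%N.
  rewrite -cardUI; apply: leq_trans (leq_addr _ _).
  apply/subset_leq_card/fintype.subsetP => z; rewrite !inE => hz.
  rewrite hz/=; have /and4P[_ _ _ h2] := hz.
  have sz : size (pl z) = (2 * k)%N by rewrite size_cat !size_wl mul2n addnn.
  have := size_undup2 h2; rewrite sz leq_mul2l/= leq_eqVlt => /predU1P[e|].
    by rewrite e eqxx/= (size_undup2_eq h2)// sz e.
  by move=> hlt; apply/orP; right; lia.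
rewrite (leq_trans (leq_mul (leqnn N) h))// mulnDr mulnDl leq_add//; last first.
  rewrite (leq_trans (leq_mul (leqnn N) (card_few_pair_labels _ _ _)))//.
  by rewrite mulnCA -expnS (prednK k0).
(* Codes with vanishing form are assigned the empty set, which is legitimate since no tight pair has
   such a code. *)
apply: (@card_sigma_le _ _ _ _
  (fun c => [set x : {ffun 'I_k.+2 -> 'I_N} | (form c != 0) && (lin (form c) x == 0)]) (enc2 k)).
- move=> z z'; rewrite !inE => /and3P[_ sz _] /and3P[_ sz' _].
  by apply: enc2_inj; rewrite inE (eqP sz, eqP sz').
- by move=> z hz; have [h1 h2] := tight_form hz; rewrite inE h1 h2 eqxx.
move=> c; case: (eqVneq (form c) 0) => [_|f0] /=.
  by rewrite eq_card0 ?muln0// => x; rewrite !inE.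
have [i fi] : exists i, form c i != 0.
  apply/existsP; apply: contraNT f0 => /existsPn h'; apply/eqP/ffunP => i.
  by rewrite ffunE; apply/eqP; have := h' i; rewrite negbK.
by have := card_hyperplane N 0 fi; rewrite card_ord.
Qed.

End LinkedPairs.

Local Close Scope ring_scope.

(** * Upper bound for the number of matched walks *)

Definition matched (s : seq nat) := (0%N \notin s) && all (fun d => count_mem d s == 2) s.

Definition mwalks m N := [pred w : walk N (2 * m) | closed_walk w && matched (wl w)].

Section EvenWords.
Variable N : nat.

Definition evenw (s : seq 'I_N) := all (fun d => ~~ odd (count_mem d s)) s.

Lemma evenwP s : reflect (forall d, ~~ odd (count_mem d s)) (evenw s).
Proof.
apply: (iffP allP) => h d; last by move=> _; exact: h.
by case: (boolP (d \in s)) => [/h//|/count_memPn ->].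
Qed.

(** The first letter reappears later; deleting it together with its next occurrence leaves an even
    word. The letter (N choices) and the place of that occurrence (n + 1 choices) undo the
    deletion. *)
Lemma card_evenw n :
  #|[pred t : n.+2.-tuple 'I_N | evenw t]| <= n.+1 * N * #|[pred t : n.-tuple 'I_N | evenw t]|.
Proof.
pose f (t : n.+2.-tuple 'I_N) : ('I_n.+1 * 'I_N) * n.-tuple 'I_N :=
  (inord (index (thead t) (behead t)), thead t,
   insubd (nseq_tuple n (thead t)) (rem (thead t) (behead t))).
have fE (t : n.+2.-tuple 'I_N) : evenw t -> exists a s,
    [/\ val t = a :: s, a \in s, val (f t).1.1 = index a s,
      (f t).1.2 = a & val (f t).2 = rem a s].
  case/tupleP: t => a s /evenwP h; exists a, s.
  have as' : a \in tval s.
    by have := h a; rewrite /= eqxx -has_pred1 has_count; case: count => //.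
  split=> //=; rewrite ?theadE//.
    by rewrite inordK// -{2}(size_tuple s) index_mem.
  by rewrite insubdK// unfold_in/= size_rem// size_tuple.
rewrite -[X in X <= _]mul1n.
have -> : n.+1 * N = #|{: 'I_n.+1 * 'I_N}| by rewrite card_prod !card_ord.
apply: (@card_sigma_le _ _ _ _ (fun=> [set t : n.-tuple 'I_N | evenw t]) f).
- move=> t t' /fE[a [s [ht as' h1 h2 h3]]] /fE[a' [s' [ht' as'' h1' h2' h3']]] e.
  have aa : a' = a by rewrite -h2' -e h2.
  move: h1' h3' as'' ht'; rewrite {}aa -e h1 h3 => h1' h3' as'' ht'.
  apply/val_inj; rewrite ht ht'; congr cons.
  rewrite -(cat_take_drop (index a s) s) (drop_nth a) ?index_mem// nth_index//.
  rewrite -[RHS](cat_take_drop (index a s') s') [in RHS](drop_nth a) ?index_mem// nth_index//.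
  have hs : index a s <= size s by rewrite index_size.
  have hs' : index a s <= size s' by rewrite h1' index_size.
  move/eqP: h3'; rewrite !remE -h1' eqseq_cat ?size_takel//.
  by move=> /andP[/eqP -> /eqP ->].
- move=> t ht; have [a [s [hs as' _ _ h]]] := fE t ht; rewrite inE h.
  have /evenwP he := ht; apply/evenwP => d; have := he d; rewrite hs count_rem/= as'.
  case: (eqVneq a d) as' => [->|] as' /=; last by rewrite subn0.
  have : 0 < count_mem d s by rewrite -has_count has_pred1.
  by case: (count_mem d s) => //= c _; rewrite subn1/= negbK.
by move=> _; rewrite mul1n cardsE.
Qed.

(** Iterating the deletion gives the product of the odd numbers below 2 m, the number of perfect
    matchings; each factor 2 j + 1 is bounded by 2 (j + 1). *)
Lemma card_evenw_le m :
  #|[pred t : (2 * m).-tuple 'I_N | evenw t]| <= 2 ^ m * m`! * N ^ m.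
Proof.
elim: m => [|m IH].
  by rewrite (leq_trans (max_card _))// card_tuple.
have -> : 2 * m.+1 = (2 * m).+2 by lia.
rewrite (leq_trans (card_evenw _))// (leq_trans (leq_mul (leqnn _) IH))//.
rewrite !expnS factS; nia.
Qed.

(** The start contributes N, the directions 4^m, and the word of step lengths, whose letters all
    have multiplicity two, at most 2^m m! N^m. *)
Lemma card_mwalks_le m : #|mwalks m N| <= 8 ^ m * m`! * N ^ m.+1.
Proof.
case: (posnP N) => [N0|N0].
  by rewrite eq_card0// => -[[i hi]]; exfalso; rewrite N0 in hi.
pose o0 := Ordinal N0.
pose g (w : walk N (2 * m)) : (2 * m).-tuple 'I_N :=
  insubd (nseq_tuple (2 * m) o0) (map (insubd o0) (wl w)).
have gE w : val (g w) = map (insubd o0) (wl w).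
  by rewrite insubdK// unfold_in/= size_map size_wl.
have hv s : all (fun d => d < N) s -> map val (map (insubd o0) s) = s.
  move=> /allP h; rewrite -map_comp -[RHS]map_id; apply/eq_in_map => d /h hd /=.
  by rewrite insubdK.
pose f w := (w.1, Tuple (ws_tupleP w), g w) : ('I_N * (2 * m).-tuple bool) * (2 * m).-tuple 'I_N.
rewrite -[X in X <= _]mul1n.
have -> : 8 ^ m * m`! * N ^ m.+1 = #|{: 'I_N * (2 * m).-tuple bool}| * (2 ^ m * m`! * N ^ m).
  rewrite card_prod card_ord card_tuple card_bool expnS expnM.
  by rewrite -[8]/(4 * 2) expnMn; ring.
apply: (@card_sigma_le _ _ _ _ (fun=> [set t : (2 * m).-tuple 'I_N | evenw t]) f).
- move=> w w' _ _ [h1 h2 h3]; apply: wlws_inj => //.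
  by rewrite -(hv _ (wl_lt w)) -gE h3 gE hv ?wl_lt.
- move=> w /andP[_ /andP[_ /allP h]]; rewrite inE gE; apply/allP => _ /mapP[d dw ->].
  rewrite (@count_map_in _ _ _ _ (wl w))// ?(eqP (h _ dw))//.
  move=> a b aw bw /(congr1 val); rewrite !insubdK ?unfold_in//;
  exact: (allP (wl_lt w)).
by move=> _; rewrite mul1n cardsE card_evenw_le.
Qed.

End EvenWords.

(** * Lower bound for the number of matched walks *)

Section FreshWalks.
Variable N : nat.
Implicit Types (v a b : 'I_N).

Lemma lab_sgn_inj a b b' : lab a b = lab a b' -> sgn a b = sgn a b' -> b = b'.
Proof.
move=> h1 h2; apply/val_inj; have := step_eq a b; have := step_eq a b'.
by rewrite h1 h2 => <- [].
Qed.

(** Each forbidden length excludes at most two neighbours of [a], one in each direction. *)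
Lemma card_fresh a (U : seq nat) : uniq U ->
  N - 2 * size U <= #|[pred b | lab a b \notin U]|.
Proof.
move=> uU.
have e : #|[pred b | lab a b \in U]| + #|[pred b | lab a b \notin U]| = N.
  by rewrite -[RHS]card_ord -(cardC [pred b | lab a b \in U]).
rewrite -{1}e leq_subLR leq_add2r.
pose L := [seq (e, d) | e <- [:: true; false], d <- U].
have <- : size L = 2 * size U by rewrite size_allpairs.
rewrite cardE -(size_map (fun b => (sgn a b, lab a b))); apply: uniq_leq_size.
  rewrite map_inj_uniq ?enum_uniq// => b b' [h1 h2]; exact: lab_sgn_inj h2 h1.
move=> x /mapP[b]; rewrite mem_enum inE => hb {x}->; apply/allpairsP.
by exists (sgn a b, lab a b); split => //=; case: sgn; rewrite !inE.
Qed.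

Lemma card_fresh_paths k a (U : seq nat) : uniq U ->
  (N - 2 * (k + size U)) ^ k <= #|[pred p : k.-tuple 'I_N | uniq (labels a p ++ U)]|.
Proof.
elim: k a U => [|k IH] a U uU.
  by rewrite expn0; apply/card_gt0P; exists [tuple]; rewrite !inE.
pose A := [set z : 'I_N * k.-tuple 'I_N | (lab a z.1 \notin U) &&
  uniq (labels z.1 z.2 ++ lab a z.1 :: U)].
pose f (z : 'I_N * k.-tuple 'I_N) : k.+1.-tuple 'I_N := cons_tuple z.1 z.2.
have finj : {in A &, injective f}.
  move=> [b p] [b' p'] _ _ /(congr1 val) [-> hp]; congr pair; exact/val_inj.
apply: (@leq_trans #|A|); last first.
  rewrite -(card_in_imset finj); apply/subset_leq_card/fintype.subsetP => _ /imsetP[[b p] + ->].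
  by rewrite !inE /= => /andP[_]; rewrite -[lab a b :: U]cat1s uniq_catCA.
have -> : #|A| = \sum_(b | lab a b \notin U) #|[pred p : k.-tuple 'I_N | uniq (labels b p ++ lab a b :: U)]|.
  rewrite -sum1_card (eq_bigl (fun z : 'I_N * k.-tuple 'I_N => (lab a z.1 \notin U) &&
    uniq (labels z.1 z.2 ++ lab a z.1 :: U))); last by move=> z; rewrite inE.
  rewrite -(pair_big_dep (fun b => lab a b \notin U)
    (fun b (p : k.-tuple 'I_N) => uniq (labels b p ++ lab a b :: U)) (fun _ _ => 1%N))/=.
  by apply: eq_bigr => b _; rewrite sum1_card.
rewrite expnS.
apply: (@leq_trans (\sum_(b | lab a b \notin U) (N - 2 * (k.+1 + size U)) ^ k)); last first.
  apply: leq_sum => b hb; rewrite addSnnS.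
  by apply: IH; rewrite /= hb.
rewrite sum_nat_const leq_mul//; apply: leq_trans (card_fresh a uU).
by lia.
Qed.

(** The appended 0 makes a single [uniq] say that the step lengths are distinct and nonzero. *)
Definition uwalks k := [pred w : walk N k | uniq (rcons (wl w) 0%N)].

Lemma card_uwalks k : (N - 2 * k.+1) ^ k.+1 <= #|uwalks k|.
Proof.
have -> : #|uwalks k| = \sum_(v : 'I_N) #|[pred p : k.-tuple 'I_N | uniq (labels v p ++ [:: 0])]|.
  rewrite -sum1_card (eq_bigl (fun z : walk N k => true &&
    uniq (labels z.1 z.2 ++ [:: 0]))); last by move=> z; rewrite !inE cats1.
  rewrite -(pair_big_dep xpredT
    (fun b (p : k.-tuple 'I_N) => uniq (labels b p ++ [:: 0])) (fun _ _ => 1%N))/=.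
  by apply: eq_bigr => b _; rewrite sum1_card.
apply: (@leq_trans (\sum_(v : 'I_N) (N - 2 * k.+1) ^ k)).
  by rewrite sum_nat_const card_ord expnS leq_mul// leq_subr.
by apply: leq_sum => v _; apply: leq_trans (@card_fresh_paths _ _ [:: 0] _); rewrite ?addn1.
Qed.

Lemma labC a b : lab a b = lab b a.
Proof. by rewrite /lab maxnC minnC. Qed.

Definition back v (p : seq 'I_N) := rev (belast v p).

Lemma labels_back v p : labels (last v p) (back v p) = rev (labels v p).
Proof.
rewrite /back /labels; elim/last_ind: p => [//|p x IH].
rewrite last_rcons belast_rcons -!cats1 pairmap_cat rev_cat /= -IH.
by rewrite lastI rev_rcons /= labC.
Qed.

Lemma last_back v p : last (last v p) (back v p) = v.
Proof. by rewrite /back; case: p => //= x p; rewrite rev_cons last_rcons. Qed.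

Lemma back_inj v p p' : size p = size p' -> last v p = last v p' -> back v p = back v p' -> p = p'.
Proof.
move=> sp lp /(congr1 rev); rewrite /back !revK => bp.
by have := lastI v p; rewrite bp lp -lastI => -[].
Qed.

End FreshWalks.

Section Keys.
Variables N m : nat.
Implicit Types w : walk N m.

Definition lset w : {set 'I_N} := [set d : 'I_N | val d \in wl w].
Definition key w := (w.1, last w.1 w.2, lset w).

(* A walk followed by a reversed one is closed and matched when both have distinct step
   lengths and the same key; Cauchy-Schwarz over keys bounds the number of such pairs below. *)
Lemma card_pairs_le : #|[pred z : walk N m * walk N m |
    [&& z.1 \in uwalks N m, z.2 \in uwalks N m & key z.1 == key z.2]]| <= #|mwalks m N|.
Proof.
have tp (z : walk N m * walk N m) : size (z.1.2 ++ back z.2.1 z.2.2) == 2 * m.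
  by rewrite size_cat size_rev size_belast !size_tuple mul2n addnn.
pose f z : walk N (2 * m) := (z.1.1, Tuple (tp z)).
rewrite -(@card_in_imset _ _ f); last first.
  move=> [[v p] [v' p']] [[u q] [u' q']]; rewrite !inE /=.
  move=> /and3P[_ _ /eqP[vv' ll' _]] /and3P[_ _ /eqP[uu' kk' _]]; subst v' u'.
  move=> [vu] /eqP; rewrite eqseq_cat ?size_tuple// => /andP[/eqP pq /eqP].
  subst u; move: (val_inj pq) => {}pq; subst q.
  move=> /back_inj; rewrite !size_tuple -ll' -kk' => /(_ erefl erefl) /val_inj ->.
  by [].
apply/subset_leq_card/fintype.subsetP => _ /imsetP[[[v p] [v' p']] + ->].
rewrite !inE /= => /and3P[up up' /eqP[vv' ll' kk']]; subst v'.
rewrite /closed_walk /= last_cat ll' last_back eqxx /=.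
have wE : wl (f (v, p, (v, p'))) = wl (v, p) ++ rev (wl (v, p')).
  by rewrite /wl /f /= /labels pairmap_cat ll'; congr cat; exact: labels_back.
have hmem d : (d \in wl (v, p)) = (d \in wl (v, p')).
  have [hd|hd] := ltnP d N.
    by move/setP/(_ (Ordinal hd)): kk'; rewrite !inE.
  by apply/idP/idP => /(allP (wl_lt _)) /=; rewrite ltnNge hd.
move: up up'; rewrite !rcons_uniq => /andP[n0 up] /andP[n0' up'].
rewrite wE; apply/andP; split; first by rewrite mem_cat mem_rev negb_or n0.
apply/allP => d; rewrite mem_cat mem_rev -hmem orbb => hd.
by rewrite count_cat count_rev !count_uniq_mem// -hmem hd.
Qed.

(** Cauchy-Schwarz for the fibre sizes [c k]: their sum is [#|A|], and the sum of their squares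
    counts the pairs lying in a common fibre. *)
Lemma pairs_cauchy (T K : finType) (A : {pred T}) (f : T -> K) :
  #|A| ^ 2 <= #|[set f x | x in A]| * #|[pred z : T * T | [&& z.1 \in A, z.2 \in A & f z.1 == f z.2]]|.
Proof.
pose c (k : K) := #|[pred x in A | f x == k]|.
set F := [set f x | x in A].
have hA : #|A| = \sum_(k in F) c k.
  rewrite -sum1_card (partition_big f (mem F)) => [|x xA]; last exact: imset_f.
  by apply: eq_bigr => k _; rewrite /c -sum1_card; apply: eq_bigl => x; rewrite !inE.
have hP : #|[pred z : T * T | [&& z.1 \in A, z.2 \in A & f z.1 == f z.2]]| = \sum_(k in F) c k ^ 2.
  rewrite -sum1_card (partition_big (fun z => f z.1) (mem F)) => [|z /and3P[zA _ _]]; last exact: imset_f.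
  apply: eq_bigr => k _.
  have -> : c k ^ 2 = #|setX [set x in A | f x == k] [set x in A | f x == k]|.
    by rewrite cardsX !cardsE mulnn.
  rewrite -sum1_card; apply: eq_bigl => -[x y]; rewrite !inE /=.
  case: (x \in A); case: (y \in A) => //=; rewrite ?andbF//.
  by case: (eqVneq (f x) k) => [->|_]; rewrite ?andbF ?andbT// eq_sym.
rewrite hP hA -mulnn big_distrlr/=.
(* Doubling reduces the claim to 2 x y <= x^2 + y^2 for each pair of fibres. *)
rewrite -(leq_pmul2l (isT : 0 < 2)) big_distrr/=.
have -> : 2 * (#|F| * \sum_(k in F) c k ^ 2) = \sum_(k in F) \sum_(k' in F) (c k ^ 2 + c k' ^ 2).
  under [RHS]eq_bigr do rewrite big_split/= sum_nat_const.
  by rewrite big_split/= -big_distrr/= sum_nat_const mul2n addnn.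
by apply: leq_sum => k _; rewrite big_distrr/=; apply: leq_sum => k' _; exact: nat_Cauchy.
Qed.

Local Open Scope ring_scope.

(** The end of a walk with distinct lengths is determined by the start, the set of lengths and the
    subset of upward steps: N starts, at most N^m / m! sets and 2^m subsets. *)
Lemma card_keys_le : (m`! * #|[set key w | w in uwalks N m]| <= N ^ m.+1 * 2 ^ m)%N.
Proof.
pose D := [set z : {set 'I_N} * {set 'I_N} | (#|z.1| == m) && (z.2 \subset z.1)].
have cD : (m`! * #|D| <= N ^ m * 2 ^ m)%N.
  have -> : #|D| = (\sum_(S : {set 'I_N} | #|S| == m) 2 ^ m)%N.
    rewrite -sum1_card (eq_bigl (fun z : {set 'I_N} * {set 'I_N} => (#|z.1| == m) && (z.2 \subset z.1))); last by move=> z; rewrite inE.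
    rewrite -(pair_big_dep (fun S : {set 'I_N} => #|S| == m) (fun (S T : {set 'I_N}) => T \subset S) (fun _ _ => 1%N))/=.
    apply: eq_bigr => S /eqP <-; rewrite -card_powerset -sum1_card.
    by apply: eq_bigl => T; rewrite powersetE.
  rewrite sum_nat_const -(cardsE (fun S : {set 'I_N} => #|S| == m)) card_draws card_ord mulnA leq_mul//.
  rewrite mulnC bin_ffact ffact_prod -[X in (_ <= _ ^ X)%N]card_ord -prod_nat_const.
  by apply: leq_prod => i _; exact: leq_subr.
(* Here [z.2.1] is the set of lengths and [z.2.2] the upward ones; the default of [insubd] is not
   reached on actual walks, whose signed sum ends in [0, N). *)
pose g (z : 'I_N * ({set 'I_N} * {set 'I_N})) : 'I_N * 'I_N * {set 'I_N} :=
  (z.1, insubd z.1 (absz (z.1%:Z + \sum_(d in z.2.1) sint (d \in z.2.2) d)), z.2.1).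
suff h : [set key w | w in uwalks N m] \subset g @: setX setT D.
  rewrite expnS -mulnA (leq_trans (leq_mul (leqnn _) (subset_leq_card h)))//.
  rewrite (leq_trans (leq_mul (leqnn _) (leq_imset_card _ _)))// cardsX cardsT card_ord.
  by rewrite mulnCA leq_mul.
apply/fintype.subsetP => _ /imsetP[w + ->]; rewrite inE rcons_uniq => /andP[_ uw].
pose o := map (insubd w.1) (wl w).
have oE : map val o = wl w.
  rewrite -map_comp -[RHS]map_id; apply/eq_in_map => d /(allP (wl_lt w)) hd /=.
  by rewrite insubdK.
have uo : uniq o by rewrite -(map_inj_uniq val_inj) oE.
have lo d : (d \in lset w) = (d \in o) by rewrite inE -oE (mem_map val_inj).
pose T := [set d : 'I_N | (d \in o) && nth false (ws w) (index d o)].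
apply/imsetP; exists (w.1, (lset w, T)).
  rewrite !inE /=; apply/andP; split.
    have -> : #|lset w| = #|o| by apply: eq_card.
    by rewrite (card_uniqP uo) size_map size_wl.
  by apply/fintype.subsetP => d; rewrite lo inE => /andP[].
rewrite /g /key /=; congr (_, _, _).
have -> : \sum_(d in lset w) sint (d \in T) d = \sum_(x <- steps (zip (ws w) (wl w))) x.
  rewrite /steps big_map -oE.
  have -> : zip (ws w) (map val o) = [seq (nth false (ws w) (index d o), val d) | d <- o].
    have so : size o = m by rewrite /o size_map size_wl.
    rewrite -zip_map; congr zip; apply: (@eq_from_nth _ false).
      by rewrite size_ws (size_map _ o) so.
    by move=> i; rewrite size_ws => hi; rewrite (nth_map w.1) ?so// index_uniq// so.
  rewrite big_map (big_uniq _ uo)/=; rewrite (eq_bigl (mem o)) => [|d]; last exact: lo.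
  by apply: eq_bigr => d dw; rewrite inE (dw : d \in o).
rewrite -last_pos absz_nat; apply/val_inj; rewrite insubdK// unfold_in/=.
exact: ltn_ord.
Qed.

(** To leading order this reads #|mwalks m N| >= N^(m+1) m! / 2^m: the squared number of walks with
    distinct lengths, divided by the number of keys. *)
Lemma card_mwalks_ge : (m`! * ((N - 2 * m.+1) ^ m.+1) ^ 2 <= N ^ m.+1 * 2 ^ m * #|mwalks m N|)%N.
Proof.
have h := @pairs_cauchy _ _ (uwalks N m) key.
apply: (@leq_trans (m`! * #|uwalks N m| ^ 2)%N).
  by rewrite leq_mul// leq_sqr card_uwalks.
rewrite (leq_trans (leq_mul (leqnn _) h))// mulnA leq_mul ?card_keys_le//.
exact: card_pairs_le.
Qed.

End Keys.

From mathcomp Require Import all_classical all_reals all_analysis measurable_realfun.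
Import numFieldNormedType.Exports.

Local Open Scope classical_set_scope.
Local Open Scope ring_scope.

(** * Limits of normalized counts of integer points *)

Lemma cvgnP (R : realType) (u : nat -> R) (l : R) :
  u @ \oo --> l <->
  (forall e, 0 < e -> exists n0, forall n, (n0 <= n)%N -> `|u n - l| <= e).
Proof.
split=> [/cvgrPdist_le h e e0|h].
  have [n0 _ hn] := h e e0; exists n0 => n n0n.
  by rewrite distrC; exact: hn.
apply/cvgrPdist_le => e e0; have [n0 hn] := h e e0.
by exists n0 => // n /= n0n; rewrite distrC hn.
Qed.

Lemma inv_small (R : realType) (C e : R) : 0 < e ->
  exists n0, forall n, (n0 <= n)%N -> (0 < n)%N /\ C / n%:R <= e.
Proof.
move=> e0; exists (Num.truncn (`|C| / e)).+1 => n hn.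
have n0 : (0 < n)%N by apply: leq_trans hn.
split=> //; rewrite ler_pdivrMr ?ltr0n//.
have : `|C| / e <= n%:R.
  apply: ltW; apply: lt_le_trans (_ : (Num.truncn (`|C| / e)).+1%:R <= _).
    by rewrite truncnS_gt.
  by rewrite ler_nat.
by rewrite ler_pdivrMr// mulrC => /(le_trans (ler_norm _)).
Qed.

(** Two terms u n and u n' are both compared with u (n n'), whence the Cauchy property. *)
Lemma scaling_cvg (R : realType) (u : nat -> R) (C : R) :
  (forall N M, (0 < M)%N -> (0 < N)%N -> `|u (M * N)%N - u N| <= C / N%:R) ->
  exists l : R, u @ \oo --> l.
Proof.
move=> h.
suff : cvgn u by move=> /cvg_ex[l hl]; exists l.
apply/cauchy_cvgP/cauchy_exP => e e0.
have [n0 hn0] := @inv_small R C (e / 4) ltac:(by rewrite divr_gt0).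
exists (u n0.+1); exists n0.+1 => // n /= n0n; rewrite -ball_normE/=.
have [n_gt0 hn] := hn0 n (ltnW n0n); have [m_gt0 hm] := hn0 n0.+1 (leqnSn _).
have := h n n0.+1 m_gt0 n_gt0; have := h n0.+1 n n_gt0 m_gt0; rewrite mulnC.
move: hn hm => /=; rewrite !ler_norml.
set a := _ / n%:R; set b := _ / n0.+1%:R.
move=> ? ? /andP[? ?] /andP[? ?]; rewrite ltr_norml; apply/andP; split; lra.
Qed.

Section System.
Variables (R : realType) (I : finType).
Implicit Types (N M : nat) (a : {ffun I -> int}).

(** In the application, F says that the positions stay in [0, N), E that the walk closes, and D that
    the step lengths are nonzero and distinct. *)
Definition sys_set N (F E D : seq {ffun I -> int}) :=
  [set x : {ffun I -> 'I_N} | [&& all (fun a => in_range a x) F,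
     all (fun a => lin a x == 0) E & all (fun a => lin a x != 0) D]]%SET.

Lemma range_set_cvg (F : seq {ffun I -> int}) : exists l : R,
  (fun N => #|range_set N F|%:R / N%:R ^+ #|I| : R) @ \oo --> l.
Proof.
have [C hC] := range_scaling F.
apply: (@scaling_cvg R _ C%:R) => N M M0 N0.
have [h1 h2] := hC N M M0 N0.
have N0' : 0 < N%:R :> R by rewrite ltr0n.
have M0' : 0 < M%:R :> R by rewrite ltr0n.
have P0 : 0 < (M * N)%:R ^+ #|I| :> R by rewrite exprn_gt0// ltr0n muln_gt0 M0.
rewrite ler_pdivlMr// -(ler_pM2r P0).
rewrite -[X in _ * X * _](ger0_norm (ltW N0')) -normrM.
rewrite -[X in _ * X](ger0_norm (ltW P0)) -normrM.
rewrite ler_norml.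
have -> : (#|range_set (M * N) F|%:R / (M * N)%:R ^+ #|I| - #|range_set N F|%:R / N%:R ^+ #|I|)
   * N%:R * (M * N)%:R ^+ #|I| =
  (N * #|range_set (M * N) F|)%:R - (N * M ^ #|I| * #|range_set N F|)%:R :> R.
  rewrite !natrM natrX exprMn; field.
  by rewrite !expf_neq0// ?gt_eqF.
move: h1 h2; rewrite -!(ler_nat R) !natrD.
have -> : (C * (M * N) ^ #|I|)%:R = C%:R * (M * N)%:R ^+ #|I| :> R.
  by rewrite natrM natrX.
set x := _%:R; set y := _%:R; set z := _ * _ ^+ _ => ? ?.
by apply/andP; split; lra.
Qed.

Lemma nonzero_coord a : a != 0 -> exists i, a i != 0.
Proof.
move=> a0; apply/existsP; apply: contraNT a0 => /existsPn h.
by apply/eqP/ffunP => i; rewrite ffunE; apply/eqP; have := h i; rewrite negbK.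
Qed.

Lemma card_range_sys N (F D : seq {ffun I -> int}) : all (fun a => a != 0) D ->
  (N * #|range_set N F| <= N * #|sys_set N F [::] D| + size D * N ^ #|I|)%N.
Proof.
elim: D => [_|a D IH] /=.
  by rewrite mul0n addn0 leq_mul// subset_leq_card//; apply/fintype.subsetP => x; rewrite !inE => ->.
move=> /andP[a0 /IH h]; rewrite (leq_trans h)// mulSn addnA leq_add2r.
have [i ai] := nonzero_coord a0.
rewrite (leq_trans _ (leq_add (leqnn _) (card_hyperplane N 0 ai)))// -mulnDr leq_mul//.
apply: leq_trans (leq_card_setU _ _); apply/subset_leq_card/fintype.subsetP => x.
rewrite !inE/= => /andP[-> ->] /=; rewrite andbT orbC.
by case: (lin a x == 0).
Qed.

Lemma sys_small (c : nat -> nat) (n K : nat) :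
  (forall N, N * c N <= K * N ^ n)%N ->
  (fun N => (c N)%:R / N%:R ^+ n : R) @ \oo --> (0 : R).
Proof.
move=> h; apply/cvgnP => e e0; have [n0 hn0] := @inv_small R K%:R e e0.
exists n0 => N /hn0[N0 hN]; have := h N; rewrite -(ler_nat R) !natrM natrX => hN'.
have N0' : 0 < N%:R :> R by rewrite ltr0n.
rewrite subr0 ger0_norm; last by rewrite divr_ge0.
apply: le_trans hN; rewrite ler_pdivrMr ?exprn_gt0// mulrAC ler_pdivlMr//.
by rewrite mulrC.
Qed.

(** A nonzero form in E confines the points to a hyperplane and a zero form in D leaves none, so the
    limit is 0. Otherwise E imposes nothing, D removes finitely many hyperplanes, and the limit is
    that of [range_set]. *)
Lemma sys_cvg F E D : exists l : R,
  (fun N => #|sys_set N F E D|%:R / N%:R ^+ #|I| : R) @ \oo --> l.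
Proof.
case: (boolP (all (fun a => a == 0) E)) => [E0|/allPn[a aE a0]]; last first.
  exists 0; apply: (@sys_small _ _ 1%N) => N.
  have [i ai] := nonzero_coord a0.
  rewrite mul1n; apply: leq_trans (card_hyperplane N 0 ai).
  rewrite leq_mul//; apply/subset_leq_card/fintype.subsetP => x.
  by rewrite !inE => /and3P[_ /allP/(_ _ aE)].
have sE N : sys_set N F E D = sys_set N F [::] D.
  apply/setP => x; rewrite !inE; congr (_ && _); rewrite /=.
  suff -> : all (fun a => lin a x == 0) E by [].
  by apply/allP => a /(allP E0)/eqP->; rewrite lin0.
have -> : (fun N => #|sys_set N F E D|%:R / N%:R ^+ #|I| : R) =
  (fun N => #|sys_set N F [::] D|%:R / N%:R ^+ #|I|).
  by apply/funext => N; rewrite sE.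
case: (boolP (all (fun a => a != 0) D)) => [D0|/allPn[a aD]]; last first.
  rewrite negbK => /eqP a0; exists 0; apply: (@sys_small _ _ 0%N) => N.
  rewrite mul0n leqn0 muln_eq0 cards_eq0; apply/orP; right; apply/eqP/setP => x.
  by rewrite !inE; apply/negP => /and3P[_ _ /allP/(_ _ aD)]; rewrite a0 lin0 eqxx.
have [l hl] := range_set_cvg F; exists l.
have h : (fun N => (#|range_set N F| - #|sys_set N F [::] D|)%N%:R / N%:R ^+ #|I| : R) @ \oo --> (0 : R).
  apply: (@sys_small _ _ (size D)) => N; have := card_range_sys N F D0; rewrite mulnBr; lia.
rewrite -[l]subr0; apply: cvg_trans (cvgB hl h); apply: near_eq_cvg; apply: nearW => N.
rewrite !fctE -mulrBl natrB; last first.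
  by apply/subset_leq_card/fintype.subsetP => x; rewrite !inE => /and3P[].
by congr (_ / _); ring.
Qed.

End System.

Local Close Scope classical_set_scope.

(** * Convergence of the number of matched walks *)

Section MatchedLimit.
Variable m : nat.
Local Notation code := ((2 * m).-tuple 'I_m.+1 * (2 * m).-tuple bool)%type.

Definition fiber N (c : code) := [pred w : walk N (2 * m) | mwalks m N w & (enc1 m w).1 == c].

(** Coordinate [ord0] of the value vector is the start and the other m are the step lengths; this is
    why [distD] spares [ord0]. *)
Let zc (c : code) := zip c.2 c.1.
Let posF (c : code) := delta ord0 :: scanl +%R (delta ord0) (fsteps (zc c)).
Let closE (c : code) := [:: \sum_(a <- fsteps (zc c)) a].
Let distD : seq {ffun 'I_m.+1 -> int} :=
  [seq delta i | i <- enum 'I_m.+1 & i != ord0] ++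
  [seq delta ij.1 - delta ij.2 | ij <- enum {: 'I_m.+1 * 'I_m.+1} &
     [&& ij.1 != ij.2, ij.1 != ord0 & ij.2 != ord0]].

Let distDP N (x : {ffun 'I_m.+1 -> 'I_N}) :
  reflect ((forall i, i != ord0 -> x i != 0%N :> nat) /\
           (forall i j, i != ord0 -> j != ord0 -> x i = x j -> i = j))
    (all (fun a => lin a x != 0) distD).
Proof.
rewrite all_cat; apply: (iffP andP) => [[/allP h1 /allP h2]|[h1 h2]]; split.
- move=> i i0; have := h1 (delta i); rewrite lin_delta; apply.
  by apply/mapP; exists i => //; rewrite mem_filter i0 mem_enum.
- move=> i j i0 j0 xij; apply/eqP; apply: contraT => ij.
  have := h2 (delta i - delta j); rewrite linB !lin_delta xij subrr eqxx; apply.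
  by apply/mapP; exists (i, j) => //; rewrite mem_filter /= ij i0 j0 mem_enum.
- apply/allP => a /mapP[i]; rewrite mem_filter => /andP[i0 _] ->.
  by rewrite lin_delta; exact: h1.
- apply/allP => a /mapP[[i j]]; rewrite mem_filter => /andP[/and3P[/= ij i0 j0] _] ->.
  rewrite linB !lin_delta subr_eq0; apply: contraNneq ij => -[/val_inj xij].
  by apply/eqP/h2.
Qed.

Lemma matched_size N (w : walk N (2 * m)) : matched (wl w) -> size (undup (wl w)) = m.
Proof. by move=> /andP[_ /size_undup2_all]; rewrite size_wl; lia. Qed.

Lemma fiber_image N (w : walk N (2 * m)) c : fiber N c w ->
  (enc1 m w).2 \in sys_set N (posF c) (closE c) distD.
Proof.
move=> /andP[/andP[cw mw] /eqP/= <-] {c}.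
have sz := matched_size mw; have /andP[n0 _] := mw.
set x := vals m w.1 [:: w.1] (wl w).
have sx : [seq val (x i) | i <- kap m 1 (wl w)] = wl w.
  by apply: (@vals_kap N m w.1 [:: w.1] (wl w)); rewrite ?sz ?wl_lt.
have x0 : x ord0 = w.1 by rewrite /x vals_start.
have zx : [seq (y.1, val (x y.2)) | y <- zip (ws w) (kap m 1 (wl w))] = zip (ws w) (wl w).
  by rewrite (map_zip_snd (fun i => val (x i))) sx.
have xi (i : 'I_m.+1) : i != ord0 -> val (x i) = nth 0%N (undup (wl w)) i.-1 /\ (i.-1 < m)%N.
  case: i => [[|i] hi]// _; split; last by [].
  rewrite /x ffunE /= insubdK// unfold_in; apply: (allP (wl_lt w)).
  by rewrite -mem_undup mem_nth// sz.
rewrite inE; apply/and3P; split.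
- have -> : all (fun a => in_range a x) (posF (Tuple (kap_tupleP m 1 w), Tuple (ws_tupleP w))) =
    all (fun u : int => 0 <= u < N%:Z) [seq lin a x | a <- posF (Tuple (kap_tupleP m 1 w), Tuple (ws_tupleP w))].
    by rewrite all_map.
  rewrite /posF map_cons lin_scanl lin_delta /zc /= zx x0 positions.
  apply/andP; split; first by case: (w.1) => /=.
  by rewrite all_map; apply/allP => -[i hi] _ /=.
- rewrite /closE /= andbT /zc /= lin_fsteps zx.
  have := last_pos w.1 w.2; rewrite (eqP cw) => /eqP.
  by rewrite -[X in X == _]addr0 (inj_eq (addrI _)) eq_sym.
- apply/distDP; split=> [i /xi[-> hi]|i j i0 j0 xij].
    apply: contraNneq n0 => e.
    by rewrite -mem_undup -[X in X \in _]e mem_nth// sz.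
  have [hi' hi] := xi i i0; have [hj' hj] := xi j j0.
  have : nth 0%N (undup (wl w)) i.-1 == nth 0%N (undup (wl w)) j.-1 by rewrite -hi' -hj' xij.
  rewrite nth_uniq ?undup_uniq ?sz// => /eqP ij; apply/val_inj.
  move: i0 j0; rewrite -!(inj_eq val_inj) /=; lia.
Qed.

(** The code must come from some walk [w1], perhaps for another size: this guarantees that it
    numbers the letters in the order of [undup] and uses each of them twice. Replacing the lengths
    of [w1] by the values x, injectively, preserves the pattern. *)
Lemma fiber_onto N1 (w1 : walk N1 (2 * m)) c N x : fiber N1 c w1 ->
  x \in sys_set N (posF c) (closE c) distD ->
  exists2 w, fiber N c w & (enc1 m w).2 = x.
Proof.
move=> /andP[/andP[_ m1] /eqP/= <-] {c}; rewrite inE => /and3P[].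
have sz := matched_size m1; have /andP[_ /allP c2] := m1.
have hn : (1 + size (undup (wl w1)) <= m.+1)%N by rewrite sz.
set phi := fun d => inord (1 + index d (undup (wl w1))) : 'I_m.+1.
have phiE d : d \in wl w1 -> val (phi d) = (1 + index d (undup (wl w1)))%N.
  by move=> dw; rewrite (kap_val hn).
have kE : kap m 1 (wl w1) = map phi (wl w1) by [].
set zz := zip (ws w1) (kap m 1 (wl w1)).
move=> hpos hclos /distDP[hn0 hinj].
set xp := fun d => val (x (phi d)).
have phi0 d : d \in wl w1 -> phi d != ord0.
  by move=> dw; rewrite -(inj_eq val_inj) phiE.
have phi_inj : {in wl w1 &, injective phi}.
  move=> a b az bz /(congr1 val); rewrite (phiE _ az) (phiE _ bz) => /eqP.
  rewrite eqn_add2l -(mem_undup (wl w1)) in az *; rewrite -(mem_undup (wl w1)) in bz.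
  by move=> /eqP /(congr1 (nth 0%N (undup (wl w1)))); rewrite !nth_index.
have xp_inj : {in wl w1 &, injective xp}.
  by move=> a b aw bw /val_inj/hinj e; apply: phi_inj => //; apply: e; exact: phi0.
set z := zip (ws w1) (map xp (wl w1)).
have zE : [seq (y.1, val (x y.2)) | y <- zz] = z.
  by rewrite /zz (map_zip_snd (fun i => val (x i))) kE -map_comp.
have sz1 : size (ws w1) = size (map xp (wl w1)) by rewrite size_map size_wl size_ws.
have [||p [sp lp gp]] := @walk_realize N (x ord0) z.
- have : all (fun u : int => 0 <= u < N%:Z) [seq lin a x | a <- posF (Tuple (kap_tupleP m 1 w1), Tuple (ws_tupleP w1))].
    by rewrite all_map.
  by rewrite /posF map_cons lin_scanl lin_delta /zc /= zE => /andP[].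
- apply/allP => y; rewrite -[y.2]/(snd y) => /(map_f snd).
  rewrite -/(unzip2 z) unzip2_zip ?sz1// => /mapP[d dw ->].
  by rewrite lt0n; apply: hn0; exact: phi0.
have tp : size p == (2 * m)%N by rewrite sp size_zip sz1 minnn size_map size_wl.
have lw : wl (x ord0, Tuple tp) = map xp (wl w1).
  by rewrite /wl/= lp unzip2_zip// sz1.
have gw : ws (x ord0, Tuple tp) = ws w1.
  by rewrite /ws/= gp unzip1_zip// sz1.
have mw : matched (wl (x ord0, Tuple tp)).
  rewrite lw; apply/andP; split.
    by apply/mapP => -[d dw] /esym /eqP; apply/negP; apply: hn0; exact: phi0.
  apply/allP => y /mapP[d dw ->].
  by rewrite (@count_map_in _ _ xp _ (wl w1))// c2.
have uw : undup (wl (x ord0, Tuple tp)) = map xp (undup (wl w1)).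
  by rewrite lw (@undup_map_in _ _ xp _ (wl w1)).
exists (x ord0, Tuple tp).
  apply/andP; split; last first.
    rewrite /enc1 /= xpair_eqE -!val_eqE /= gw eqxx andbT.
    rewrite /kap lw -map_comp; apply/eqP/eq_in_map => d dw /=.
    rewrite (@undup_map_in _ _ xp _ (wl w1))// (@index_map_in _ _ xp _ (wl w1))//.
    by move=> e; rewrite mem_undup.
  apply/andP; split=> //; rewrite /closed_walk -(inj_eq val_inj)/=.
  have := last_pos (x ord0) p; rewrite gp lp unzip1_zip ?unzip2_zip ?sz1// -/z.
  move: hclos; rewrite /closE /= andbT /zc /= lin_fsteps zE => /eqP ->.
  by rewrite addr0 => -[->].
apply/ffunP => i; apply/val_inj; rewrite /enc1 ffunE /= uw.
case: i => [[|i] hi] /=.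
  rewrite insubdK ?unfold_in//=; congr (val (x _)); exact: val_inj.
have hi' : (i < size (undup (wl w1)))%N by rewrite sz.
rewrite (nth_map 0%N)//.
set d := nth _ _ _; have dw : d \in wl w1 by rewrite -mem_undup mem_nth.
rewrite insubdK ?unfold_in//= /xp; last by case: (x _).
congr (val (x _)); apply/val_inj; rewrite phiE//= /d.
by rewrite index_uniq ?undup_uniq.
Qed.

Lemma fiber_inj N c : {in fiber N c &, injective (fun w => (enc1 m w).2)}.
Proof.
move=> w w' /andP[/andP[_ mw] /eqP hw] /andP[/andP[_ mw'] /eqP hw'] e.
apply: (@enc1_inj _ _ m); rewrite ?inE ?matched_size//.
by rewrite [LHS]surjective_pairing [RHS]surjective_pairing hw hw' e.
Qed.

Variable R : realType.

Lemma fiber_cvg c : exists l : R,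
  ((fun N => #|fiber N c|%:R / N%:R ^+ m.+1 : R) @ \oo --> l)%classic.
Proof.
(* Either the code is realized for some size, and then the fibres are exactly the solution sets for
   all N, or every fibre is empty. *)
have [[N1 [w1 h1]]|h0] := pselect (exists N1 w1, fiber N1 c w1); last first.
  exists 0; have -> : (fun N => #|fiber N c|%:R / N%:R ^+ m.+1 : R) = (fun=> 0).
    apply/funext => N; rewrite eq_card0 ?mul0r// => w.
    by apply/negP => hw; apply: h0; exists N, w.
  exact: cvg_cst.
have [l hl] := sys_cvg R (posF c) (closE c) distD; exists l.
move: hl; rewrite card_ord.
suff -> : (fun N => #|sys_set N (posF c) (closE c) distD|%:R / N%:R ^+ m.+1 : R) =
  (fun N => #|fiber N c|%:R / N%:R ^+ m.+1) by [].
apply/funext => N; congr (_%:R / _).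
rewrite -(card_in_imset (@fiber_inj N c)); apply/eq_card => x.
apply/idP/imsetP => [hx|[w hw ->]]; last exact: fiber_image hw.
by have [w hw <-] := fiber_onto h1 hx; exists w.
Qed.

Lemma mwalks_cvg : exists l : R,
  ((fun N => #|mwalks m N|%:R / N%:R ^+ m.+1 : R) @ \oo --> l)%classic.
Proof.
have /choice[l hl] := fiber_cvg.
exists (\sum_c l c).
suff -> : (fun N => #|mwalks m N|%:R / N%:R ^+ m.+1 : R) =
  (fun N => \sum_c #|fiber N c|%:R / N%:R ^+ m.+1).
  by apply: cvg_big => [|c _]; [exact: add_continuous|exact: hl].
apply/funext => N; rewrite -mulr_suml; congr (_ / _).
rewrite -natr_sum; congr (_%:R).
rewrite -sum1_card (partition_big (fun w => (enc1 m w).1) xpredT)//=.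
by apply: eq_bigr => c _; rewrite sum1_card.
Qed.

End MatchedLimit.

(** * Expected traces and their variances, from the moments of the entries *)

Section Moments.
Variable R : realType.
Implicit Type mu : nat -> R.

(* The expectation of the product of the b_d, d in s, for b_0 = 0 and independent b_d (d > 0)
   with moments mu. *)
Definition ev mu (s : seq nat) : R :=
  if 0%N \in s then 0 else \prod_(d <- undup s) mu (count_mem d s).

Lemma ev_zero mu s : 0%N \in s -> ev mu s = 0.
Proof. by rewrite /ev => ->. Qed.

Lemma ev_single mu s d : mu 1%N = 0 -> d \in s -> count_mem d s = 1%N -> ev mu s = 0.
Proof.
move=> mu1 ds cd; rewrite /ev; case: ifP => // _.
by rewrite (bigD1_seq d) ?undup_uniq ?mem_undup//= cd mu1 mul0r.
Qed.

Lemma ev_matched mu s : mu 2%N = 1 -> matched s -> ev mu s = 1.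
Proof.
move=> mu2 /andP[/negbTE s0 /allP hs]; rewrite /ev s0 big_seq big1// => d.
by rewrite mem_undup => /hs/eqP->.
Qed.

Lemma ev_cat mu s t : ~~ has (mem s) t -> ev mu (s ++ t) = ev mu s * ev mu t.
Proof.
move=> hst; have ts d : d \in t -> d \notin s by move=> /(hasPn hst).
rewrite /ev mem_cat; case: ifPn => [|]; first by case: ifP; rewrite ?mul0r// => _ /= ->; rewrite mulr0.
rewrite negb_or => /andP[/negbTE-> /negbTE->].
rewrite undup_cat big_cat/=; congr (_ * _).
  rewrite (_ : [seq x <- undup s | x \notin t] = undup s).
    rewrite big_seq [RHS]big_seq; apply: eq_bigr => d; rewrite mem_undup => ds.
    have dt : d \notin t by apply: contraTN ds => /ts.
    by rewrite count_cat (count_memPn dt) addn0.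
  by apply/all_filterP/allP => d; rewrite mem_undup => ds; apply: contraTN ds => /ts.
rewrite big_seq [RHS]big_seq; apply: eq_bigr => d; rewrite mem_undup => /ts ds.
by rewrite count_cat (count_memPn ds).
Qed.

Lemma ev_bound mu k : exists2 B : R, 0 <= B & forall s, (size s <= k)%N -> `|ev mu s| <= B.
Proof.
pose C : R := 1 + \sum_(i < k.+1) `|mu i|.
have C1 : 1 <= C by rewrite lerDl sumr_ge0.
exists (C ^+ k); first by rewrite exprn_ge0// (le_trans ler01).
move=> s sk; rewrite /ev; case: ifP => _; first by rewrite normr0 exprn_ge0// (le_trans ler01).
rewrite normr_prod.
apply: (@le_trans _ _ (\prod_(d <- undup s) C)).
  apply: ler_prod => d _; rewrite normr_ge0/=.
  have hd : (count_mem d s < k.+1)%N by rewrite ltnS (leq_trans (count_size _ _)).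
  rewrite /C (bigD1 (Ordinal hd))//= addrCA lerDl addr_ge0// sumr_ge0//.
rewrite big_const_seq count_predT iter_mulr_1.
by apply: ler_weXn2l => //; rewrite (leq_trans (size_undup _)).
Qed.

Definition tsum mu k N := \sum_(w : walk N k | closed_walk w) ev mu (wl w).

(** The limit moments. Odd ones vanish because a matched word has even length. *)
Definition tmom k : R := if odd k then 0 else
  limn (fun N => #|mwalks k./2 N|%:R / N%:R ^+ (k./2).+1 : R).

Local Open Scope classical_set_scope.

Lemma tmom_cvg m : (fun N => #|mwalks m N|%:R / N%:R ^+ m.+1 : R) @ \oo --> tmom (2 * m).
Proof.
have om : odd (2 * m) = false by rewrite mul2n odd_double.
have hm : (2 * m)./2 = m by rewrite mul2n doubleK.
rewrite /tmom om hm.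
by have [l hl] := @mwalks_cvg m R; apply/cvg_ex; exists l.
Qed.

(** Some letter occurs at least three times, so twice the number of letters is strictly less than
    the length. *)
Lemma bad_few (w : seq nat) : ~~ matched w -> 0%N \notin w ->
  all (fun d => 2 <= count_mem d w)%N w -> (size (undup w) <= (size w).-1./2)%N /\ (0 < size w)%N.
Proof.
move=> nm w0 h2; have := size_undup2 h2.
rewrite leq_eqVlt => /predU1P[e|h]; last first.
  case: (size w) h => [//|n] h /=; split=> //.
  by rewrite geq_half_double -mul2n -ltnS.
by move: nm; rewrite /matched w0 (size_undup2_eq h2)// e.
Qed.

(** For k = 0 the only word is empty, hence matched, and the error is 0. The factor [(0 < k)]
    records this, since the power N^1 on the right would not be negligible there. *)
Lemma tsum_matched mu k : mu 1%N = 0 -> mu 2%N = 1 -> exists2 C : R, 0 <= C & forall N,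
  `|tsum mu k N - #|[pred w : walk N k | closed_walk w && matched (wl w)]|%:R| <=
  C * (0 < k)%N%:R * N%:R ^+ (k.-1./2).+1.
Proof.
move=> mu1 mu2; have [B B0 hB] := ev_bound mu k.
pose C := #|{: k.-tuple 'I_(k.-1./2).+1 * k.-tuple bool}|.
exists (B * C%:R); first by rewrite mulr_ge0.
move=> N; rewrite /tsum (bigID (fun w => matched (wl w)))/=.
rewrite (eq_bigr (fun=> 1%:R)) => [|w /andP[_ /ev_matched->//]].
rewrite -natr_sum.
have -> : (\sum_(w : walk N k | closed_walk w && matched (wl w)) 1)%N =
    #|[pred w : walk N k | closed_walk w && matched (wl w)]|.
  by rewrite -sum1_card; apply: eq_bigl => w; rewrite inE.
rewrite addrAC subrr add0r.
pose P (w : walk N k) := [&& ~~ matched (wl w), 0%N \notin wl w & all (fun d => 2 <= count_mem d (wl w))%N (wl w)].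
rewrite (bigID P)/= [X in _ + X]big1 ?addr0; last first.
  move=> w /andP[/andP[_ nm]]; rewrite /P nm/= negb_and negbK => /orP[/ev_zero->//|].
  move=> /allPn[d dw]; rewrite -ltnNge ltnS => cd; apply: (@ev_single _ _ d) => //.
  by apply/eqP; rewrite eqn_leq cd -has_count has_pred1.
rewrite (le_trans (ler_norm_sum _ _ _))//.
case: (posnP k) => k0.
  rewrite big1 ?mulr0 ?mul0r// => w /andP[_ /and3P[nm w0 h2]].
  by have [_] := bad_few nm w0 h2; rewrite size_wl [X in (0 < X)%N]k0.
apply: (@le_trans _ _ (\sum_(w : walk N k | (size (undup (wl w)) <= k.-1./2)%N) B)).
  apply: (@le_trans _ _ (\sum_(w : walk N k | P w) B)).
    rewrite big_mkcond [leRHS]big_mkcond; apply: ler_sum => w _.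
    case: ifPn => [/andP[_ ->]|_]; first by rewrite hB// size_wl.
    by case: ifP.
  rewrite big_mkcond [leRHS]big_mkcond; apply: ler_sum => w _.
  case: ifPn => [/and3P[nm w0 h2]|_]; last by case: ifP.
  by have [] := bad_few nm w0 h2; rewrite size_wl => -> _.
rewrite (sumr_const [pred w : walk N k | (size (undup (wl w)) <= k.-1./2)%N]).
have -> : B * C%:R * true%:R * N%:R ^+ (k.-1./2).+1 = B * (C * N ^ (k.-1./2).+1)%:R.
  by rewrite mulr1 natrM natrX mulrA.
rewrite -[B *+ _]mulr_natr ler_wpM2l// ler_nat.
exact: card_few_labels.
Qed.

(** The left side is N^(r - k/2), with r - k/2 <= -1/2. *)
Lemma norm_factor N k (r : nat) : (0 < N)%N -> (2 * r < k)%N ->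
  N%:R^-1 * (Num.sqrt N%:R) ^- k * N%:R ^+ r.+1 <= (Num.sqrt N%:R)^-1 :> R.
Proof.
move=> N0 rk; set q : R := Num.sqrt N%:R.
have N1 : 1 <= N%:R :> R by rewrite ler1n.
have q1 : 1 <= q by rewrite -sqrtr1 ler_sqrt// (lt_le_trans ltr01).
have q0 : q != 0 by rewrite gt_eqF// (lt_le_trans ltr01).
have hq : N%:R = q ^+ 2 by rewrite sqr_sqrtr.
rewrite hq -exprM mulnS exprD.
have -> : (q ^+ 2)^-1 * q ^- k * (q ^+ 2 * q ^+ (2 * r)) = q ^- k * q ^+ (2 * r).
  by field; rewrite expf_neq0.
have [d ->] : exists d, k = (2 * r + d.+1)%N by exists (k - 2 * r).-1; lia.
rewrite exprD invfM mulrAC mulVf ?expf_neq0// mul1r.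
rewrite exprS invfM ger_pMr ?invr_gt0 ?(lt_le_trans ltr01)//.
by rewrite invf_le1 ?exprn_gt0 ?(lt_le_trans ltr01)// exprn_ege1.
Qed.

Lemma sqrt_inv_small (C e : R) : 0 < e ->
  exists n0, forall n, (n0 <= n)%N -> (0 < n)%N /\ C / Num.sqrt n%:R <= e.
Proof.
move=> e0; have [n0 hn0] := @inv_small R (C ^+ 2) (e ^+ 2) (exprn_gt0 2 e0).
exists n0 => n /hn0[n_gt0 hn]; split=> //.
have [C0|C0] := leP C 0.
  by apply: (le_trans _ (ltW e0)); rewrite mulr_le0_ge0// invr_ge0 sqrtr_ge0.
rewrite -(@ler_pXn2r _ 2) ?nnegrE ?divr_ge0 ?sqrtr_ge0 ?(ltW C0) ?(ltW e0)//.
by rewrite exprMn exprVn sqr_sqrtr.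
Qed.

(** Universality: matched walks have weight 1 whatever the higher moments are, and the remaining
    walks contribute O(N^(-1/2)). *)
Lemma tsum_cvg mu k : mu 1%N = 0 -> mu 2%N = 1 ->
  (fun N => N%:R^-1 * (Num.sqrt N%:R) ^- k * tsum mu k N) @ \oo --> tmom k.
Proof.
move=> mu1 mu2; have [C C0 hC] := tsum_matched k mu1 mu2.
pose nf N : R := N%:R^-1 * (Num.sqrt N%:R) ^- k.
have h0 : (fun N => nf N * (tsum mu k N - #|[pred w : walk N k | closed_walk w && matched (wl w)]|%:R)) @ \oo --> (0 : R).
  apply/cvgnP => e e0; have [n0 hn0] := @sqrt_inv_small C e e0.
  exists n0 => N /hn0[N0 hN]; rewrite subr0 normrM.
  rewrite ger0_norm; last by rewrite mulr_ge0 ?invr_ge0 ?exprn_ge0 ?sqrtr_ge0.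
  apply: le_trans hN; rewrite (le_trans (ler_wpM2l _ (hC N)))//.
    by rewrite mulr_ge0 ?invr_ge0 ?exprn_ge0 ?sqrtr_ge0.
  case: (posnP k) => k0; first by rewrite mulr0 mul0r mulr0 divr_ge0 ?sqrtr_ge0.
  rewrite mulr1 mulrCA ler_wpM2l// norm_factor//.
  have : ((k.-1./2).*2 <= k.-1)%N by rewrite -geq_half_double.
  by rewrite -mul2n; lia.
suff h1 : (fun N => nf N * #|[pred w : walk N k | closed_walk w && matched (wl w)]|%:R) @ \oo --> tmom k.
  rewrite -[tmom k]add0r; apply: cvg_trans (cvgD h0 h1); apply: near_eq_cvg.
  by apply: nearW => N; rewrite !fctE -mulrDr subrK.
case: (boolP (odd k)) => ok.
  rewrite /tmom ok; have -> : (fun N => nf N * #|[pred w : walk N k | closed_walk w && matched (wl w)]|%:R) = (fun=> 0).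
    apply/funext => N; rewrite eq_card0 ?mulr0// => w; rewrite inE; apply/negP.
    move=> /andP[_ /andP[_ /size_undup2_all]]; rewrite size_wl => h.
    by move: ok; rewrite h mul2n odd_double.
  exact: cvg_cst.
have [m km] : exists m, k = (2 * m)%N by exists k./2; rewrite mul2n even_halfK.
subst k; apply: cvg_trans (@tmom_cvg m); apply: near_eq_cvg.
exists 1%N => // N /= N0; rewrite /nf exprM sqr_sqrtr// mulrC; congr (_ * _).
by rewrite exprS invfM.
Qed.

(** The variance of Trace(A^k), expanded over pairs of closed walks. *)
Definition tcov mu k N := \sum_(w : walk N k | closed_walk w) \sum_(w' : walk N k | closed_walk w')
  (ev mu (wl w ++ wl w') - ev mu (wl w) * ev mu (wl w')).

(** The squared normalization is N^-(k+2), while only linked pairs contribute, and there are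
    O(N^(k+1)) of them. *)
Lemma tcov_cvg mu k : mu 1%N = 0 ->
  (fun N => (N%:R^-1 * (Num.sqrt N%:R) ^- k) ^+ 2 * tcov mu k N) @ \oo --> (0 : R).
Proof.
move=> mu1; have [B B0 hB] := ev_bound mu (k + k).
have [C hC] := card_linked k.
have bnd N : `|tcov mu k N| <= (B + B ^+ 2) * #|linked k N|%:R.
  rewrite /tcov pair_big_dep/= (le_trans (ler_norm_sum _ _ _))//.
  rewrite mulr_natr -sumr_const big_mkcond [leRHS]big_mkcond ler_sum// => -[w w'] _ /=.
  have B2 : 0 <= B + B ^+ 2 by rewrite addr_ge0 ?exprn_ge0.
  case: ifP => [/andP[cw cw']|_]; last by case: ifP.
  case: ifP => [_|/negbT].
    rewrite (le_trans (ler_normB _ _))// lerD ?hB ?size_cat ?size_wl//.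
    by rewrite normrM expr2 ler_pM ?hB ?size_wl ?leq_addl.
  rewrite inE /= cw cw'/= negb_and => /orP[ns|].
    by rewrite ev_cat// subrr normr0.
  rewrite /pl/= => /allPn[d dw]; rewrite -ltnNge ltnS => cd.
  have c1 : count_mem d (wl w ++ wl w') = 1%N.
    by apply/eqP; rewrite eqn_leq cd -has_count has_pred1.
  rewrite (@ev_single _ _ d)// sub0r normrN.
  suff -> : ev mu (wl w) * ev mu (wl w') = 0 by rewrite normr0.
  move: dw c1; rewrite mem_cat count_cat => /orP[] dw c1.
    rewrite (@ev_single _ (wl w) d) ?mul0r//.
    by apply/eqP; rewrite eqn_leq -has_count has_pred1 dw andbT -c1 leq_addr.
  rewrite (@ev_single _ (wl w') d) ?mulr0//.
  by apply/eqP; rewrite eqn_leq -has_count has_pred1 dw andbT -c1 leq_addl.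
apply/cvgnP => e e0; have [n0 hn0] := @inv_small R ((B + B ^+ 2) * C%:R) e e0.
exists n0 => N /hn0[N0 hN]; rewrite subr0 normrM ger0_norm ?sqr_ge0//.
apply: le_trans hN; rewrite (le_trans (ler_wpM2l _ (bnd N))) ?sqr_ge0//.
have N0' : 0 < N%:R :> R by rewrite ltr0n.
have -> : (N%:R^-1 * Num.sqrt N%:R ^- k) ^+ 2 = (N%:R ^+ k.+2)^-1 :> R.
  rewrite exprMn !exprVn -exprM mulnC exprM sqr_sqrtr// -invfM -exprD.
  by [].
have := hC N; rewrite -(ler_nat R) (natrM _ C) natrX natrM => h.
rewrite mulrCA -mulrA ler_wpM2l ?addr_ge0 ?exprn_ge0//.
rewrite ler_pdivrMl ?exprn_gt0// mulrA ler_pdivlMr//.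
by rewrite [leLHS]mulrC [leRHS]mulrC.
Qed.

Lemma tmom_le m : tmom (2 * m) <= 8 ^+ m * m`!%:R.
Proof.
have h := @tmom_cvg m; rewrite -(cvg_lim _ h)//; apply: limr_le; first by apply/cvg_ex; exists (tmom (2 * m)).
exists 1%N => // N /= N0; rewrite ler_pdivrMr ?exprn_gt0 ?ltr0n//.
rewrite -!natrX -natrM -natrM ler_nat.
exact: card_mwalks_le.
Qed.

Lemma tmom_ge m : m`!%:R / 2 ^+ m <= tmom (2 * m).
Proof.
have h := @tmom_cvg m; rewrite -(cvg_lim _ h)//.
(* The lower bound of [card_mwalks_ge] divided by N^(m+1); its first factor tends to 1. *)
pose g N : R := (1 - (2 * m.+1)%:R * N%:R^-1) ^+ (m.+1 * 2) * (m`!%:R / 2 ^+ m).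
have hg : g @ \oo --> (m`!%:R / 2 ^+ m : R).
  have h1 : (fun N => 1 - (2 * m.+1)%:R * N%:R^-1 : R) @ \oo --> (1 : R).
    apply/cvgnP => e e0; have [n0 hn0] := @inv_small R (2 * m.+1)%:R e e0.
    exists n0 => N /hn0[_ hN]; rewrite addrAC subrr sub0r normrN ger0_norm ?divr_ge0//.
  have := cvgM (continuous_cvg _ (@exprn_continuous R (m.+1 * 2) 1) h1) (cvg_cst (m`!%:R / 2 ^+ m : R)).
  by rewrite expr1n mul1r; apply.
rewrite -(cvg_lim _ hg)//; apply: ler_lim; [by apply/cvg_ex; eexists; exact: hg|by apply/cvg_ex; eexists; exact: h|].
exists (2 * m.+1)%N.+1 => // N /= N0.
have N0' : 0 < N%:R :> R by rewrite ltr0n; lia.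
have := card_mwalks_ge N m; rewrite -(ler_nat R) (natrM _ m`!) (natrM _ (_ * _)%N).
rewrite natrM !natrX natrB; last by lia.
rewrite /g -exprM => hh.
rewrite ler_pdivlMr ?exprn_gt0// mulrA mulrAC ler_pdivrMr ?exprn_gt0//.
have -> : 1 - (2 * m.+1)%:R / N%:R = (N%:R - (2 * m.+1)%:R) / N%:R :> R.
  by rewrite mulrBl divff// gt_eqF.
rewrite exprMn exprVn [in X in _ / X]exprM expr2 invfM.
rewrite -(ler_pM2l (exprn_gt0 m.+1 N0')).
apply: le_trans (_ : m`!%:R * (N%:R - (2 * m.+1)%:R) ^+ (m.+1 * 2) <= _).
  by rewrite le_eqVlt; apply/orP; left; apply/eqP; field; rewrite expf_neq0// gt_eqF.
by rewrite (le_trans hh)// le_eqVlt; apply/orP; left; apply/eqP; ring.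
Qed.

End Moments.

Local Open Scope classical_set_scope.
Local Open Scope ring_scope.

(** * Polynomial approximation *)

Section Weierstrass.
Variable R : realType.
Implicit Types (f : R -> R) (g h : nat -> R).

(* The n-th Bernstein operator, i.e. the expectation of g under the binomial law (n, 'X). *)
Fixpoint bern n g : {poly R} :=
  if n is n.+1 then 'X * bern n (g \o succn) + (1 - 'X) * bern n g else (g 0%N)%:P.

Lemma hornerS_bern n g x :
  (bern n.+1 g).[x] = x * (bern n (g \o succn)).[x] + (1 - x) * (bern n g).[x].
Proof. by rewrite /= !hornerE. Qed.

Lemma bern_approx n g h y x : 0 <= x <= 1 ->
  (forall k, (k <= n)%N -> `|g k - y| <= h k) -> `|(bern n g).[x] - y| <= (bern n h).[x].
Proof.
move=> /andP[x0 x1]; elim: n g h => [|n IH] g h gh; first by rewrite !hornerE; exact: gh.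
rewrite !hornerS_bern.
have h1 : `|(bern n (g \o succn)).[x] - y| <= (bern n (h \o succn)).[x].
  by apply: IH => k kn; exact: gh.
have h2 : `|(bern n g).[x] - y| <= (bern n h).[x].
  by apply: IH => k kn; apply: gh; exact: leqW.
have -> : x * (bern n (g \o succn)).[x] + (1 - x) * (bern n g).[x] - y =
  x * ((bern n (g \o succn)).[x] - y) + (1 - x) * ((bern n g).[x] - y) by ring.
rewrite (le_trans (ler_normD _ _))// !normrM (ger0_norm x0) (@ger0_norm _ (1 - x)) ?subr_ge0//.
by apply: lerD; apply: ler_wpM2l; rewrite ?subr_ge0.
Qed.

(** The binomial law has mean n x and variance n x (1 - x). *)
Lemma bern_quad n (A B c x : R) :
  (bern n (fun k => A + B * (k%:R - c) ^+ 2)).[x] =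
  A + B * ((n%:R * x - c) ^+ 2 + n%:R * (x * (1 - x))).
Proof.
elim: n c => [|n IH] c; first by rewrite /= hornerC; ring.
rewrite hornerS_bern IH.
have -> : (fun k : nat => A + B * (k%:R - c) ^+ 2) \o succn = fun k => A + B * (k%:R - (c - 1)) ^+ 2.
  by apply/funext => k /=; rewrite -natr1; congr (_ + _ * _ ^+ _); ring.
by rewrite IH -natr1; ring.
Qed.

(** Only x is confined to the segment; y may lie slightly outside, which is needed near the ends of
    a subdivision. *)
Lemma heine f a b (e : R) : continuous f -> 0 < e ->
  exists2 d : R, 0 < d & forall x y : R, a <= x <= b -> `|x - y| <= d -> `|f x - f y| <= e.
Proof.
move=> cf e0.
have /compact_near_coveringP := @segment_compact R a b.
move=> /(_ R (0^'+) (fun d x => forall y, `|x - y| <= d -> `|f x - f y| <= e) _).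
have hx x : `[a, b]%classic x -> \forall x' \near x & d \near 0^'+,
    forall y, `|x' - y| <= d -> `|f x' - f y| <= e.
  move=> _; have /cvgrPdist_le/(_ (e / 2)) := cf x.
  have e2 : 0 < e / 2 by rewrite divr_gt0.
  move=> /(_ e2) /nbhs_ballP[d /= d0 hd].
  exists (ball x (d / 2), [set d' | d' < d / 2]).
    split => /=; first by apply: nbhsx_ballx; rewrite divr_gt0.
    by apply: nbhs_right_lt; rewrite divr_gt0.
  move=> [x' d'] [/= hx' hd'] y hy.
  have h1 : `|f x - f x'| <= e / 2.
    by apply: hd; apply: le_ball hx'; rewrite ler_pdivrMr// ler_peMr ?ler1n ?ltW.
  have h2 : `|f x - f y| <= e / 2.
    apply: hd; move: hx'; rewrite -!ball_normE/= => hx'.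
    rewrite (_ : x - y = (x - x') + (x' - y)); last by ring.
    by rewrite (le_lt_trans (ler_normD _ _))//; lra.
  rewrite (_ : f x' - f y = - (f x - f x') + (f x - f y)); last by ring.
  by rewrite (le_trans (ler_normD _ _))// normrN; lra.
move=> /(_ hx) H.
near (0 : R)^'+ => d.
exists d => // x y xab; have : (`[a, b] `<=` (fun x => forall y, `|x - y| <= d -> `|f x - f y| <= e)) by near: d.
by move=> /(_ x); apply; rewrite /= in_itv.
Unshelve. all: by end_near. Qed.

Lemma bounded_segment f a b : continuous f ->
  exists2 C : R, 0 <= C & forall x : R, a <= x <= b -> `|f x| <= C.
Proof.
move=> cf; have [ab|ba] := leP a b; last first.
  by exists 0 => // x; lra.
have [|c _ hc] := @EVT_max R (fun x => `|f x|) a b ab.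
  by apply: continuous_subspaceT => x; apply: continuous_comp; [exact: cf|exact: norm_continuous].
by exists `|f c| => // x xab; apply: hc; rewrite in_itv.
Qed.

Lemma weierstrass01 f (e : R) : continuous f -> 0 < e ->
  exists q : {poly R}, forall x : R, 0 <= x <= 1 -> `|f x - q.[x]| <= e.
Proof.
move=> cf e0.
have e2 : 0 < e / 2 by rewrite divr_gt0.
have [d d0 hd] := @heine f 0 1 _ cf e2.
have [C C0 hC] := @bounded_segment f 0 1 cf.
have [n0 /(_ n0 (leqnn _))[n_gt0 hn]] := @inv_small R (C / d ^+ 2) _ e2.
pose n := n0; have n0' : 0 < n%:R :> R by rewrite ltr0n.
exists (bern n (fun k => f (k%:R / n%:R))) => x x01.
(* Chosen so that B (k - n x)^2 >= 2 C as soon as |k/n - x| >= d, where continuity gives nothing. *)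
pose B := 2 * C / (d * n%:R) ^+ 2.
have B0 : 0 <= B by rewrite /B divr_ge0 ?sqr_ge0 ?mulr_ge0.
rewrite distrC; apply: le_trans (@bern_approx n _ (fun k => e / 2 + B * (k%:R - n%:R * x) ^+ 2) (f x) x x01 _) _.
  move=> k kn; have k01 : 0 <= (k%:R / n%:R : R) <= 1.
    by rewrite divr_ge0//= ler_pdivrMr// mul1r ler_nat.
  have [h|h] := leP `|k%:R / n%:R - x| d.
    by rewrite (le_trans (hd _ _ k01 h))// lerDl mulr_ge0 ?sqr_ge0.
  rewrite (@le_trans _ _ (2 * C))//.
    rewrite (le_trans (ler_normB _ _))//; have := hC _ x01; have := hC _ k01; lra.
  rewrite (@le_trans _ _ (B * (k%:R - n%:R * x) ^+ 2))//; last by rewrite lerDr ltW.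
  rewrite /B -mulrA ler_peMr ?mulr_ge0// mulrC ler_pdivlMr ?exprn_gt0 ?mulr_gt0// mul1r.
  rewrite -(real_normK (num_real (_ - _))) ler_sqr ?nnegrE ?mulr_ge0 ?(ltW d0)//.
  have -> : k%:R - n%:R * x = (k%:R / n%:R - x) * n%:R by field; rewrite gt_eqF.
  by rewrite normrM (ger0_norm (ltW n0')) ler_pM2r// ltW.
rewrite bern_quad subrr expr0n add0r.
have -> : B * (n%:R * (x * (1 - x))) = 2 * (x * (1 - x)) * (C / d ^+ 2 / n%:R).
  by rewrite /B; field; rewrite !gt_eqF.
have /andP[x0 x1] := x01.
have hx : x * (1 - x) <= 1 / 4 by have := sqr_ge0 (x - 1 / 2); rewrite expr2; lra.
have hx0 : 0 <= x * (1 - x) by rewrite mulr_ge0// subr_ge0.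
have h3 : 0 <= C / d ^+ 2 / n%:R by rewrite divr_ge0// divr_ge0// sqr_ge0.
have : C / d ^+ 2 / n%:R <= e / 2 by [].
move: h3; set u := C / _ / _ => u0 ue.
have : 2 * (x * (1 - x)) * u <= 1 * u by apply: ler_wpM2r => //; lra.
by lra.
Qed.

Lemma weierstrass f a b (e : R) : continuous f -> 0 < e ->
  exists q : {poly R}, forall x : R, a <= x <= b -> `|f x - q.[x]| <= e.
Proof.
move=> cf e0; have [ab|ba] := ltP a b; last first.
  exists (f a)%:P => x xab; have -> : x = a by lra.
  by rewrite hornerC subrr normr0 ltW.
have ba0 : 0 < b - a by rewrite subr_gt0.
have [|q hq] := @weierstrass01 (fun t => f (a + (b - a) * t)) e _ e0.
  move=> t; apply: (continuous_comp (f := fun t => a + (b - a) * t)); last exact: cf.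
  by apply: cvgD; [exact: cvg_cst|apply: cvgM; [exact: cvg_cst|exact: cvg_id]].
exists (q \Po ((b - a)^-1 *: ('X - a%:P))) => x xab.
rewrite horner_comp !hornerE.
have := hq ((b - a)^-1 * (x - a)); rewrite mulrA divff ?gt_eqF// mul1r.
rewrite (_ : a + (x - a) = x); last by ring.
apply.
rewrite mulr_ge0 ?invr_ge0 ?(ltW ba0)//=; last by lra.
by rewrite ler_pdivrMl// mulr1; lra.
Qed.

End Weierstrass.

(** * Taylor remainders of exp(-y) *)

Section ExpTaylor.
Variable R : realType.

Fixpoint texp n (y : R) : R :=
  if n is n.+1 then texp n y + (- y) ^+ n / n`!%:R else 0.

Lemma is_derive_texp n (x : R) : is_derive x 1 (texp n.+1) (- texp n x).
Proof.
elim: n => [|n IH].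
  rewrite /= oppr0 (_ : (fun y : R => _) = cst 1); last first.
    by apply/funext => y /=; rewrite expr0 fact0 divr1 add0r.
  exact: is_derive_cst.
have h : is_derive x 1 (fun y : R => (- y) ^+ n.+1 / n.+1`!%:R) (- ((- x) ^+ n / n`!%:R)).
  have := is_deriveM (is_deriveX n.+1 (is_deriveN (is_derive_id x 1))) (is_derive_cst (n.+1`!%:R^-1 : R) x 1).
  rewrite (_ : _ * cst _ = fun y : R => (- y) ^+ n.+1 / n.+1`!%:R); last first.
    by apply/funext => y /=; rewrite !fctE.
  move=> h; apply: is_derive_eq h _; rewrite !fctE scaler0 add0r /= /GRing.scale /=.
  rewrite factS natrM; have a0 : n.+1%:R != 0 :> R by rewrite pnatr_eq0.
  have b0 : n`!%:R != 0 :> R by rewrite pnatr_eq0 -lt0n fact_gt0.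
  by move: a0 b0; set a := n.+1%:R; set b := n`!%:R; clearbody a b => *; field; apply/andP.
have := is_deriveD IH h; rewrite -opprD.
by rewrite (_ : _ + _ = texp n.+2)//; apply/funext.
Qed.

(** The sign makes the remainder nonnegative for y >= 0 and makes each remainder the derivative of
    the next one. *)
Definition rexp n (y : R) : R := (-1) ^+ n * (expR (- y) - texp n y).

Lemma is_derive_rexp n (x : R) : is_derive x 1 (rexp n.+1) (rexp n x).
Proof.
have h1 : is_derive x 1 (fun y : R => expR (- y)) (- expR (- x)).
  have := @is_derive1_comp R expR (fun y : R => - y) x _ _ (is_derive_expR _) (is_deriveN (is_derive_id x 1)).
  by rewrite mulrN1.
have := is_deriveZ ((-1) ^+ n.+1 : R) (is_deriveB h1 (is_derive_texp n x)).
rewrite (_ : _ \*: _ = rexp n.+1); last by apply/funext => y; rewrite !fctE.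
by move=> h; apply: is_derive_eq h _; rewrite /rexp exprS /GRing.scale /=; ring.
Qed.

Lemma ge0_of_derive (f df : R -> R) (x : R) : 0 <= x -> f 0 = 0 ->
  (forall y : R, is_derive y 1 f (df y)) -> (forall y : R, 0 <= y -> 0 <= df y) -> 0 <= f x.
Proof.
move=> x0 f0 hd hp; rewrite -f0.
have hder y : derivable f y 1 by case: (hd y).
apply: (@ger0_derive1_le_cc R f 0 x) => //; rewrite ?in_itv/= ?lexx ?x0//.
- move=> y; rewrite in_itv/= => /andP[y0 _].
  by rewrite derive1E; have [_ ->] := hd y; apply/hp/ltW.
- by apply: continuous_subspaceT => y; apply/differentiable_continuous/derivable1_diffP.
Qed.

Lemma rexp0 n : rexp n.+1 0 = 0.
Proof.
rewrite /rexp oppr0 expR0 (_ : texp n.+1 0 = 1) ?subrr ?mulr0//.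
elim: n => [|n IH]; first by rewrite /= expr0 fact0 divr1 add0r.
by rewrite [LHS]/= -/(texp n.+1 0) IH oppr0 expr0n mul0r addr0.
Qed.

(** Both inequalities pass from n to n + 1 by integration: the differences vanish at 0 and have
    nonnegative derivatives. *)
Lemma rexp_bound n (y : R) : 0 <= y -> 0 <= rexp n y <= y ^+ n / n`!%:R.
Proof.
elim: n y => [|n IH] y y0.
  rewrite /rexp !expr0 fact0 mul1r subr0 divr1 expR_ge0/= -expR0 ler_expR.
  by rewrite oppr_le0.
apply/andP; split.
  apply: (@ge0_of_derive (rexp n.+1) (rexp n)) => //; first exact: rexp0.
    exact: is_derive_rexp.
  by move=> z /IH/andP[].
rewrite -subr_ge0.
apply: (@ge0_of_derive (fun y => y ^+ n.+1 / n.+1`!%:R - rexp n.+1 y) (fun y => y ^+ n / n`!%:R - rexp n y)) => //.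
- by rewrite rexp0 expr0n mul0r subrr.
- move=> x; apply: is_deriveB; last exact: is_derive_rexp.
  have := is_deriveM (is_deriveX n.+1 (is_derive_id x 1)) (is_derive_cst (n.+1`!%:R^-1 : R) x 1).
  rewrite (_ : _ * cst _ = fun y : R => y ^+ n.+1 / n.+1`!%:R); last first.
    by apply/funext => z /=; rewrite !fctE.
  move=> h; apply: is_derive_eq h _; rewrite !fctE scaler0 add0r /= /GRing.scale /=.
  rewrite factS natrM; have a0 : n.+1%:R != 0 :> R by rewrite pnatr_eq0.
  have b0 : n`!%:R != 0 :> R by rewrite pnatr_eq0 -lt0n fact_gt0.
  by move: a0 b0; set a := n.+1%:R; set b := n`!%:R; clearbody a b => *; field; apply/andP.
- by move=> z /IH/andP[]; rewrite subr_ge0.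
Qed.

Lemma texp_approx n (y : R) : 0 <= y -> `|expR (- y) - texp n y| <= y ^+ n / n`!%:R.
Proof.
move=> /(rexp_bound n)/andP[h0]; apply: le_trans.
by rewrite -(ger0_norm h0) /rexp normrM normrX normrN1 expr1n mul1r.
Qed.

End ExpTaylor.

Local Close Scope classical_set_scope.

(** * From polynomials to bounded continuous functions *)

Section MomentFunctional.
Variables (R : realType) (M : nat -> R).

Definition mfun (q : {poly R}) : R := \sum_(k < size q) q`_k * M k.

Lemma mfun_widen (q : {poly R}) n : (size q <= n)%N -> mfun q = \sum_(k < n) q`_k * M k.
Proof.
move=> qn; rewrite /mfun (big_ord_widen n (fun k => q`_k * M k)) // big_mkcond /=.
apply: eq_bigr => k _; case: ltnP => // h.
by rewrite nth_default// mul0r.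
Qed.

Lemma mfunD (p q : {poly R}) : mfun (p + q) = mfun p + mfun q.
Proof.
have hs := size_polyD p q; set n := maxn _ _ in hs.
rewrite (mfun_widen hs) (@mfun_widen p n) ?leq_maxl// (@mfun_widen q n) ?leq_maxr//.
by rewrite -big_split; apply: eq_bigr => k _; rewrite coefD mulrDl.
Qed.

Lemma mfunZ c (q : {poly R}) : mfun (c *: q) = c * mfun q.
Proof.
rewrite (mfun_widen (size_scale_leq c q)) /mfun mulr_sumr.
by apply: eq_bigr => k _; rewrite coefZ mulrA.
Qed.

Lemma mfunXn n : mfun 'X^n = M n.
Proof.
rewrite /mfun size_polyXn (bigD1 ord_max)//= coefXn eqxx mul1r big1 ?addr0// => i ni.
by rewrite coefXn (_ : (i == n :> nat) = false) ?mul0r//; apply: contra_neqF ni => /eqP e; exact/val_inj.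
Qed.

Lemma mfunC c : mfun c%:P = c * M 0%N.
Proof. by rewrite -[c%:P]mulr1 -alg_polyC mulr_algl mfunZ -[1](expr0 'X) mfunXn. Qed.

End MomentFunctional.

Section Density.
Variables (R : realType) (M : nat -> R) (B : R).
Hypothesis B1 : 1 <= B.
Hypothesis hM : forall k, M (2 * k)%N <= B ^+ k * k`!%:R.
Variable G : (R -> R) -> Prop.
Hypothesis Gpoly : forall q : {poly R}, G (horner q).
Hypothesis Glin : forall a f g, G f -> G g -> G (fun x => a * f x + g x).
Hypothesis Gsand : forall f, continuous f ->
  (forall e, 0 < e -> exists g (q : {poly R}),
     [/\ G g, forall x, `|f x - g x| <= q.[x] & mfun M q <= e]) -> G f.

(** With c B = 1/4, the value c^n B^(n+j) (n+j)! / n! is at most 2^-n (2 B)^j j!, the binomial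
    factor 2^n being absorbed by 4^-n. *)
Let c := (4 * B)^-1.
Let u (x : R) := expR (- (c * x ^+ 2)).

Let B0 : 0 < B. Proof. exact: lt_le_trans B1. Qed.
Let c0 : 0 < c. Proof. by rewrite invr_gt0 mulr_gt0. Qed.
Let u0 x : 0 < u x. Proof. exact: expR_gt0. Qed.
Let u1 x : u x <= 1.
Proof. by rewrite -expR0 ler_expR oppr_le0 mulr_ge0 ?sqr_ge0 ?ltW. Qed.

Let cu : continuous u.
Proof.
move=> x.
have h : {for x, continuous (fun x : R => - (c * x ^+ 2))}.
  by apply: cvgN; apply: cvgM; [exact: cvg_cst|exact: exprn_continuous].
exact: (continuous_comp h (@continuous_expR R _)).
Qed.

Let G0 : G (fun=> 0).
Proof. by have := Gpoly 0; congr G; apply/funext => x; rewrite horner0. Qed.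

Let Gsum n (a : nat -> R) (f : nat -> R -> R) : (forall k, G (f k)) ->
  G (fun x => \sum_(k < n) a k * f k x).
Proof.
move=> Gf; elim: n => [|n IH].
  by move: G0; congr G; apply/funext => x; rewrite big_ord0.
have := Glin (a n) (Gf n) IH; congr G; apply/funext => x.
by rewrite big_ord_recr/= addrC.
Qed.

Lemma bin_le_pow n k : ('C(n, k) <= 2 ^ n)%N.
Proof.
elim: n k => [|n IH] [|k] //; first by rewrite bin0 expn_gt0.
by rewrite binS expnS mul2n -addnn leq_add.
Qed.

Lemma fact_add_le n j : ((n + j)`! <= 2 ^ (n + j) * n`! * j`!)%N.
Proof.
rewrite -(@bin_fact (n + j) n) ?leq_addr// addKn mulnA leq_mul// leq_mul//.
exact: bin_le_pow.
Qed.

Let texpE n y : texp n y = \sum_(k < n) (-1) ^+ k / k`!%:R * (y ^+ k) :> R.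
Proof.
elim: n => [|n IH]; first by rewrite big_ord0.
by rewrite big_ord_recr/= IH; congr (_ + _); rewrite [in LHS]exprNn mulrAC.
Qed.

(* The Taylor remainder of u is at most (c x^2)^n / n!, and M maps (c x^2)^n to at most n! / 4^n. *)
Lemma dense_gauss m j : G (fun x => x ^+ j * u x ^+ m).
Proof.
elim: m j => [|m IH] j.
  have := Gpoly 'X^j; congr G; apply/funext => x.
  by rewrite hornerXn expr0 mulr1.
apply: Gsand.
  move=> x; apply: cvgM; first exact: exprn_continuous.
  apply: (continuous_comp (f := u) (g := fun y => y ^+ m.+1)); last exact: exprn_continuous.
  exact: cu.
move=> e e0; pose K := 1 + (2 * B) ^+ j * j`!%:R.
have [n0 /(_ n0 (leqnn _))[n0_gt0 hn]] := @inv_small R K e e0.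
pose n := n0.
exists (fun x => \sum_(k < n) ((-1) ^+ k * c ^+ k / k`!%:R) * (x ^+ (j + 2 * k) * u x ^+ m)).
(* The two monomials come from |x^j u^m| <= 1 + x^(2j) multiplied by the remainder bound; K collects
   their values up to the factor 2^-n <= 1/n. *)
exists ((c ^+ n / n`!%:R) *: ('X^(2 * n) + 'X^(2 * (n + j)))).
split.
- by apply: (@Gsum n (fun k => (-1) ^+ k * c ^+ k / k`!%:R) (fun k x => x ^+ (j + 2 * k) * u x ^+ m)).
- move=> x; pose y := c * x ^+ 2; have y0 : 0 <= y by rewrite mulr_ge0 ?sqr_ge0 ?ltW.
  have -> : \sum_(k < n) ((-1) ^+ k * c ^+ k / k`!%:R) * (x ^+ (j + 2 * k) * u x ^+ m) =
      x ^+ j * u x ^+ m * texp n y.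
    rewrite texpE mulr_sumr; apply: eq_bigr => k _.
    by rewrite exprMn -exprM exprD; ring.
  have -> : x ^+ j * u x ^+ m.+1 - x ^+ j * u x ^+ m * texp n y =
      x ^+ j * u x ^+ m * (expR (- y) - texp n y).
    by rewrite exprSr /u -/y; ring.
  rewrite !hornerE/= normrM.
  have h1 := texp_approx n y0.
  have h2 : `|x ^+ j * u x ^+ m| <= 1 + x ^+ (2 * j).
    rewrite normrM (ger0_norm (exprn_ge0 _ (ltW (u0 x)))).
    rewrite (@le_trans _ _ (`|x ^+ j| * 1))//.
      by rewrite ler_wpM2l// exprn_ile1// ltW.
    rewrite mulr1 mulnC exprM -(real_normK (num_real (x ^+ j))).
    have := normr_ge0 (x ^+ j); set t := `|_| => t0.
    by have := sqr_ge0 (t - 1); rewrite sqrrB expr1n mulr1 -subr_ge0; nra.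
  rewrite (le_trans (ler_pM _ _ h2 h1))//.
  rewrite /y exprMn -exprM !mulnDr exprD le_eqVlt; apply/orP; left; apply/eqP.
  by ring.
rewrite mfunZ mfunD !mfunXn; apply: le_trans hn.
have n1 : 0 < n`!%:R :> R by rewrite ltr0n fact_gt0.
have cn : 0 <= c ^+ n / n`!%:R by rewrite divr_ge0 ?exprn_ge0 ?ltW.
have hq := lerD (hM n) (hM (n + j)).
rewrite (le_trans (ler_wpM2l cn hq))// mulrDr.
have cB : c * B = 4^-1 by rewrite /c invfM -mulrA mulVf ?mulr1// gt_eqF.
have -> : c ^+ n / n`!%:R * (B ^+ n * n`!%:R) = (4^-1) ^+ n.
  by rewrite -cB exprMn; field; rewrite gt_eqF.
have h1 : c ^+ n / n`!%:R * (B ^+ (n + j) * (n + j)`!%:R) <= (2^-1) ^+ n * ((2 * B) ^+ j * j`!%:R).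
  apply: (@le_trans _ _ (c ^+ n / n`!%:R * (B ^+ (n + j) * (2 ^ (n + j) * n`! * j`!)%:R))).
    rewrite ler_wpM2l// ler_wpM2l ?exprn_ge0 ?(ltW B0)// ler_nat.
    exact: fact_add_le.
  rewrite !natrM natrX !exprD [(2 * B) ^+ j]exprMn.
  have -> : (2^-1 : R) = c * B * 2 by rewrite cB; field.
  rewrite !exprMn le_eqVlt; apply/orP; left; apply/eqP.
  by field; rewrite gt_eqF.
have h2 : (4^-1 : R) ^+ n <= (2^-1) ^+ n by apply: lerXn2r; rewrite ?nnegrE//; lra.
have h3 : (2^-1 : R) ^+ n <= n%:R^-1.
  rewrite exprVn lef_pV2 ?posrE ?exprn_gt0 ?ltr0n// -natrX ler_nat ltnW//.
  exact: ltn_expl.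
have K0 : 0 <= (2 * B) ^+ j * j`!%:R by rewrite mulr_ge0 ?exprn_ge0 ?mulr_ge0 ?(ltW B0).
apply: (@le_trans _ _ ((2^-1) ^+ n * K)); first by rewrite /K mulrDr mulr1 lerD.
by rewrite mulrC ler_wpM2l// addr_ge0.
Qed.

Let Gu (q : {poly R}) j : G (fun x => x ^+ j * q.[u x]).
Proof.
have := @Gsum (size q) (fun k => q`_k) (fun k x => x ^+ j * u x ^+ k) (dense_gauss^~ j).
congr G; apply/funext => x; rewrite horner_coef mulr_sumr.
by apply: eq_bigr => k _; rewrite mulrCA.
Qed.

Variable f : R -> R.
Hypothesis cf : continuous f.
Variable C : R.
Hypothesis fC : forall x, `|f x| <= C.

(** The function [u] sees only |x|: the even part of f is approximated by polynomials in [u], the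
    odd part by x times such polynomials. *)
Let fe x := (f x + f (- x)) / 2.
Let fo x := (f x - f (- x)) / 2.

Let cNf : continuous (fun x => f (- x)).
Proof. by move=> x; apply: (continuous_comp (f := -%R)); [exact: opp_continuous|exact: cf]. Qed.

Let cfe : continuous fe.
Proof. by move=> x; apply: cvgM; [apply: cvgD; [exact: cf|exact: cNf]|exact: cvg_cst]. Qed.

Let cfo : continuous fo.
Proof. by move=> x; apply: cvgM; [apply: cvgB; [exact: cf|exact: cNf]|exact: cvg_cst]. Qed.

Let feC x : `|fe x| <= C.
Proof.
rewrite normrM (ger0_norm (_ : 0 <= 2^-1)); last by rewrite invr_ge0.
rewrite ler_pdivrMr// (le_trans (ler_normD _ _))//; have := fC x; have := fC (- x); lra.
Qed.

Let foC x : `|fo x| <= C.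
Proof.
rewrite normrM (ger0_norm (_ : 0 <= 2^-1)); last by rewrite invr_ge0.
rewrite ler_pdivrMr// (le_trans (ler_normB _ _))//; have := fC x; have := fC (- x); lra.
Qed.

Let fe_abs x : fe `|x| = fe x.
Proof. by case: (ger0P x) => // _; rewrite /fe opprK addrC. Qed.

Let fo_abs x : x * fo `|x| = `|x| * fo x.
Proof. by case: (ger0P x) => // _; rewrite /fo opprK; ring. Qed.

(* The inverse of x |-> u x on [0, K], extended by K below u K. *)
Let yK (K s : R) := Num.sqrt (- ln (Num.max s (u K)) / c).

Let yK_cont K : continuous (yK K).
Proof.
move=> s; apply: (continuous_comp (f := fun s => - ln (Num.max s (u K)) / c)); last exact: sqrt_continuous.
apply: cvgM; last exact: cvg_cst.
apply: cvgN; apply: (continuous_comp (f := fun s => Num.max s (u K)) (g := @ln R)).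
  by apply: (@continuous_max R R (fun s => s) (fun=> u K) s); [exact: cvg_id|exact: cvg_cst].
by apply: continuous_ln; rewrite lt_max u0 orbT.
Qed.

Let yKE K x : 0 <= K -> yK K (u x) = Num.min `|x| K.
Proof.
move=> K0; have hy z : Num.sqrt (- ln (u z) / c) = `|z|.
  by rewrite /u expRK opprK mulrAC divff ?gt_eqF// mul1r sqrtr_sqr.
have uu y z : (u y <= u z) = (`|z| <= `|y|).
  rewrite /u ler_expR lerN2 ler_pM2l// -(real_normK (num_real z)) -(real_normK (num_real y)).
  by rewrite ler_sqr ?nnegrE.
rewrite /yK; have [h|h] := leP `|x| K.
  have /max_idPl -> : u K <= u x by rewrite uu (ger0_norm K0).
  by rewrite hy.
have /max_idPr -> : u x <= u K by rewrite uu (ger0_norm K0) ltW.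
by rewrite hy ger0_norm.
Qed.

(** On |x| <= K both parts are continuous functions of [u x], up to the factor x and a correction
    near 0, so that Weierstrass applies on [0, 1]. Beyond K the error of the truncation is at most 4
    C x^2 / K^2, a polynomial with small moment value. *)
Lemma dense_bounded : G f.
Proof.
apply: Gsand => // e e0.
have C0 : 0 <= C := le_trans (normr_ge0 _) (fC 0).
(* The majorant below is 3 a + (a + 4 C / K^2) x^2 with 4 C / K^2 <= a, so its value is at most 3 a
   + 2 a B <= e. *)
have [a [a0 ea]] : exists a : R, 0 < a /\ e = 3 * a * (1 + B).
  exists (e / (3 * (1 + B))); split; first by rewrite divr_gt0// mulr_gt0// addr_gt0.
  by field; rewrite gt_eqF// addr_gt0.
have [K [K1 hK]] : exists K, 1 <= K /\ 4 * C / K ^+ 2 <= a.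
  exists (1 + 4 * C / a); have h : 0 <= 4 * C / a by rewrite divr_ge0 ?mulr_ge0 ?(ltW a0).
  split; first by rewrite lerDl.
  rewrite ler_pdivrMr ?exprn_gt0 ?ltr_wpDr// [leRHS]mulrC -ler_pdivrMr//.
  by move: h; set t := 4 * C / a => h; rewrite expr2; nra.
have K0 : 0 < K := lt_le_trans ltr01 K1.
(* The odd part vanishes at 0. Dividing by max(|x|, eta) instead of |x| thus costs at most a, and
   the quotient stays continuous. *)
have [eta [eta0 eta1 heta]] : exists eta, [/\ 0 < eta, eta <= 1 & forall x, `|x| <= eta -> `|fo x| <= a].
  have /cvgrPdist_le/(_ _ a0)/nbhs_ballP[d /= d0 hd] := cfo (x := 0).
  exists (Num.min (d / 2) 1); split; first by rewrite lt_min divr_gt0//=.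
    by rewrite ge_min lexx orbT.
  move=> x; rewrite le_min => /andP[xd _].
  have := hd x; rewrite -ball_normE/= sub0r normrN.
  rewrite /fo oppr0 subrr mul0r sub0r normrN; apply.
  by rewrite (le_lt_trans xd)// ltr_pdivrMr// ltr_pMr// ltr1n.
have [|q1 hq1] := @weierstrass R (fun s => fe (yK K s)) 0 1 a _ a0.
  by move=> s; apply: (continuous_comp (f := yK K)); [exact: yK_cont|exact: cfe].
have [|q2 hq2] := @weierstrass R (fun s => fo (yK K s) / Num.max (yK K s) eta) 0 1 a _ a0.
  move=> s; apply: cvgM.
    by apply: (continuous_comp (f := yK K)); [exact: yK_cont|exact: cfo].
  apply: cvgV; first by rewrite gt_eqF// lt_max eta0 orbT.
  by apply: (@continuous_max R R (yK K) (fun=> eta) s); [exact: yK_cont|exact: cvg_cst].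
have u01 x : 0 <= u x <= 1 by rewrite (ltW (u0 x)) u1.
exists (fun x => 1 * (x ^+ 0 * q1.[u x]) + x ^+ 1 * q2.[u x]).
exists ((3 * a)%:P + (a + 4 * C / K ^+ 2) *: 'X^2); split.
- by apply: Glin; exact: Gu.
- move=> x; rewrite expr0 !mul1r expr1 !hornerE/=.
  have := hq1 _ (u01 x); have := hq2 _ (u01 x); rewrite yKE ?(ltW K0)//.
  set y := Num.min `|x| K => h2 h1.
  have fE : f x = fe x + fo x by rewrite /fe /fo; field.
  have x2 : `|x| <= 1 + x ^+ 2.
    rewrite -(real_normK (num_real x)); have := sqr_ge0 (`|x| - 1); rewrite sqrrB expr1n mulr1.
    by have := normr_ge0 x; lra.
  have hx2 : `|x * (fo y / Num.max y eta - q2.[u x])| <= a * (1 + x ^+ 2).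
    by rewrite normrM mulrC ler_pM.
  have -> : f x - (q1.[u x] + x * q2.[u x]) = (fe x - fe y) + (fo x - x * (fo y / Num.max y eta))
     + (fe y - q1.[u x]) + x * (fo y / Num.max y eta - q2.[u x]).
    by rewrite fE; ring.
  suff h3 : `|(fe x - fe y) + (fo x - x * (fo y / Num.max y eta))| <= a + 4 * C / K ^+ 2 * x ^+ 2.
    rewrite (le_trans (ler_normD _ _))// (le_trans (lerD (ler_normD _ _) (lexx _)))//.
    rewrite (le_trans (lerD (lerD h3 h1) hx2))//.
    by rewrite le_eqVlt; apply/orP; left; apply/eqP; ring.
  rewrite /y; have [xK|Kx] := leP `|x| K.
    rewrite fe_abs subrr add0r mulrA fo_abs.
    apply: (@le_trans _ _ a); last by rewrite lerDl mulr_ge0 ?sqr_ge0// divr_ge0 ?sqr_ge0// mulr_ge0.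
    have [xe|ex] := leP eta `|x|.
      have x0 : `|x| != 0 by rewrite gt_eqF// (lt_le_trans eta0).
      by rewrite mulrAC divff// mul1r subrr normr0 ltW.
    rewrite [_ * fo x]mulrC -mulrA -[X in X - _]mulr1 -mulrBr normrM.
    rewrite (le_trans _ (heta x (ltW ex)))// ler_piMr//.
    have h0 : 0 <= `|x| / eta by rewrite divr_ge0 ?(ltW eta0).
    have h1' : `|x| / eta <= 1 by rewrite ler_pdivrMr// mul1r ltW.
    by rewrite ger0_norm; lra.
  have eK : eta <= K by rewrite (le_trans eta1).
  have /max_idPl -> := eK.
  have r1 : 1 <= `|x| / K by rewrite ler_pdivlMr// mul1r ltW.
  have rr : `|x| / K <= x ^+ 2 / K ^+ 2.
    rewrite -[x ^+ 2](real_normK (num_real x)) -expr_div_n expr2 ler_peMr//; exact: le_trans ler01 r1.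
  have t1 : `|fe x - fe K| <= 2 * C.
    by rewrite (le_trans (ler_normB _ _))//; have := feC x; have := feC K; lra.
  have t2 : `|x * (fo K / K)| <= C * (`|x| / K).
    have -> : x * (fo K / K) = fo K * (x / K) by ring.
    rewrite normrM [`|x / K|]normrM (ger0_norm (_ : 0 <= K^-1)) ?invr_ge0 ?(ltW K0)//.
    by apply: ler_wpM2r => //; rewrite divr_ge0 ?(ltW K0).
  rewrite (le_trans (ler_normD _ _))//.
  apply: (@le_trans _ _ (2 * C + (C + C * (`|x| / K)))).
    by rewrite lerD// (le_trans (ler_normB _ _))// lerD.
  have -> : 4 * C / K ^+ 2 * x ^+ 2 = 4 * C * (x ^+ 2 / K ^+ 2) by rewrite mulrAC mulrA.
  have p1 := ler_wpM2l C0 r1; have p2 := ler_wpM2l C0 rr.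
  by lra.
rewrite mfunD mfunC mfunZ mfunXn.
have m0 : M 0%N <= 1 by have := hM 0; rewrite muln0 expr0 fact0 mulr1.
have m2 : M 2%N <= B by have := hM 1; rewrite muln1 expr1 mulr1.
have h1 : 3 * a * M 0%N <= 3 * a by rewrite ger_pMr// mulr_gt0.
have h2 : (a + 4 * C / K ^+ 2) * M 2%N <= (a + 4 * C / K ^+ 2) * B.
  by rewrite ler_wpM2l// addr_ge0 ?(ltW a0)// divr_ge0 ?sqr_ge0 ?mulr_ge0.
have h3 : (a + 4 * C / K ^+ 2) * B <= (a + a) * B by rewrite ler_wpM2r ?(ltW B0)// lerD2l.
rewrite ea; apply: le_trans (lerD h1 (le_trans h2 h3)) _.
by have aB := mulr_ge0 (ltW a0) (ltW B0); lra.
Qed.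

End Density.

Local Open Scope ring_scope.
Local Open Scope classical_set_scope.

(** * The limit measure *)

Section CdfMeasure.
Variables (R : realType) (F : R -> R).
Hypothesis Fnd : nondecreasing F.
Hypothesis Frc : right_continuous F.
Hypothesis FNy : F @ -oo --> (0 : R).
Hypothesis Fy : F @ +oo --> (1 : R).

HB.instance Definition _ := isCumulative.Build R _ R F Fnd Frc.
HB.instance Definition _ := isCumulativeBounded.Build R 0 1 F FNy Fy.

Let idTR : measurableTypeR R -> R := idfun.

#[local] HB.instance Definition _ :=
  @isMeasurableFun.Build _ _ _ _ idTR (@measurable_id _ _ setT).

Lemma cdf_measure : exists mu : probability R R, forall t, mu `]-oo, t] = (F t)%:E.
Proof.
(* Pushing the Stieltjes measure forward along the identity only moves it to the measurable type
   R. *)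
exists (distribution (lebesgue_stieltjes_measure F) idTR) => t.
exact: (@cdf_lebesgue_stieltjes_id R F t).
Qed.

End CdfMeasure.

(** * Integrals against a probability and approximation by step functions *)

Section BoundedIntegral.
Context d (T : measurableType d) (R : realType) (P : probability T R).

Lemma bounded_integrable (f : T -> R) (C : R) : measurable_fun setT f ->
  (forall x, `|f x| <= C) -> P.-integrable setT (EFin \o f).
Proof.
move=> mf fC; apply: measurable_bounded_integrable => //.
  by rewrite (le_lt_trans (probability_le1 _ _))// ltry.
exists C; split; first exact: num_real.
by move=> x Cx y _ /=; exact: le_trans (fC y) (ltW Cx).
Qed.

Lemma Rintegral_cstT (r : R) : (\int[P]_x r)%R = r.
Proof.
rewrite Rintegral_cst//.
by have /(congr1 fine)/= -> := probability_setT P; rewrite mulr1.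
Qed.

Lemma Rintegral_indicT (A : set T) : measurable A -> (\int[P]_x \1_A x)%R = fine (P A).
Proof. by move=> mA; rewrite /Rintegral integral_indic// setIT. Qed.

Lemma indic_integrable (A : set T) : measurable A -> P.-integrable setT (EFin \o \1_A).
Proof.
move=> mA; apply: (@bounded_integrable _ 1); first exact: measurable_indic.
by move=> x; rewrite indicE ger0_norm// lern1 leq_b1.
Qed.

Lemma integrable_scale (c : R) (f : T -> R) : P.-integrable setT (EFin \o f) ->
  P.-integrable setT (EFin \o (fun x => c * f x)).
Proof.
move=> jf; have := integrableZl measurableT c jf.
by apply: eq_integrable => // x _ /=; rewrite EFinM.
Qed.

Lemma integrable_add (f g : T -> R) : P.-integrable setT (EFin \o f) ->
  P.-integrable setT (EFin \o g) -> P.-integrable setT (EFin \o (fun x => f x + g x)).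
Proof.
move=> jf jg; have := integrableD measurableT jf jg.
by apply: eq_integrable => // x _ /=; rewrite EFinD.
Qed.

Lemma integrable_sub (f g : T -> R) : P.-integrable setT (EFin \o f) ->
  P.-integrable setT (EFin \o g) -> P.-integrable setT (EFin \o (fun x => f x - g x)).
Proof.
move=> jf jg; have := integrableB measurableT jf jg.
by apply: eq_integrable => // x _ /=; rewrite EFinB.
Qed.

Lemma integrable_cstT (c : R) : P.-integrable setT (EFin \o cst c).
Proof. exact: (@bounded_integrable _ `|c|). Qed.

Lemma Rintegral_bigsum (I : eqType) (r : seq I) (Q : pred I) (f : I -> T -> R) :
  (forall i, i \in r -> Q i -> P.-integrable setT (EFin \o f i)) ->
  P.-integrable setT (EFin \o (fun x => \sum_(i <- r | Q i) f i x)) /\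
  \int[P]_x (\sum_(i <- r | Q i) f i x) = \sum_(i <- r | Q i) \int[P]_x f i x.
Proof.
elim: r => [|i r IH] fi.
  rewrite big_nil (_ : (fun x => _) = cst 0); last by apply/funext => x; rewrite big_nil.
  split; last by rewrite Rintegral_cstT.
  exact: integrable_cstT.
have [|IH1 IH2] := IH; first by move=> j jr; apply: fi; rewrite inE jr orbT.
rewrite big_cons; under eq_Rintegral do rewrite big_cons.
rewrite (_ : (fun x => _) = (fun x => if Q i then f i x + \sum_(j <- r | Q j) f j x
  else \sum_(j <- r | Q j) f j x)); last by apply/funext => x; rewrite big_cons.
have := fi i; rewrite inE eqxx; case: (Q i) => // /(_ isT isT) h; split.
  exact: integrable_add.
by rewrite RintegralD// IH2.
Qed.

End BoundedIntegral.

Section HalfLine.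
Variable R : realType.

(* With G i = 1 left of t i and 0 right of t i + h, the increments of G are a partition of unity. *)
Lemma step_approx (f : R -> R) (t : nat -> R) (G : nat -> R) n (h w C x : R) :
  (forall i, (i <= n)%N -> 0 <= G i <= 1) ->
  (forall i, (i < n)%N -> G i <= G i.+1) ->
  (forall i, (i <= n)%N -> x <= t i -> G i = 1) ->
  (forall i, (i <= n)%N -> t i + h <= x -> G i = 0) ->
  (forall i, t i.+1 = t i + h) -> 0 <= w ->
  (forall i, (i < n)%N -> `|t i - x| <= 2 * h -> `|f (t i) - f x| <= w) ->
  `|f x| <= C -> 0 < h ->
  `|f x - \sum_(i < n) f (t i) * (G i.+1 - G i)| <= w + C * (1 - (G n - G 0%N)).
Proof.
move=> G01 Gm Gl Gr tS w0 fw fC h0.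
have tel : \sum_(i < n) (G i.+1 - G i) = G n - G 0%N.
  by rewrite -(big_mkord xpredT (fun i => G i.+1 - G i)) telescope_sumr.
have /andP[n0 n1] := G01 n (leqnn _); have /andP[z0 z1] := G01 0%N (leq0n _).
have G0n : G 0%N <= G n.
  by rewrite -subr_ge0 -tel sumr_ge0// => i _; rewrite subr_ge0 Gm.
have -> : f x - \sum_(i < n) f (t i) * (G i.+1 - G i) =
    f x * (1 - (G n - G 0%N)) - \sum_(i < n) (f (t i) - f x) * (G i.+1 - G i).
  under [X in _ = _ - X]eq_bigr do rewrite mulrBl.
  by rewrite sumrB -mulr_sumr tel; ring.
rewrite (le_trans (ler_normB _ _))// addrC lerD//; last first.
  by rewrite normrM [X in _ * X <= _]ger0_norm ?ler_wpM2r//; lra.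
apply: (@le_trans _ _ (\sum_(i < n) w * (G i.+1 - G i))); last first.
  by rewrite -mulr_sumr tel ler_piMr//; lra.
rewrite (le_trans (ler_norm_sum _ _ _))// ler_sum// => i _.
have gm : 0 <= G i.+1 - G i by rewrite subr_ge0 Gm.
rewrite normrM (ger0_norm gm).
have [xl|xl] := leP x (t i).
  have -> : G i.+1 - G i = 0.
    rewrite (Gl i (ltnW (ltn_ord i)) xl) (Gl i.+1 (ltn_ord i)) ?subrr// tS.
    by rewrite (le_trans xl)// lerDl ltW.
  by rewrite !mulr0.
have [xr|xr] := leP (t i + h + h) x.
  have -> : G i.+1 - G i = 0.
    rewrite (Gr i.+1 (ltn_ord i)) ?tS// (Gr i (ltnW (ltn_ord i))) ?subrr//.
    by rewrite (le_trans _ xr)// lerDl ltW.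
  by rewrite !mulr0.
apply: ler_wpM2r => //; apply: fw => //.
by rewrite ler_norml; apply/andP; split; lra.
Qed.

End HalfLine.

Section StepFunctional.
Variables (R : realType) (D : (R -> R) -> Prop) (E : (R -> R) -> R).
Hypothesis Dlin : forall a f g, D f -> D g -> D (fun x => a * f x + g x).
Hypothesis Elin : forall a f g, D f -> D g -> E (fun x => a * f x + g x) = a * E f + E g.
Hypothesis Ele : forall f g, D f -> D g -> (forall x, f x <= g x) -> E f <= E g.
Hypothesis D1 : D (fun=> 1).
Hypothesis E1 : E (fun=> 1) = 1.

Lemma functional0 : D (fun=> 0) /\ E (fun=> 0) = 0.
Proof.
have e : (fun=> -1 * 1 + 1) = (fun=> 0) :> (R -> R) by apply/funext => x; rewrite mulN1r addNr.
split; first by rewrite -e; exact: (Dlin (-1) D1 D1).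
by rewrite -e (Elin (-1) D1 D1) E1 mulN1r addNr.
Qed.

Lemma functional_sum n (a : nat -> R) (f : nat -> R -> R) :
  (forall k, (k < n)%N -> D (f k)) ->
  D (fun x => \sum_(k < n) a k * f k x) /\
  E (fun x => \sum_(k < n) a k * f k x) = \sum_(k < n) a k * E (f k).
Proof.
elim: n => [_|n IH h].
  have [d e] := functional0.
  by rewrite big_ord0 (_ : (fun x => _) = (fun=> 0))//; apply/funext => x; rewrite big_ord0.
have [|d e] := IH; first by move=> k kn; apply: h; exact: ltnW.
have fn := h n (ltnSn n).
rewrite (_ : (fun x => \sum_(k < n.+1) _) = (fun x => a n * f n x + \sum_(k < n) a k * f k x)); last first.
  by apply/funext => x; rewrite big_ord_recr/= addrC.
split; first exact: Dlin.
by rewrite Elin// e big_ord_recr/= addrC.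
Qed.

Lemma functional_dist f g h : D f -> D g -> D h -> (forall x, `|f x - g x| <= h x) ->
  `|E f - E g| <= E h.
Proof.
move=> Df Dg Dh fgh; rewrite ler_norml; apply/andP; split.
  rewrite lerBrDl lerBlDr; have -> : E f + E h = E (fun x => 1 * f x + h x) by rewrite Elin// mul1r.
  by apply: Ele => // [|x]; [exact: Dlin|have := fgh x; rewrite ler_norml mul1r; lra].
rewrite lerBlDr; have -> : E h + E g = E (fun x => 1 * h x + g x) by rewrite Elin// mul1r.
by apply: Ele => // [|x]; [exact: Dlin|have := fgh x; rewrite ler_norml mul1r; lra].
Qed.

(** Stated for an abstract positive linear E because it is used twice with the same nodes: for the
    limit functional, with continuous ramps, and for the integral against mu, with indicators of
    half-lines. Both values are then close to one Riemann-Stieltjes sum. *)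
Lemma step_functional (f : R -> R) (t : nat -> R) (G : nat -> R -> R) n (h w C : R) :
  (forall i x, 0 <= G i x <= 1) ->
  (forall i x, G i x <= G i.+1 x) ->
  (forall i x, x <= t i -> G i x = 1) ->
  (forall i x, t i + h <= x -> G i x = 0) ->
  (forall i, t i.+1 = t i + h) -> 0 <= w ->
  (forall i x, (i < n)%N -> `|t i - x| <= 2 * h -> `|f (t i) - f x| <= w) ->
  (forall x, `|f x| <= C) -> 0 < h -> D f -> (forall i, D (G i)) ->
  `|E f - \sum_(i < n) f (t i) * (E (G i.+1) - E (G i))| <= w + C * (1 - (E (G n) - E (G 0%N))).
Proof.
move=> G01 Gm Gl Gr tS w0 fw fC h0 Df DG.
have [d0 e0] := functional0.
have DGS i : D (fun x => -1 * G i x + G i.+1 x) by exact: Dlin.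
have [dS eS] := @functional_sum n (fun i => f (t i)) (fun i x => -1 * G i x + G i.+1 x) (fun k _ => DGS k).
have eS' : \sum_(i < n) f (t i) * (E (G i.+1) - E (G i)) =
    E (fun x => \sum_(k < n) f (t k) * (-1 * G k x + G k.+1 x)).
  by rewrite eS; apply: eq_bigr => i _; rewrite Elin// mulN1r addrC.
rewrite eS'.
have D1w : D (fun x => (w + C) * 1 + 0) by exact: Dlin.
pose H x := C * (-1 * G n x + G 0%N x) + ((w + C) * 1 + 0).
have DH : D H by apply: Dlin => //; exact: Dlin.
have EH : E H = w + C * (1 - (E (G n) - E (G 0%N))).
  rewrite /H Elin ?Elin//; first by rewrite e0 E1; ring.
  exact: Dlin.
rewrite -EH; apply: functional_dist => // x.
have -> : \sum_(k < n) f (t k) * (-1 * G k x + G k.+1 x) = \sum_(i < n) f (t i) * (G i.+1 x - G i x).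
  by apply: eq_bigr => i _; rewrite mulN1r addrC.
have -> : H x = w + C * (1 - (G n x - G 0%N x)) by rewrite /H; ring.
apply: (@step_approx R f t (fun i => G i x) n h w C x) => // i.
- by move=> _; exact: Gl.
- by move=> _; exact: Gr.
- by move=> hi; exact: fw.
Qed.

End StepFunctional.

Section Ramp.
Variable R : realType.

(** A continuous substitute for the indicator of a half-line: for a < b it is 1 up to a and 0 from b
    on, and affine between. *)
Definition ramp (a b x : R) : R := Num.max 0 (Num.min 1 ((b - x) / (b - a))).

Lemma ramp_continuous a b : continuous (ramp a b).
Proof.
move=> x; apply: (@continuous_max R R (fun=> 0) (fun x => Num.min 1 ((b - x) / (b - a))) x).
  exact: cvg_cst.
apply: (@continuous_min R R (fun=> 1) (fun x => (b - x) / (b - a)) x); first exact: cvg_cst.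
by apply: cvgM; [apply: cvgB; [exact: cvg_cst|exact: cvg_id]|exact: cvg_cst].
Qed.

Lemma ramp01 a b x : 0 <= ramp a b x <= 1.
Proof. by rewrite /ramp le_max lexx ge_max ler01 ge_min lexx. Qed.

Lemma ramp_bound a b x : `|ramp a b x| <= 1.
Proof. by have /andP[h0 h1] := ramp01 a b x; rewrite ger0_norm. Qed.

Lemma ramp_l a b x : a < b -> x <= a -> ramp a b x = 1.
Proof.
move=> ab xa; rewrite /ramp; have /min_idPl -> : 1 <= (b - x) / (b - a).
  by rewrite ler_pdivlMr ?subr_gt0// mul1r lerD2l lerN2.
by apply/max_idPr.
Qed.

Lemma ramp_r a b x : a < b -> b <= x -> ramp a b x = 0.
Proof.
move=> ab bx; apply/max_idPl; rewrite ge_min; apply/orP; right.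
by rewrite pmulr_lle0 ?invr_gt0 ?subr_gt0// subr_le0.
Qed.

Lemma ramp_le a b a' b' x : a < b -> a' < b' -> b <= a' -> ramp a b x <= ramp a' b' x.
Proof.
move=> ab ab' ba; have [xa|ax] := leP x a'.
  by rewrite (ramp_l ab' xa); have /andP[] := ramp01 a b x.
by rewrite (ramp_r ab) ?(le_trans ba (ltW ax))//; have /andP[] := ramp01 a' b' x.
Qed.

End Ramp.

(** * The distribution function of the limit functional *)

Section MomentMeasure.
Variables (R : realType) (M : nat -> R) (B : R).
Hypothesis B1 : 1 <= B.
Hypothesis hM : forall k, M (2 * k)%N <= B ^+ k * k`!%:R.
Hypothesis M0 : M 0%N = 1.
Variable LN : nat -> (R -> R) -> R.
Hypothesis LNlin : forall N a f g, LN N (fun x => a * f x + g x) = a * LN N f + LN N g.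
Hypothesis LNpos : forall N f, (forall x, 0 <= f x) -> 0 <= LN N f.
Hypothesis LNmom : forall k, (LN ^~ (fun x => x ^+ k)) @ \oo --> M k.

Let B0 : 0 < B. Proof. exact: lt_le_trans B1. Qed.

Let LN0 N : LN N (fun=> 0) = 0.
Proof.
have e : (fun=> -1 * 0 + 0) = (fun=> 0) :> (R -> R) by apply/funext => x; rewrite mulr0 addr0.
by have := LNlin N (-1) (fun=> 0) (fun=> 0); rewrite e mulN1r addNr.
Qed.

Let LNle N f g : (forall x, f x <= g x) -> LN N f <= LN N g.
Proof.
move=> fg; rewrite -subr_ge0 addrC -mulN1r -LNlin; apply: LNpos => x.
by rewrite mulN1r addrC subr_ge0.
Qed.

Let LNdist N f g h : (forall x, `|f x - g x| <= h x) -> `|LN N f - LN N g| <= LN N h.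
Proof.
have h1 a f1 f2 : True -> True -> LN N (fun x => a * f1 x + f2 x) = a * LN N f1 + LN N f2 by [].
have h2 f1 f2 : True -> True -> (forall x, f1 x <= f2 x) -> LN N f1 <= LN N f2.
  by move=> _ _; exact: LNle.
by move=> fgh; apply: (@functional_dist R (fun=> True) (LN N)).
Qed.

Definition Ldom (f : R -> R) := exists l : R, LN ^~ f @ \oo --> l.
Definition Lim (f : R -> R) : R := limn (LN ^~ f).

Lemma Lim_cvg f : Ldom f -> LN ^~ f @ \oo --> Lim f.
Proof. by move=> [l hl]; apply/cvg_ex; exists l. Qed.

Lemma Lim_eq f l : LN ^~ f @ \oo --> l -> Lim f = l.
Proof. by move=> h; exact: (cvg_lim _ h). Qed.

Lemma Ldom_lin a f g : Ldom f -> Ldom g -> Ldom (fun x => a * f x + g x) /\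
  Lim (fun x => a * f x + g x) = a * Lim f + Lim g.
Proof.
move=> /Lim_cvg hf /Lim_cvg hg.
have h : LN ^~ (fun x => a * f x + g x) @ \oo --> a * Lim f + Lim g.
  rewrite (_ : LN ^~ _ = fun N => a * LN N f + LN N g); last by apply/funext => N; rewrite LNlin.
  by apply: cvgD => //; apply: cvgM => //; exact: cvg_cst.
by split; [exists (a * Lim f + Lim g)|exact: Lim_eq].
Qed.

Lemma Lim_le f g : Ldom f -> Ldom g -> (forall x, f x <= g x) -> Lim f <= Lim g.
Proof.
move=> /Lim_cvg hf /Lim_cvg hg fg; rewrite -(cvg_lim _ hf)// -(cvg_lim _ hg)//.
apply: ler_lim; [by apply/cvg_ex; eexists; exact: hf|by apply/cvg_ex; eexists; exact: hg|].
by apply: nearW => N; exact: LNle.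
Qed.

Lemma Lim_poly (q : {poly R}) : LN ^~ (horner q) @ \oo --> mfun M q.
Proof.
have -> : LN ^~ (horner q) = fun N => \sum_(k < size q) q`_k * LN N (fun x => x ^+ k).
  apply/funext => N; rewrite (_ : horner q = fun x => \sum_(k < size q) q`_k * x ^+ k); last first.
    by apply/funext => x; rewrite horner_coef.
  elim: (size q) => [|n IH].
    by rewrite big_ord0 -(LN0 N); congr (LN N); apply/funext => x; rewrite big_ord0.
  rewrite big_ord_recr/= -IH addrC -LNlin; congr (LN N); apply/funext => x.
  by rewrite big_ord_recr/= addrC.
apply: cvg_big => [|k _]; first exact: add_continuous.
by apply: cvgM; [exact: cvg_cst|exact: LNmom].
Qed.

Lemma Lim_sandwich f : continuous f ->
  (forall e, 0 < e -> exists g (q : {poly R}),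
     [/\ Ldom g, forall x, `|f x - g x| <= q.[x] & mfun M q <= e]) -> Ldom f.
Proof.
move=> _ h; suff : cvgn (LN ^~ f) by move=> /cvg_ex[l hl]; exists l.
apply/cauchy_cvgP/cauchy_exP => e e0.
(* Three errors of e/8, namely M(q), the convergence on q and the convergence on g, put [LN N f]
   within 3 e/8 of [Lim g]; two such terms differ by less than e. *)
have e8 : 0 < e / 8 by rewrite divr_gt0.
have [g [q [/Lim_cvg hg fgq qe]]] := h _ e8.
have [n1 hn1] := (cvgnP _ _).1 hg _ e8.
have [n2 hn2] := (cvgnP _ _).1 (@Lim_poly q) _ e8.
have hd N : (maxn n1 n2 <= N)%N -> `|LN N f - Lim g| <= 3 * (e / 8).
  rewrite geq_max => /andP[/hn1 + /hn2]; have := LNdist N fgq.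
  by rewrite !ler_norml => /andP[? ?] /andP[? ?] /andP[? ?]; apply/andP; split; lra.
exists (LN (maxn n1 n2) f); exists (maxn n1 n2) => // n /= hn.
rewrite -ball_normE/=; have := hd _ hn; have := hd _ (leqnn _).
by rewrite !ler_norml ltr_norml => /andP[? ?] /andP[? ?]; apply/andP; split; lra.
Qed.

Lemma Ldom_bounded f C : continuous f -> (forall x, `|f x| <= C) -> Ldom f.
Proof.
move=> cf fC; apply: (@dense_bounded R M B B1 hM Ldom _ _ _ f cf C fC).
- by move=> q; exists (mfun M q); exact: Lim_poly.
- by move=> a g h dg dh; have [] := Ldom_lin a dg dh.
- exact: Lim_sandwich.
Qed.

Let Dl a f g (df : Ldom f) (dg : Ldom g) := (Ldom_lin a df dg).1.
Let El a f g (df : Ldom f) (dg : Ldom g) := (Ldom_lin a df dg).2.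

Let Ldom_poly q : Ldom (horner q). Proof. by exists (mfun M q); exact: Lim_poly. Qed.

Let Lim_polyE q : Lim (horner q) = mfun M q. Proof. exact: Lim_eq (@Lim_poly q). Qed.

Let one_poly : (fun=> 1) = horner 1%:P :> (R -> R).
Proof. by apply/funext => x; rewrite hornerC. Qed.

Let D1 : Ldom (fun=> 1). Proof. by rewrite one_poly. Qed.
Let E1 : Lim (fun=> 1) = 1. Proof. by rewrite one_poly Lim_polyE mfunC mul1r M0. Qed.

Let Dramp a b : Ldom (ramp a b).
Proof. by apply: (@Ldom_bounded _ 1); [exact: ramp_continuous|exact: ramp_bound]. Qed.

Let Phi a b := Lim (ramp a b).

Let Phi01 a b : 0 <= Phi a b <= 1.
Proof.
have [D0 E0] := functional0 Dl El D1 E1.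
apply/andP; split; rewrite /Phi; [rewrite -E0|rewrite -E1]; apply: Lim_le => // x;
  by have /andP[] := ramp01 a b x.
Qed.

(** The indicator of the half-line up to t is approached by ramps from the right. The strict
    inequality [t < z.1] leaves room to move t, which yields right continuity. *)
Let F t := inf [set Phi z.1 z.2 | z in [set z | t < z.1 < z.2]].

Let F_le t a b : t < a -> a < b -> F t <= Phi a b.
Proof.
move=> ta ab; apply: ge_inf; last by exists (a, b) => //=; rewrite ta.
by exists 0 => _ [z _ <-]; have /andP[] := Phi01 z.1 z.2.
Qed.

Let le_F t c : (forall a b, t < a -> a < b -> c <= Phi a b) -> c <= F t.
Proof.
move=> h; apply: lb_le_inf; last by move=> _ [[a b] /= /andP[ta ab] <-]; exact: h.
by exists (Phi (t + 1) (t + 2)), (t + 1, t + 2) => //=; lra.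
Qed.

Let Phi_le_F t a b : a < b -> b <= t -> Phi a b <= F t.
Proof.
move=> ab bt; apply: le_F => a' b' ta ab'; apply: Lim_le => // x.
by apply: ramp_le => //; lra.
Qed.

Let Fnd : nondecreasing F.
Proof. by move=> t t' tt'; apply: le_F => a b ta ab; apply: F_le => //; exact: le_lt_trans ta. Qed.

Let F_adherent t e : 0 < e -> exists a b, [/\ t < a, a < b & Phi a b <= F t + e].
Proof.
move=> e0; apply: contrapT => h; have : F t + e <= F t; last by rewrite gerDl leNgt e0.
apply: le_F => a b ta ab; rewrite leNgt; apply/negP => hl; apply: h.
by exists a, b; split => //; exact: ltW.
Qed.

Let Frc : right_continuous F.
Proof.
move=> x; apply/cvgrPdist_le => e e0; have [a [b [xa ab hab]]] := F_adherent x e0.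
near=> y.
have xy : x <= y by apply: ltW; near: y; exact: nbhs_right_gt.
have ya : y < a by near: y; exact: nbhs_right_lt.
have := Fnd xy; have := F_le ya ab; rewrite ler_norml => *; apply/andP; split; lra.
Unshelve. all: by end_near. Qed.

Let tail (K : R) : 0 < K -> Lim (horner (K^-1 ^+ 2 *: 'X^2)) <= B / K ^+ 2.
Proof.
move=> K0; rewrite Lim_polyE mfunZ mfunXn exprVn mulrC ler_wpM2r ?invr_ge0 ?sqr_ge0//.
by have := hM 1; rewrite muln1 expr1 mulr1.
Qed.

(** Chebyshev with x^2 / K^2; the shift by 2 leaves room for a ramp from -K - 1 to -K that lies
    strictly to the right of the argument of F. *)
Let FNy_le K : 0 < K -> F (- K - 2) <= B / K ^+ 2.
Proof.
move=> K0; apply: (@le_trans _ _ (Phi (- K - 1) (- K))); first by apply: F_le; lra.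
apply: le_trans (tail K0); apply: Lim_le => // x.
rewrite hornerZ hornerXn exprVn; have [xK|Kx] := ltP x (- K); last first.
  rewrite (_ : ramp _ _ x = 0); first by rewrite mulr_ge0 ?invr_ge0 ?sqr_ge0.
  by apply: ramp_r => //; lra.
have /andP[_ h1] := ramp01 (- K - 1) (- K) x; apply: (le_trans h1).
by rewrite ler_pdivlMl ?exprn_gt0// mulr1; nra.
Qed.

Let Fy_ge K : 0 < K -> 1 - B / K ^+ 2 <= F (K + 1).
Proof.
move=> K0; apply: (@le_trans _ _ (Phi K (K + 1))); last by apply: Phi_le_F; lra.
rewrite lerBlDr -lerBlDl; apply: le_trans (tail K0).
have -> : 1 - Phi K (K + 1) = Lim (fun x => -1 * ramp K (K + 1) x + 1).
  by rewrite El// E1 mulN1r addrC.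
apply: Lim_le => //; first exact: Dl.
move=> x; rewrite hornerZ hornerXn exprVn; have [xK|Kx] := leP x K.
  by rewrite ramp_l// ?ltrDl// mulr1 addNr mulr_ge0 ?invr_ge0 ?sqr_ge0.
have /andP[h0 _] := ramp01 K (K + 1) x.
apply: (@le_trans _ _ 1); first lra.
by rewrite ler_pdivlMl ?exprn_gt0// mulr1; nra.
Qed.

Let F01 t : 0 <= F t <= 1.
Proof.
apply/andP; split; first by apply: le_F => a b _ _; have /andP[] := Phi01 a b.
by apply: (le_trans (F_le (a := t + 1) (b := t + 2) _ _)); try lra; have /andP[] := Phi01 (t + 1) (t + 2).
Qed.

Let tail_small e : 0 < e -> exists2 K, 0 < K & B / K ^+ 2 <= e.
Proof.
move=> e0; have [n0 /(_ n0 (leqnn _))[n_gt0 hn]] := @inv_small R B e e0.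
exists n0%:R; first by rewrite ltr0n.
apply: le_trans hn; rewrite ler_pM2l// lef_pV2 ?posrE ?exprn_gt0 ?ltr0n//.
by rewrite expr2 -natrM ler_nat leq_pmull.
Qed.

Let FNy : F @ -oo --> (0 : R).
Proof.
apply/cvgrPdist_le => e e0; have [K K0 hK] := tail_small e0.
near=> t; have tK : t <= - K - 2 by near: t; apply: nbhs_ninfty_le; exact: num_real.
rewrite sub0r normrN ger0_norm; last by have /andP[] := F01 t.
by rewrite (le_trans (Fnd tK))// (le_trans (FNy_le K0)).
Unshelve. all: by end_near. Qed.

Let Fy : F @ +oo --> (1 : R).
Proof.
apply/cvgrPdist_le => e e0; have [K K0 hK] := tail_small e0.
near=> t; have tK : K + 1 <= t by near: t; apply: nbhs_pinfty_ge; exact: num_real.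
rewrite ger0_norm; last by have /andP[_] := F01 t; rewrite subr_ge0.
have := Fy_ge K0; have := Fnd tK; lra.
Unshelve. all: by end_near. Qed.

Lemma limit_cdf_measure : exists mu : probability R R,
  forall f C, continuous f -> (forall x, `|f x| <= C) -> (\int[mu]_x f x)%R = Lim f.
Proof.
have [mu muF] := cdf_measure Fnd Frc FNy Fy; exists mu => f C cf fC.
have C0 : 0 <= C := le_trans (normr_ge0 _) (fC 0).
apply/eqP; rewrite -subr_eq0 -normr_eq0 eq_le normr_ge0 andbT.
apply/ler_addgt0Pl => e e0; rewrite addr0.
(* Then C (2 s) <= e/4, which with w = e/4 gives the bound e/2 in each of the two comparisons. *)
pose s := e / (8 * (1 + C)).
have s0 : 0 < s by rewrite divr_gt0// mulr_gt0// ltr_wpDr.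
have [K0' K0'0 hK0] := tail_small s0.
pose K := K0' + 2.
have K0 : 0 < K by rewrite addr_gt0.
have FK : 1 - s <= F K.
  apply: le_trans (Fnd (_ : K0' + 1 <= K)); last by rewrite /K; lra.
  by apply: le_trans (Fy_ge K0'0); rewrite lerD2l lerN2.
have FNK : F (- K) <= s.
  by apply: le_trans hK0; apply: le_trans (FNy_le K0'0); apply: Fnd; rewrite /K; lra.
pose w := e / 4; have w0 : 0 < w by rewrite divr_gt0.
have [d d0 hd] := @heine R f (- K) K w cf w0.
have [n0 /(_ n0 (leqnn _))[n_gt0 hn]] := @inv_small R (4 * K) d d0.
pose n := n0; pose h := 2 * K / n%:R.
have n0' : 0 < n%:R :> R by rewrite ltr0n.
have h0 : 0 < h by rewrite divr_gt0// mulr_gt0.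
have h2 : 2 * h <= d by apply: le_trans hn; rewrite /h mulrA mulrA -natrM.
pose t i : R := - K + i%:R * h.
have tS i : t i.+1 = t i + h by rewrite /t -natr1 mulrDl mul1r addrA.
have t0 : t 0%N = - K by rewrite /t mul0r addr0.
have tn : t n = K by rewrite /t /h mulrC divfK ?gt_eqF//; ring.
have fw i x : (i < n)%N -> `|t i - x| <= 2 * h -> `|f (t i) - f x| <= w.
  move=> ilt hx; apply: hd; last exact: le_trans hx h2.
  have ih0 : 0 <= i%:R * h by rewrite mulr_ge0 ?(ltW h0) ?(ltW s0).
  have : i%:R * h <= n%:R * h by rewrite ler_wpM2r ?(ltW h0)// ler_nat ltnW.
  by move: tn; rewrite /t => tn' hi; apply/andP; split; lra.
have Df : Ldom f by exact: Ldom_bounded fC.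
have bound (p : nat -> R) : p n = F K -> p 0%N = F (- K) ->
    w + C * (1 - (p n - p 0%N)) <= e / 2.
  move=> -> ->; apply: (@le_trans _ _ (w + C * (2 * s))).
    by rewrite lerD2l ler_wpM2l//; lra.
  have : C * (2 * s) <= e / 4; last by rewrite /w; lra.
  have -> : e / 4 = (1 + C) * (2 * s) by rewrite /s; field; rewrite gt_eqF// ltr_wpDr.
  by rewrite ler_wpM2r ?lerDr// mulr_ge0// ltW.
pose S (p : nat -> R) := \sum_(i < n) f (t i) * (p i.+1 - p i).
have hL : `|Lim f - S (F \o t)| <= e / 2.
  (* The ramps start strictly to the right of [t i], so that their values lie between F (t i) and F
     (t i + 2 ep m). Right continuity squeezes them to F (t i), also where F jumps. *)
  pose ep m : R := h / 2 / m.+1%:R.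
  have ep0 m : 0 < ep m by rewrite /ep divr_gt0 ?ltr0n// divr_gt0.
  have eph m : 2 * ep m <= h.
    have -> : 2 * ep m = h / m.+1%:R by rewrite /ep mulrA [2 * (h / 2)]mulrC divfK ?pnatr_eq0.
    by rewrite ler_pdivrMr ?ltr0n// ler_peMr ?(ltW h0)// ler1n.
  pose p m i := Phi (t i + ep m) (t i + 2 * ep m).
  have hp m : `|Lim f - S (p m)| <= w + C * (1 - (p m n - p m 0%N)).
    have hr i : t i + ep m < t i + 2 * ep m by have := ep0 m; lra.
    apply: (@step_functional R Ldom Lim Dl El Lim_le D1 E1 f t (fun i => ramp (t i + ep m) (t i + 2 * ep m)) n h) => //.
    - by move=> i x; exact: ramp01.
    - by move=> i x; apply: ramp_le => //; rewrite tS; have := ep0 m; have := eph m; lra.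
    - by move=> i x xt; apply: ramp_l => //; have := ep0 m; lra.
    - by move=> i x xt; apply: ramp_r => //; have := eph m; lra.
    - exact: ltW.
  have epc : ep @ \oo --> (0 : R).
    apply/cvgnP => e' e'0; have [m0 hm0] := @inv_small R (h / 2) e' e'0.
    exists m0 => m hm; have [_ hm'] := hm0 m.+1 (leqW hm).
    by rewrite subr0 ger0_norm// ltW.
  have pc i : (fun m => p m i) @ \oo --> F (t i).
    have hF : (fun m => F (t i + 2 * ep m)) @ \oo --> F (t i).
      have /cvgrPdist_le hrc := @Frc (t i).
      apply/cvgrPdist_le => e' e'0; have [d' /= d'0 hd'] := hrc _ e'0.
      have [m0 hm0] := (cvgnP _ _).1 epc (d' / 4) (divr_gt0 d'0 (ltr0Sn _ _)).
      exists m0 => // m /= /hm0; rewrite subr0 ger0_norm ?(ltW (ep0 m))// => hm.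
      apply: hd'; last by rewrite ltrDl mulr_gt0.
      have e2 : 0 < 2 * ep m by exact: mulr_gt0.
      rewrite /= opprD addNKr normrN (gtr0_norm e2).
      apply: (@le_lt_trans _ _ (2 * (d' / 4))); first by rewrite ler_pM2l.
      by rewrite mulrA ltr_pdivrMr// [d' * 4]mulrC ltr_pM2r// ltr_nat.
    have hsq : \forall m \near \oo, F (t i) <= p m i <= F (t i + 2 * ep m).
      apply: nearW => m; have := ep0 m => epm.
      by apply/andP; split; [apply: F_le|apply: Phi_le_F] => //; lra.
    exact: (squeeze_cvgr hsq (cvg_cst _) hF).
  have cS : (fun m => S (p m)) @ \oo --> S (F \o t).
    apply: cvg_big => [|i _]; first exact: add_continuous.
    by apply: cvgM; [exact: cvg_cst|apply: cvgB; exact: pc].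
  have c1 : (fun m => `|Lim f - S (p m)|) @ \oo --> `|Lim f - S (F \o t)|.
    by apply: cvg_norm; apply: cvgB => //; exact: cvg_cst.
  have c2 : (fun m => w + C * (1 - (p m n - p m 0%N))) @ \oo --> w + C * (1 - (F (t n) - F (t 0%N))).
    apply: cvgD; first exact: cvg_cst.
    apply: cvgM; first exact: cvg_cst.
    by apply: cvgB; [exact: cvg_cst|apply: cvgB; exact: pc].
  apply: le_trans (bound (F \o t) _ _); rewrite /= ?tn ?t0//.
  move: c2; rewrite tn t0 => c2.
  rewrite -(cvg_lim _ c1)// -(cvg_lim _ c2)//.
  apply: ler_lim; [by apply/cvg_ex; eexists; exact: c1|by apply/cvg_ex; eexists; exact: c2|].
  exact: nearW.
have hmu : `|(\int[mu]_x f x)%R - S (F \o t)| <= e / 2.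
  pose D (g : R -> R) := mu.-integrable setT (EFin \o g).
  have Dlin a g1 g2 : D g1 -> D g2 -> D (fun x => a * g1 x + g2 x).
    by move=> h1 h2'; apply: integrable_add => //; exact: integrable_scale.
  have Elin a g1 g2 : D g1 -> D g2 -> (\int[mu]_x (a * g1 x + g2 x))%R = a * (\int[mu]_x g1 x)%R + (\int[mu]_x g2 x)%R.
    by move=> h1 h2'; rewrite RintegralD// ?RintegralZl//; exact: integrable_scale.
  have Dfm : D f.
    apply: (@bounded_integrable _ _ _ mu f C) => //; exact: continuous_measurable_fun.
  have mt i : measurable `]-oo, t i] by exact: measurable_itv.
  (* For mu the half-line indicators are integrable and serve as steps themselves, with integrals
     exactly F (t i). *)
  pose I i := \1_(`]-oo, t i]) : R -> R.
  have EI i : (\int[mu]_x I i x)%R = F (t i) by rewrite Rintegral_indicT// muF.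
  have := @step_functional R D (fun g => (\int[mu]_x g x)%R) Dlin Elin _ _ _ f t I n h w C.
  rewrite (eq_bigr (fun i : 'I_n => f (t i) * (F (t i.+1) - F (t i)))); last by move=> i _; rewrite !EI.
  rewrite !EI => hh; apply: le_trans (bound (F \o t) _ _); rewrite /= ?tn ?t0//.
  rewrite -t0 -[in F K]tn; apply: hh => //.
  - by move=> g1 g2 h1 h2' h12; apply: le_Rintegral => // x _; exact: h12.
  - by apply: (@bounded_integrable _ _ _ mu (fun=> 1) 1) => // x; rewrite normr1.
  - exact: Rintegral_cstT.
  - by move=> i x; rewrite /I indicE ler0n lern1 leq_b1.
  - move=> i x; rewrite /I !indicE ler_nat; case: (boolP (x \in `]-oo, t i]%classic)) => //.
    rewrite inE /= in_itv /= => xt; rewrite mem_set//= in_itv/= tS.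
    by rewrite (le_trans xt)// lerDl ltW.
  - by move=> i x xt; rewrite /I indicE mem_set//= in_itv.
  - move=> i x xt; rewrite /I indicE memNset//= in_itv/=; apply/negP; rewrite -ltNge.
    by apply: lt_le_trans xt; rewrite ltrDl.
  - exact: ltW.
  - by move=> i; exact: indic_integrable.
have -> : (\int[mu]_x f x)%R - Lim f = ((\int[mu]_x f x)%R - S (F \o t)) - (Lim f - S (F \o t)) by ring.
by rewrite (le_trans (ler_normB _ _))//; lra.
Qed.

End MomentMeasure.

(** * Sandwiched integrals and truncation *)

Section IntegralTools.
Context d (T : measurableType d) (R : realType) (P : probability T R).

Lemma close_integrable (f g h : T -> R) : measurable_fun setT f ->
  P.-integrable setT (EFin \o g) -> P.-integrable setT (EFin \o h) ->
  (forall x, `|f x - g x| <= h x) ->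
  P.-integrable setT (EFin \o f) /\ `|(\int[P]_x f x)%R - (\int[P]_x g x)%R| <= (\int[P]_x h x)%R.
Proof.
move=> mf ig ih fgh.
have h0 x : 0 <= h x := le_trans (normr_ge0 _) (fgh x).
have iB : P.-integrable setT (EFin \o (fun x => `|g x| + h x)).
  have := integrableD measurableT (integrable_norm ig) ih.
  by apply: eq_integrable => // x _ /=; rewrite EFinD.
have if_ : P.-integrable setT (EFin \o f).
  apply: le_integrable iB => //; first exact/measurable_EFinP.
  move=> x _ /=; rewrite lee_fin [leRHS]ger0_norm ?addr_ge0//.
  by rewrite -[f x](subrK (g x)) addrC (le_trans (ler_normD _ _))// lerD2l.
split=> //; rewrite -RintegralB//.
have iD : P.-integrable setT (EFin \o (fun x => f x - g x)).
  have := integrableB measurableT if_ ig.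
  by apply: eq_integrable => // x _ /=; rewrite EFinB.
rewrite (le_trans (le_normr_Rintegral _ iD))//.
apply: le_Rintegral => //.
by have := integrable_norm iD; apply: eq_integrable.
Qed.

(** Monotone convergence along min(h, n). The truncations are bounded, so their integrals can be
    identified with the limit functional. *)
Lemma truncated_integral_le (h : T -> R) (K : R) : measurable_fun setT h ->
  (forall x, 0 <= h x) -> (forall n : nat, (\int[P]_x Num.min (h x) n%:R)%R <= K) ->
  (\int[P]_x (h x)%:E <= K%:E)%E.
Proof.
move=> mh h0 hK; pose g n x := (Num.min (h x) n%:R)%:E.
have min0 n x : 0 <= Num.min (h x) n%:R by rewrite le_min h0/=.
have mg n : measurable_fun setT (g n).
  by apply/measurable_EFinP; apply: measurable_minr => //; exact: measurable_cst.
have lg x : limn (g^~ x) = (h x)%:E.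
  apply: cvg_lim => //; apply: cvg_near_cst.
  exists (Num.truncn (h x)).+1 => // n /= hn.
  rewrite /g; congr EFin; apply/min_idPl/ltW.
  by rewrite (lt_le_trans (truncnS_gt _))// ler_nat.
have := @cvg_monotone_convergence _ _ _ P setT measurableT g mg.
have g0 n x : setT x -> (0 <= g n x)%E by move=> _; rewrite lee_fin.
have gm x : setT x -> {homo g^~ x : n m / (n <= m)%N >-> (n <= m)%E}.
  by move=> _ n m nm; rewrite lee_fin le_min !ge_min lexx/= ler_nat nm orbT.
move=> /(_ g0 gm).
under [X in _ --> X]eq_integral do rewrite lg.
move=> hc; rewrite -(cvg_lim _ hc)//; apply: lime_le; first by apply/cvg_ex; eexists; exact: hc.
apply: nearW => n.
have ig : P.-integrable setT (EFin \o (fun x => Num.min (h x) n%:R)).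
  apply: (@bounded_integrable _ _ _ P _ n%:R); first by apply/measurable_EFinP; exact: (mg n).
  by move=> x; rewrite ger0_norm// ge_min lexx orbT.
have := hK n; rewrite -lee_fin fineK//.
exact: integrable_fin_num.
Qed.

Lemma pow_le_even (x : R) k : `|x ^+ k| <= 1 + x ^+ (2 * k).
Proof.
rewrite mulnC exprM -(real_normK (num_real (x ^+ k))).
by have := sqr_ge0 (`|x ^+ k| - 1); have := normr_ge0 (x ^+ k); rewrite sqrrB expr1n mulr1; lra.
Qed.

End IntegralTools.

(** * Determinacy by the moments *)

Section HasMoments.
Variables (R : realType) (M : nat -> R).

Definition has_moments (mu : probability R R) := forall k,
  mu.-integrable setT (fun x => (x ^+ k)%:E) /\ (\int[mu]_x (x ^+ k)%:E = (M k)%:E)%E.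

Lemma has_moments_poly mu (q : {poly R}) : has_moments mu ->
  mu.-integrable setT (EFin \o horner q) /\ (\int[mu]_x q.[x])%R = mfun M q.
Proof.
move=> h; have ix k := integrable_scale q`_k (h k).1.
have [|i e] := @Rintegral_bigsum _ _ _ mu _ (index_enum 'I_(size q)) xpredT (fun k x => q`_k * x ^+ k).
  by move=> k _ _; exact: ix.
have qE : horner q = fun x => \sum_(k < size q) q`_k * x ^+ k by apply/funext => x; rewrite horner_coef.
rewrite qE; split=> //; rewrite e; apply: eq_bigr => k _.
by rewrite RintegralZl ?(h k).1// /Rintegral (h k).2.
Qed.

Variable B : R.
Hypothesis B1 : 1 <= B.
Hypothesis hM : forall k, M (2 * k)%N <= B ^+ k * k`!%:R.

(** The class fed to [dense_bounded] consists of the functions integrable for both measures with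
    equal integrals; a majorant q costs at most M(q) for each of them. *)
Lemma same_moments_bounded (mu nu : probability R R) f C : has_moments mu -> has_moments nu ->
  continuous f -> (forall x, `|f x| <= C) -> (\int[mu]_x f x)%R = (\int[nu]_x f x)%R.
Proof.
move=> hmu hnu cf fC.
pose G (f : R -> R) := [/\ mu.-integrable setT (EFin \o f), nu.-integrable setT (EFin \o f) &
  (\int[mu]_x f x)%R = (\int[nu]_x f x)%R].
suff [] : G f by [].
apply: (@dense_bounded R M B B1 hM G _ _ _ f cf C fC).
- move=> q; have [i1 e1] := has_moments_poly q hmu; have [i2 e2] := has_moments_poly q hnu.
  by split => //; rewrite e1 e2.
- move=> a g1 g2 [i1 j1 e1] [i2 j2 e2].
  have j1' := integrable_scale a j1; have i1' := integrable_scale a i1.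
  split; [exact: integrable_add|exact: integrable_add|].
  by rewrite !RintegralD// !RintegralZl// e1 e2.
- move=> g cg hg; have mg := continuous_measurable_fun cg.
  have h1 e : 0 < e -> [/\ mu.-integrable setT (EFin \o g), nu.-integrable setT (EFin \o g) &
      `|(\int[mu]_x g x)%R - (\int[nu]_x g x)%R| <= e + e].
    move=> e0; have [g' [q [[i1 i2 e12] gq qe]]] := hg e e0.
    have [iq1 eq1] := has_moments_poly q hmu; have [iq2 eq2] := has_moments_poly q hnu.
    have [k1 d1] := close_integrable mg i1 iq1 gq.
    have [k2 d2] := close_integrable mg i2 iq2 gq.
    split => //; move: d1 d2; rewrite eq1 eq2 e12 !ler_norml => /andP[? ?] /andP[? ?].
    by apply/andP; split; lra.
  have [i1 i2 _] := h1 1 ltr01; split => //.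
  apply/eqP; rewrite -subr_eq0 -normr_eq0 eq_le normr_ge0 andbT.
  apply/ler_addgt0Pl => e e0; have [_ _] := h1 (e / 2) (divr_gt0 e0 (ltr0Sn _ _)).
  by rewrite -splitr addr0.
Qed.

End HasMoments.

Section HalfLines.
Variable R : realType.

Lemma half_line_ramp (mu : probability R R) t :
  (\int[mu]_x (ramp t (t + n.+1%:R^-1) x)%:E)%E @[n --> \oo] --> mu `]-oo, t]%classic.
Proof.
have mt : measurable (`]-oo, t]%classic : set R) by exact: measurable_itv.
have -> : mu `]-oo, t]%classic = (\int[mu]_x (\1_(`]-oo, t]%classic) x)%:E)%E.
  by rewrite integral_indic// setIT.
apply: (@dominated_cvg _ _ _ mu setT measurableT (fun n x => (ramp t (t + n.+1%:R^-1) x)%:E) _ (fun=> 1%:E)) => //.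
- by move=> n; apply/measurable_EFinP; apply: continuous_measurable_fun; exact: ramp_continuous.
- move=> x _; apply: cvg_EFin; first exact: nearW.
  have tn n : t < t + n.+1%:R^-1 :> R by rewrite ltrDl invr_gt0 ltr0n.
  apply: cvg_near_cst; rewrite indicE; have [xt|tx] := leP x t.
    have -> : x \in (`]-oo, t]%classic : set R) by rewrite inE /= in_itv.
    by apply: nearW => n /=; rewrite ramp_l.
  have [n0 hn0] := @inv_small R 1 (x - t) ltac:(by rewrite subr_gt0).
  have -> : (x \in (`]-oo, t]%classic : set R)) = false.
    by apply: memNset; rewrite /= in_itv/= => /(lt_le_trans tx); rewrite ltxx.
  exists n0 => // n /= hn; rewrite ramp_r//.
  by have [_] := hn0 n.+1 (leqW hn); rewrite mul1r lerBrDl.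
- have := @bounded_integrable _ _ _ mu (fun=> 1) 1; apply => // x; by rewrite normr1.
- by move=> n x _; rewrite lee_fin ramp_bound.
Qed.

(** Ramps give equality on half-lines, hence on half-open intervals, which form a generating class
    stable under intersection. *)
Lemma eq_measure_bounded (mu nu : probability R R) :
  (forall f C, continuous f -> (forall x, `|f x| <= C) -> (\int[mu]_x f x)%R = (\int[nu]_x f x)%R) ->
  forall A, measurable A -> nu A = mu A.
Proof.
move=> h.
have hh t : nu `]-oo, t]%classic = mu `]-oo, t]%classic.
  apply: (cvg_unique _ (@half_line_ramp nu t)) => //.
  apply: cvg_trans (@half_line_ramp mu t); apply: near_eq_cvg; apply: nearW => n /=.
  have hf (m : probability R R) : (\int[m]_x (ramp t (t + n.+1%:R^-1) x)%:E)%E =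
     ((\int[m]_x ramp t (t + n.+1%:R^-1) x)%R)%:E.
    rewrite fineK//; apply: integrable_fin_num => //.
    apply: (@bounded_integrable _ _ _ m _ 1); last exact: ramp_bound.
    by apply: continuous_measurable_fun; exact: ramp_continuous.
  by rewrite !hf (h _ 1)//; [exact: ramp_continuous|exact: ramp_bound].
apply: (@measure_unique _ R R (@ocitv R) (fun n => `]- n%:R, n%:R]%classic)) => //.
- by move=> A B; exact: ocitvI.
- by move=> i; exact: is_ocitv.
- exact: (bigcup_itvT false false).
- move=> _ [[a b] _ <-] /=.
  have [ab|ba] := leP a b; last by rewrite set_itv_ge ?measure0// bnd_simp -leNgt ltW.
  have -> : `]a, b]%classic = `]-oo, b]%classic `\` `]-oo, a]%classic.
    by rewrite -[RHS]setCK setCD setCitvl setUC -[LHS]setCK setCitv.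
  have hI : `]-oo, b]%classic `&` `]-oo, a]%classic = `]-oo, a]%classic :> set R.
    by apply: setIidr; exact: subset_itvl.
  have fin (m : probability R R) (A : set R) : measurable A -> (m A < +oo)%E.
    by move=> mA; rewrite (le_lt_trans (probability_le1 _ _))// ltry.
  by rewrite !measureD//= ?fin// hI !hh.
- by move=> n; rewrite (le_lt_trans (probability_le1 _ _))// ltry.
Qed.

End HalfLines.

(** * The limit measure has the limit moments *)

Section LimitMoments.
Variables (R : realType) (M : nat -> R) (B : R).
Hypothesis B1 : 1 <= B.
Hypothesis hM : forall k, M (2 * k)%N <= B ^+ k * k`!%:R.
Hypothesis M0 : M 0%N = 1.
Variable LN : nat -> (R -> R) -> R.
Hypothesis LNlin : forall N a f g, LN N (fun x => a * f x + g x) = a * LN N f + LN N g.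
Hypothesis LNpos : forall N f, (forall x, 0 <= f x) -> 0 <= LN N f.
Hypothesis LNmom : forall k, (LN ^~ (fun x => x ^+ k)) @ \oo --> M k.

Let L := Lim LN.
Let D := Ldom LN.

Let Dpoly q : D (horner q).
Proof. by exists (mfun M q); exact: (Lim_poly LNlin LNmom). Qed.

Let Lpoly q : L (horner q) = mfun M q.
Proof. exact: Lim_eq (@Lim_poly _ _ _ LNlin LNmom q). Qed.

Let Dpow k : D (fun x => x ^+ k).
Proof.
by rewrite (_ : (fun x => x ^+ k) = horner 'X^k)//; apply/funext => x; rewrite hornerXn.
Qed.

Let Lpow k : L (fun x => x ^+ k) = M k.
Proof.
rewrite (_ : (fun x => x ^+ k) = horner 'X^k); first by rewrite Lpoly mfunXn.
by apply/funext => x; rewrite hornerXn.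
Qed.

Let cpow k : continuous (fun x : R => x ^+ k).
Proof. exact: exprn_continuous. Qed.

Let mpow k : measurable_fun setT (fun x : R => x ^+ k).
Proof. by apply: continuous_measurable_fun; exact: cpow. Qed.

Let clamp (n : nat) (x : R) := Num.max (- n%:R) (Num.min x n%:R).

Let clamp_bound n x : `|clamp n x| <= n%:R.
Proof. by rewrite /clamp ler_norml le_max lexx/= ge_max ge_min lexx orbT andbT ge0_cp. Qed.

(** Where the truncation acts, |y| > n + 1, and so |y| <= y^2 / (n + 1). *)
Let clamp_close n y : `|y - clamp n.+1 y| <= n.+1%:R^-1 * y ^+ 2.
Proof.
have n0 : 0 < n.+1%:R :> R by rewrite ltr0n.
have h : forall z : R, n.+1%:R <= z -> z <= n.+1%:R^-1 * z ^+ 2.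
  by move=> z hz; rewrite ler_pdivlMl// expr2 ler_wpM2r// (le_trans (ltW n0)).
have p0 : 0 <= n.+1%:R^-1 * y ^+ 2 by rewrite mulr_ge0 ?sqr_ge0// invr_ge0 ltW.
rewrite /clamp; have [yn|ny] := leP y n.+1%:R; last first.
  have -> : Num.max (- n.+1%:R) n.+1%:R = n.+1%:R :> R by apply/max_idPr; lra.
  rewrite ger0_norm ?subr_ge0 ?(ltW ny)//.
  by apply: le_trans (h y (ltW ny)); rewrite gerBl ltW.
have [yn'|ny'] := leP (- n.+1%:R) y; first by rewrite subrr normr0.
have yn' : n.+1%:R <= - y by rewrite lerNr ltW.
have := h _ yn'; rewrite sqrrN; apply: le_trans.
rewrite opprK ler0_norm; first by rewrite opprD gerDl oppr_le0 ltW.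
by rewrite -lerBrDr sub0r ltW.
Qed.

(** The measure is known only through bounded functions. Truncation first shows that the even
    moments are finite; then x^k is replaced by its clamp, at the price of x^(2k) / (n + 1) both for
    mu and for the functional. *)
Lemma limit_moments : exists mu : probability R R, has_moments M mu.
Proof.
have [mu hmu] := limit_cdf_measure B1 hM M0 LNlin LNpos LNmom; exists mu.
have even k : (\int[mu]_x (x ^+ (2 * k))%:E <= (M (2 * k)%N)%:E)%E.
  have p0 (x : R) : 0 <= x ^+ (2 * k) by rewrite exprM exprn_ge0// sqr_ge0.
  apply: truncated_integral_le => //.
  move=> n.
  have cm : continuous (fun x : R => Num.min (x ^+ (2 * k)) n%:R).
    by move=> x; apply: (@continuous_min R R (fun x => x ^+ (2 * k)) (fun=> n%:R) x); [exact: cpow|exact: cvg_cst].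
  have bm (x : R) : `|Num.min (x ^+ (2 * k)) n%:R| <= n%:R.
    have h0 : 0 <= Num.min (x ^+ (2 * k)) n%:R by rewrite le_min p0 ler0n.
    by rewrite (ger0_norm h0) ge_min lexx orbT.
  rewrite (hmu _ n%:R cm bm) -Lpow; apply: (Lim_le LNlin LNpos (Ldom_bounded B1 hM LNlin LNpos LNmom cm bm) (@Dpow (2 * k))).
  by move=> x; rewrite ge_min lexx.
have ieven k : mu.-integrable setT (fun x => (x ^+ (2 * k))%:E).
  have p0 (x : R) : 0 <= x ^+ (2 * k) by rewrite exprM exprn_ge0// sqr_ge0.
  apply/integrableP; split; first by apply/measurable_EFinP; exact: mpow.
  rewrite (eq_integral (fun x : R => (x ^+ (2 * k))%:E)); first exact: le_lt_trans (even k) (ltry _).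
  by move=> x _ /=; rewrite ger0_norm.
have i1 : mu.-integrable setT (EFin \o (fun=> 1)).
  by apply: (@bounded_integrable _ _ _ mu (fun=> 1) 1) => // x; rewrite normr1.
have ik k : mu.-integrable setT (fun x => (x ^+ k)%:E).
  apply: le_integrable (integrableD measurableT i1 (ieven k)) => //.
    by apply/measurable_EFinP; exact: mpow.
  move=> x _ /=; rewrite lee_fin [leRHS]ger0_norm; first exact: pow_le_even.
  by rewrite addr_ge0// exprM exprn_ge0// sqr_ge0.
move=> k; split=> //.
have -> : (\int[mu]_x (x ^+ k)%:E)%E = ((\int[mu]_x (x ^+ k))%R)%:E.
  by rewrite fineK//; exact: integrable_fin_num.
congr EFin; apply/eqP; rewrite -subr_eq0 -normr_eq0 eq_le normr_ge0 andbT.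
apply/ler_addgt0Pl => e e0; rewrite addr0.
(* The factor 2 pays for the two replacements of x^k by its clamp. *)
have [n /(_ n (leqnn _))[n0 hn]] := @inv_small R (2 * M (2 * k)%N) e e0.
case: n n0 hn => // n _ hn.
pose g x := clamp n.+1 (x ^+ k); pose q := n.+1%:R^-1 *: 'X^(2 * k) : {poly R}.
have gq x : `|x ^+ k - g x| <= q.[x].
  by rewrite /q hornerZ hornerXn mulnC exprM; exact: clamp_close.
have cg : continuous g.
  move=> x; apply: (@continuous_max R R (fun=> - n.+1%:R) (fun x => Num.min (x ^+ k) n.+1%:R) x); first exact: cvg_cst.
  by apply: (@continuous_min R R (fun x => x ^+ k) (fun=> n.+1%:R) x); [exact: cpow|exact: cvg_cst].
have gC x : `|g x| <= n.+1%:R by exact: clamp_bound.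
have ig : mu.-integrable setT (EFin \o g).
  by apply: (@bounded_integrable _ _ _ mu g n.+1%:R) => //; exact: (continuous_measurable_fun cg).
have iq : mu.-integrable setT (EFin \o horner q).
  have := integrableZl measurableT n.+1%:R^-1 (ieven k).
  by apply: eq_integrable => // x _ /=; rewrite /q hornerZ hornerXn EFinM.
have mk : measurable_fun setT (fun x : R => x ^+ k) by exact: mpow.
have [_ h1] := close_integrable mk ig iq gq.
have dg : D g by exact: (Ldom_bounded B1 hM LNlin LNpos LNmom cg gC).
have D1 : D (fun=> 1) by have := Dpow 0.
have L1 : L (fun=> 1) = 1 by have := Lpow 0; rewrite M0.
have h2 : `|L (fun x => x ^+ k) - L g| <= L (horner q).
  apply: (@functional_dist R D L) => //.
  - by move=> a f1 f2 d1 d2; have [] := Ldom_lin LNlin a d1 d2.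
  - by move=> a f1 f2 d1 d2; have [] := Ldom_lin LNlin a d1 d2.
  - by move=> f1 f2 d1 d2; exact: Lim_le.
have iqM : (\int[mu]_x q.[x])%R <= n.+1%:R^-1 * M (2 * k)%N.
  have -> : (\int[mu]_x q.[x])%R = (\int[mu]_x (n.+1%:R^-1 * x ^+ (2 * k)))%R.
    by apply: eq_Rintegral => x _; rewrite /q hornerZ hornerXn.
  rewrite (@RintegralZl _ _ _ mu setT (fun x : R => x ^+ (2 * k)) _ measurableT (ieven k)) ler_wpM2l ?invr_ge0//.
  by rewrite -lee_fin fineK//; exact: integrable_fin_num.
move: h1 h2; rewrite (hmu g _ cg gC) Lpow Lpoly /q mfunZ mfunXn => h1 h2.
have hn' : n.+1%:R^-1 * M (2 * k)%N + n.+1%:R^-1 * M (2 * k)%N <= e.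
  by apply: le_trans hn; rewrite -mulrDr mulrC -mulr2n -[M _ *+ 2]mulr_natl.
rewrite (_ : _ - M k = ((\int[mu]_x (x ^+ k))%R - L g) - (M k - L g)); last by ring.
by rewrite (le_trans (ler_normB _ _))// (le_trans (lerD (le_trans h1 iqM) h2)).
Qed.

End LimitMoments.

(** * Unboundedness of the support *)

Section Support.
Variables (R : realType) (M : nat -> R) (mu : probability R R).
Hypothesis hmu : has_moments M mu.
Hypothesis hM : forall m, m`!%:R / 2 ^+ m <= M (2 * m)%N.

(** The terms of the exponential series tend to 0. *)
Lemma fact_super (r : R) : exists m : nat, r ^+ m < m`!%:R.
Proof.
have /cvg_series_cvg_0 /cvgrPdist_lt/(_ 1 ltr01)[n _ hn] := is_cvg_series_exp_coeff r.
exists n; have := hn n (leqnn n); rewrite sub0r normrN /exp_coeff/= => h.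
have f0 : 0 < n`!%:R :> R by rewrite ltr0n fact_gt0.
by move: (le_lt_trans (ler_norm _) h); rewrite ltr_pdivrMr// mul1r.
Qed.

(** Each point of U has a null ball, hence lies in a null interval with rational endpoints, and
    there are countably many of these. *)
Lemma unsupported_null (U : set R) : open U -> (forall x, U x -> ~ msupport mu x) -> mu.-negligible U.
Proof.
move=> oU hU.
pose I (n : nat) : set R :=
  if (unpickle n : option (rat * rat)) is Some (p, q) then
    (if mu `]ratr p, ratr q[%classic == 0%E then `]ratr p, ratr q[%classic else set0) else set0.
have I0 n : mu.-negligible (I n).
  rewrite /I; case: unpickle => [[p q]|]; last exact: negligible_set0.
  case: eqP => [h|_]; last exact: negligible_set0.
  by apply/negligibleP => //; exact: measurable_itv.
apply: (@negligibleS _ _ _ mu (\bigcup_n I n)); last exact: negligible_bigcup.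
move=> x Ux.
have [e e0 he] : exists2 e, 0 < e & mu (ball x e) = 0%E.
  apply: contrapT => h; apply: (hU x Ux) => e e0.
  by rewrite lt0e measure_ge0 andbT; apply/eqP => h'; apply: h; exists e.
have [p] := @rat_in_itvoo R (x - e) x ltac:(by rewrite ltrBlDr ltrDl).
have [q] := @rat_in_itvoo R x (x + e) ltac:(by rewrite ltrDl).
rewrite !in_itv/= => /andP[xq qe] /andP[ep px].
exists (pickle (p, q)); [exact: Logic.I|rewrite /I pickleK].
have -> : mu `]ratr p, ratr q[%classic = 0%E.
  have sub : `]ratr p, ratr q[%classic `<=` ball x e.
    move=> y; rewrite /= in_itv/= => /andP[py yq]; rewrite -ball_normE/= ltr_norml.
    by apply/andP; split; lra.
  apply/eqP; rewrite eq_le measure_ge0 andbT -[X in (_ <= X)%E]he.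
  apply: le_measure sub; rewrite inE; first exact: measurable_itv.
  exact: measurable_ball.
by rewrite eqxx /= in_itv/= px.
Qed.

Lemma unbounded_support r : exists x, msupport mu x /\ r < `|x|.
Proof.
apply: contrapT => hno.
pose r' := Num.max r 1; have r1 : 1 <= r' by rewrite le_max lexx orbT.
have neg : mu.-negligible [set x : R | r' < `|x|].
  apply: unsupported_null.
    rewrite (_ : [set x | r' < `|x|] = (fun x => `|x|) @^-1` [set y | r' < y])//.
    by apply: open_comp; [move=> x _; exact: norm_continuous|exact: open_gt].
  move=> x /= xr sx; apply: hno; exists x; split=> //.
  by apply: le_lt_trans xr; rewrite le_max lexx.
(* If mu lived on [-r', r'], the moment of order 2 m would be at most r'^(2m), which for this m is
   below m!/2^m. *)
have [m hm] := fact_super (2 * r' ^+ 2).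
have p0 (x : R) : 0 <= x ^+ (2 * m) by rewrite exprM exprn_ge0// sqr_ge0.
have : (\int[mu]_x (x ^+ (2 * m))%:E <= \int[mu]_x ((r' ^+ (2 * m))%:E))%E.
  apply: ae_ge0_le_integral => //.
  - by move=> x _; rewrite lee_fin.
  - by apply/measurable_EFinP; apply: continuous_measurable_fun; exact: exprn_continuous.
  - by move=> x _; rewrite lee_fin.
  apply: negligibleS neg => x /= h; rewrite ltNge; apply/negP => xr; apply: h => _.
  rewrite lee_fin !exprM; apply: lerXn2r; rewrite ?nnegrE ?sqr_ge0//.
  rewrite -(real_normK (num_real x)); apply: lerXn2r => //.
  by rewrite nnegrE (le_trans ler01).
have hc (c : R) : (\int[mu]_x c%:E = c%:E)%E.
  rewrite integral_cst//.
  exact: (etrans (congr1 (fun y => c%:E * y)%E (probability_setT mu)) (mule1 _)).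
rewrite (hmu _).2 hc lee_fin => h.
have := le_trans (hM m) h; rewrite ler_pdivrMr ?exprn_gt0// exprM mulrC -exprMn leNgt => /negP; apply.
exact: hm.
Qed.

End Support.

From mathcomp Require Import spectral complex.

Local Close Scope classical_set_scope.

(** * Eigenvalues and traces of symmetric matrices *)

Lemma char_poly_conj (F : fieldType) n (P D : 'M[F]_n) : P \in unitmx ->
  char_poly (invmx P *m D *m P) = char_poly D.
Proof.
move=> Pu; rewrite /char_poly /char_poly_mx !map_mxM.
have e : map_mx polyC (invmx P) *m map_mx polyC P = 1%:M.
  by rewrite -map_mxM mulVmx// map_mx1.
have -> : 'X%:M - map_mx polyC (invmx P) *m map_mx polyC D *m map_mx polyC P =
    map_mx polyC (invmx P) *m ('X%:M - map_mx polyC D) *m map_mx polyC P.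
  rewrite mulmxBr mulmxBl; congr (_ - _).
  by rewrite mul_mx_scalar -scalemxAl e scalemx1.
by rewrite !det_mulmx mulrAC -det_mulmx e det1 mul1r.
Qed.

Lemma expmx_conj (F : fieldType) n (P D : 'M[F]_n) k : P \in unitmx ->
  (invmx P *m D *m P) ^+ k = invmx P *m D ^+ k *m P.
Proof.
move=> Pu; elim: k => [|k IH]; first by rewrite !expr0 mulmx1 mulVmx.
rewrite !exprS IH -!mulmxE !mulmxA; congr (_ *m _ *m _).
by rewrite -!mulmxA mulmxV// mulmx1.
Qed.

Lemma expmx_diag (F : fieldType) n (d : 'rV[F]_n) k :
  diag_mx d ^+ k = diag_mx (map_mx (fun x => x ^+ k) d).
Proof.
elim: k => [|k IH].
  by rewrite expr0; apply/matrixP => i j; rewrite !mxE expr0.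
rewrite exprS IH -mulmxE mulmx_diag; congr diag_mx.
by apply/rowP => i; rewrite !mxE exprS.
Qed.

Section Spectrum.
Variable R : realType.

(** The complex matrix is Hermitian, so it is unitarily diagonalizable with real eigenvalues; both
    identities descend to R through the injective embedding. *)
Lemma sym_spectrum n (A : 'M[R]_n) : A^T = A ->
  exists lam : 'I_n -> R, is_spectrum A lam /\
    forall k, \tr (A ^+ k) = \sum_i lam i ^+ k.
Proof.
move=> As; pose f : {rmorphism R -> R[i]%C} := real_complex R; pose B := map_mx f A.
have Bh : B \is hermsymmx.
  apply/is_hermitianmxP; rewrite scale1r; apply/matrixP => i j; rewrite !mxE.
  by rewrite -[in RHS]As mxE; apply/esym/conj_Creal/complex_realP; exists (A i j).
have /orthomx_spectralP := hermitian_normalmx Bh.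
have Pu := spectral_unit B; set P := spectralmx B in Pu *; set D := spectral_diag B.
move=> BE; have Dr : D \is a realmx := hermitian_spectral_diag_real Bh.
pose lam i := complex.Re (D 0 i).
have lamE i : D 0 i = f (lam i).
  by rewrite /lam [f _]RRe_real//; exact: (mxOverP Dr).
exists lam; split.
  apply: (@map_poly_inj _ _ f); rewrite map_char_poly -/B BE char_poly_conj//.
  rewrite char_poly_trig ?diag_mx_is_trig// map_prod_XsubC.
  by apply: eq_bigr => i _; rewrite mxE eqxx lamE.
move=> k; apply: (@complexI R); change (f (\tr (A ^+ k)) = f (\sum_i lam i ^+ k)).
have -> : f (\tr (A ^+ k)) = \tr (B ^+ k).
  rewrite (_ : B ^+ k = map_mx f (A ^+ k)); first by rewrite /mxtrace rmorph_sum; apply: eq_bigr => i _; rewrite mxE.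
  elim: k => [|k IH]; first by rewrite !expr0 map_mx1.
  by rewrite !exprS -!mulmxE map_mxM IH.
rewrite BE expmx_conj// mxtrace_mulC mulmxA mulmxV// mul1mx expmx_diag mxtrace_diag.
by rewrite rmorph_sum; apply: eq_bigr => i _; rewrite mxE lamE rmorphXn.
Qed.

Lemma eigvals_spectrum n (A : 'M[R]_n) : A^T = A -> is_spectrum A (eigvals A).
Proof.
move=> /sym_spectrum[lam [h _]]; rewrite /eigvals.
case: pselect => [H|[]]; last by exists lam.
by case: boolp.constructive_indefinite_description.
Qed.

(** The list chosen by [eigvals] and the one of [sym_spectrum] have the same characteristic
    polynomial, hence agree up to permutation and have the same power sums. *)
Lemma eigvals_trace n (A : 'M[R]_n) k : A^T = A ->
  \tr (A ^+ k) = \sum_i eigvals A i ^+ k.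
Proof.
move=> As; have [lam [h ->]] := sym_spectrum As.
have h' := eigvals_spectrum As.
have : \prod_(x <- map lam (index_enum 'I_n)) ('X - x%:P) =
    \prod_(x <- map (eigvals A) (index_enum 'I_n)) ('X - x%:P).
  by rewrite !big_map -h -h'.
move=> /prod_XsubC_eq hp.
have := perm_big _ hp (R := R) (x := 0) (op := +%R) (P := xpredT) (F := fun x => x ^+ k).
by rewrite !big_map.
Qed.

Lemma toeplitz_sym N (b : nat -> R) : (toeplitz N b)^T = toeplitz N b.
Proof. by apply/matrixP => i j; rewrite !mxE eq_sym maxnC minnC. Qed.

Lemma empirical_poly N (b : nat -> R) (q : {poly R}) :
  empirical_integral (toeplitz N b) (horner q) =
  \sum_(k < size q) q`_k * moment_AN k (toeplitz N b).
Proof.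
rewrite /empirical_integral /moment_AN.
under [RHS]eq_bigr => k _ do rewrite eigvals_trace ?toeplitz_sym//.
rewrite mulr_sumr.
under [LHS]eq_bigr => i _ do rewrite horner_coef mulr_sumr.
rewrite exchange_big; apply: eq_bigr => k _.
rewrite !mulr_sumr; apply: eq_bigr => i _.
by rewrite exprMn exprVn mulrCA mulrAC !mulrA.
Qed.

End Spectrum.

(** * Random Toeplitz matrices *)

Section TraceWalks.
Variable R : realType.
Implicit Types b : nat -> R.

(** Encodes the convention b_0 = 0 whatever the value [b 0], as [toeplitz] does on the diagonal. *)
Definition offdiag b d : R := if d == 0%N then 0 else b d.

Definition wprod b (s : seq nat) : R := \prod_(d <- s) offdiag b d.

Lemma toeplitzE N b (i j : 'I_N) : toeplitz N b i j = offdiag b (lab i j).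
Proof.
rewrite mxE /offdiag /lab; case: eqVneq => [->|ij]; first by rewrite maxnn minnn subnn.
case: eqVneq => // h; exfalso; move/eqP: ij; apply; lia.
Qed.

Lemma toeplitz_exp N b k (x y : 'I_N) :
  (toeplitz N b ^+ k) x y = \sum_(p : k.-tuple 'I_N | last x p == y) wprod b (labels x p).
Proof.
elim: k x => [|k IH] x.
  rewrite expr0 mxE; rewrite (eq_bigl (fun p : 0.-tuple 'I_N => x == y)) => [|p]; last by rewrite tuple0.
  rewrite big_mkcond (big_pred1 [tuple]) => [|p]; last by rewrite (tuple0 p); exact/esym/eqP.
  by case: eqP => //= _; rewrite /wprod big_nil.
rewrite exprS -mulmxE mxE.
under eq_bigr do rewrite IH toeplitzE mulr_sumr.
rewrite pair_big_dep/=.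
rewrite (reindex_onto (fun p : k.+1.-tuple 'I_N => (thead p, [tuple of behead p]))
  (fun z => [tuple of z.1 :: z.2])) /=; last first.
  by move=> [z p] _ /=; congr pair; apply/val_inj.
apply: eq_big => [p|p _].
  have -> : [tuple of thead p :: behead p] == p by rewrite -val_eqE/= -[X in _ == X]/(tval p) [in X in _ == X](tuple_eta p).
  by rewrite andbT [in RHS](tuple_eta p).
by rewrite [in RHS](tuple_eta p) /= /wprod big_cons.
Qed.

Lemma trace_walks N b k :
  \tr (toeplitz N b ^+ k) = \sum_(w : walk N k | closed_walk w) wprod b (wl w).
Proof.
rewrite /mxtrace; under eq_bigr do rewrite toeplitz_exp.
by rewrite pair_big_dep; apply: eq_bigl => -[v p].
Qed.

Lemma wprod_cat b s t : wprod b (s ++ t) = wprod b s * wprod b t.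
Proof. by rewrite /wprod big_cat. Qed.

Lemma wprodE b s : wprod b s = if 0%N \in s then 0 else \prod_(d <- undup s) b d ^+ count_mem d s.
Proof.
case: ifPn => s0.
  rewrite /wprod (big_rem 0%N)//= /offdiag eqxx mul0r//.
rewrite /wprod (eq_big_seq b); last first.
  by move=> d ds; rewrite /offdiag; case: eqVneq ds s0 => [-> ->|].
by rewrite -big_undup_iterop_count.
Qed.

Lemma prod_undup_ord N (s : seq nat) (F : nat -> R) : all (fun d => d < N)%N s ->
  (forall d, d \notin s -> F d = 1) -> \prod_(d <- undup s) F d = \prod_(i < N) F i.
Proof.
move=> /allP sN F1; rewrite -(big_mkord xpredT F) [RHS](bigID (mem s))/= [X in _ = _ * X]big1 ?mulr1; last first.
  by move=> d /F1.
rewrite -[RHS]big_filter; apply: perm_big; apply: uniq_perm; [exact: undup_uniq|exact: (filter_uniq _ (iota_uniq _ _))|].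
move=> d; rewrite mem_undup mem_filter mem_index_iota.
by case: (boolP (d \in s)) => // /sN.
Qed.

Definition radb N (o : {ffun 'I_N -> bool}) (d : nat) : R :=
  if (insub d : option 'I_N) is Some i then (-1) ^+ o i else 0.

(** The moments of a fair random sign. *)
Definition radm (q : nat) : R := (~~ odd q)%:R.

(** Averaging over all sign vectors factors by distributivity over the coordinates, a finite form of
    independence. *)
Lemma rad_expect N (s : seq nat) : all (fun d => d < N)%N s ->
  (2 ^+ N)^-1 * \sum_(o : {ffun 'I_N -> bool}) wprod (radb o) s = ev radm s.
Proof.
move=> sN; rewrite /ev; under [X in _ * X = _]eq_bigr do rewrite wprodE.
case: ifP => s0; first by rewrite big1 ?mulr0.
have e1 (o : {ffun 'I_N -> bool}) : \prod_(d <- undup s) radb o d ^+ count_mem d s =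
    \prod_(i < N) ((-1) ^+ o i) ^+ count_mem (val i) s.
  rewrite (@prod_undup_ord N s (fun d => radb o d ^+ count_mem d s))//; last first.
    by move=> d /count_memPn->; rewrite expr0.
  by apply: eq_bigr => i _; rewrite /radb valK.
under [X in _ * X = _]eq_bigr do rewrite e1.
rewrite -(bigA_distr_bigA (fun (i : 'I_N) (c : bool) => ((-1) ^+ c) ^+ count_mem (val i) s : R)).
rewrite (@prod_undup_ord N s (fun d => radm (count_mem d s)))//; last first.
  by move=> d /count_memPn->.
have -> : (2 ^+ N)^-1 = \prod_(i < N) 2^-1 :> R by rewrite prodr_const card_ord exprVn.
rewrite -big_split/=; apply: eq_bigr => i _.
rewrite big_bool /= expr1 expr0 expr1n /radm -signr_odd.
by case: odd; rewrite /= ?expr1 ?expr0; lra.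
Qed.

Definition rad_functional N (f : R -> R) : R :=
  (2 ^+ N)^-1 * \sum_(o : {ffun 'I_N -> bool}) empirical_integral (toeplitz N (radb o)) f.

Lemma rad_lin N a f g : rad_functional N (fun x => a * f x + g x) =
  a * rad_functional N f + rad_functional N g.
Proof.
rewrite /rad_functional mulrCA -mulrDr [a * _]mulr_sumr -big_split/=; congr (_ * _).
apply: eq_bigr => o _; by rewrite /empirical_integral mulrCA -mulrDr [a * _]mulr_sumr -big_split.
Qed.

Lemma rad_pos N f : (forall x, 0 <= f x) -> 0 <= rad_functional N f.
Proof.
move=> f0; rewrite /rad_functional mulr_ge0 ?invr_ge0 ?exprn_ge0// sumr_ge0// => o _.
by rewrite /empirical_integral mulr_ge0 ?invr_ge0// sumr_ge0.
Qed.

Lemma empirical_pow N b k :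
  empirical_integral (toeplitz N b) (fun x => x ^+ k) = moment_AN k (toeplitz N b).
Proof.
rewrite /empirical_integral /moment_AN eigvals_trace ?toeplitz_sym// -mulrA; congr (_ * _).
by rewrite mulr_sumr; apply: eq_bigr => i _; rewrite exprMn exprVn mulrC.
Qed.

Lemma rad_moment N k :
  rad_functional N (fun x => x ^+ k) = N%:R^-1 * (Num.sqrt N%:R) ^- k * tsum radm k N.
Proof.
rewrite /rad_functional; under eq_bigr do rewrite empirical_pow /moment_AN trace_walks.
rewrite -mulr_sumr mulrCA; congr (_ * _).
rewrite exchange_big mulr_sumr; apply: eq_bigr => w _.
by rewrite rad_expect// wl_lt.
Qed.

Local Open Scope classical_set_scope.

Lemma rad_moment_cvg k : (rad_functional ^~ (fun x => x ^+ k)) @ \oo --> tmom R k.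
Proof.
have := @tsum_cvg R radm k (erefl _) (erefl _); apply: cvg_trans; apply: near_eq_cvg.
by apply: nearW => N; rewrite rad_moment.
Qed.

End TraceWalks.

Local Open Scope classical_set_scope.
Local Open Scope ring_scope.

(** * Independence and laws given by a density *)

Section WeightedLaw.
Variable R : realType.
Import HBNNSimple.
Local Open Scope ereal_scope.

Section OneSpace.
Context d (T : measurableType d) (mu : {measure set T -> \bar R}).
Variables (X : T -> R) (W : T -> R).
Hypothesis mX : measurable_fun setT X.
Hypothesis mW : measurable_fun setT W.
Hypothesis W0 : forall x, (0 <= W x)%R.

Lemma weighted_nnsfun (g : {nnsfun R >-> R}) :
  \int[mu]_x ((g (X x))%:E * (W x)%:E) =
  \sum_(r \in range g) (r%:E * \int[mu]_x ((\1_(g @^-1` [set r]) (X x))%:E * (W x)%:E)).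
Proof.
have mi r : measurable_fun setT (fun x => (\1_(g @^-1` [set r]) (X x))%:E * (W x)%:E).
  apply: emeasurable_funM; apply/measurable_EFinP => //.
  by apply: measurableT_comp => //; exact: measurable_indic.
have i0 r x : 0 <= (\1_(g @^-1` [set r]) (X x))%:E * (W x)%:E by rewrite mule_ge0// lee_fin.
transitivity (\int[mu]_x \sum_(r \in range g) (r%:E * ((\1_(g @^-1` [set r]) (X x))%:E * (W x)%:E))).
  apply: eq_integral => x _.
  rewrite {1}fimfunE -fsumEFin//.
  rewrite ge0_mule_fsuml => [|y]; last exact: nnfun_muleindic_ge0.
  by apply: eq_fsbigr => r _; rewrite EFinM muleA.
have gr0 r x : 0 <= r%:E * ((\1_(g @^-1` [set r]) (X x))%:E * (W x)%:E).
  rewrite muleA; apply: mule_ge0; last by rewrite lee_fin.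
  rewrite -EFinM; exact: nnfun_muleindic_ge0.
rewrite ge0_integral_fsum//; last by move=> r; apply: measurable_funeM.
apply: eq_fsbigr => r /[!inE] -[t _ <-].
by rewrite ge0_integralZl// lee_fin.
Qed.

Lemma weighted_cvg (h : R -> R) (mh : measurable_fun setT (EFin \o h)) : (forall x, (0 <= h x)%R) ->
  \int[mu]_x ((nnsfun_approx measurableT mh n (X x))%:E * (W x)%:E) @[n --> \oo] -->
  \int[mu]_x ((h (X x))%:E * (W x)%:E).
Proof.
move=> h0.
have := @cvg_monotone_convergence _ _ _ mu _ measurableT
  (fun n x => (nnsfun_approx measurableT mh n (X x))%:E * (W x)%:E).
have -> : (fun x => limn (fun n => (nnsfun_approx measurableT mh n (X x))%:E * (W x)%:E)) =
   (fun x => (h (X x))%:E * (W x)%:E).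
  apply/funext => x; apply/cvg_lim => //.
  have ch := @cvg_nnsfun_approx _ _ _ _ measurableT _ mh (fun x _ => h0 x) (X x) Logic.I.
  exact: cvgeZr ch.
apply => //.
- move=> n; apply: emeasurable_funM; apply/measurable_EFinP => //.
  by apply: measurableT_comp.
- by move=> n x _; rewrite mule_ge0// lee_fin.
- move=> x _ m n mn; apply: lee_wpmul2r; rewrite lee_fin//; exact/lefP/nd_nnsfun_approx.
Qed.
End OneSpace.

(** The integrals depend only on the image under X of the measure with density W. Agreement on
    indicators passes to simple functions and, by monotone convergence, to nonnegative h. It serves
    both for independence, with W a product of other factors, and for the law of an entry, with W
    the density. *)
Lemma weighted_transfer d1 (T1 : measurableType d1) (mu1 : {measure set T1 -> \bar R})
    d2 (T2 : measurableType d2) (mu2 : {measure set T2 -> \bar R})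
    (X1 : T1 -> R) (W1 : T1 -> R) (X2 : T2 -> R) (W2 : T2 -> R) :
  measurable_fun setT X1 -> measurable_fun setT W1 -> (forall x, (0 <= W1 x)%R) ->
  measurable_fun setT X2 -> measurable_fun setT W2 -> (forall x, (0 <= W2 x)%R) ->
  (forall B : set R, measurable B ->
     \int[mu1]_x ((\1_B (X1 x))%:E * (W1 x)%:E) = \int[mu2]_x ((\1_B (X2 x))%:E * (W2 x)%:E)) ->
  forall h : R -> R, measurable_fun setT h -> (forall x, (0 <= h x)%R) ->
  \int[mu1]_x ((h (X1 x))%:E * (W1 x)%:E) = \int[mu2]_x ((h (X2 x))%:E * (W2 x)%:E).
Proof.
move=> mX1 mW1 W10 mX2 mW2 W20 eqB h mh h0.
have mh' : measurable_fun setT (EFin \o h) by exact/measurable_EFinP.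
have c1 := @weighted_cvg _ _ mu1 _ _ mX1 mW1 W10 h mh' h0.
have c2 := @weighted_cvg _ _ mu2 _ _ mX2 mW2 W20 h mh' h0.
rewrite -(cvg_lim (@ereal_hausdorff R) c1) -(cvg_lim (@ereal_hausdorff R) c2).
apply: congr_lim; apply/funext => n.
rewrite !weighted_nnsfun//; apply: eq_fsbigr => r _; congr (_ * _).
exact: eqB.
Qed.

End WeightedLaw.

Section Independence.
Context d (T : measurableType d) (R : realType) (P : probability T R).
Variables (I : set nat) (X : nat -> T -> R).
Hypothesis mX : forall j, measurable_fun setT (X j).
Hypothesis iX : mutually_independent P I X.

Lemma measurable_prod_comp (h : nat -> R -> R) (s : seq nat) :
  (forall j, measurable_fun setT (h j)) ->
  measurable_fun setT (fun x => \prod_(j <- s) h j (X j x)).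
Proof. by move=> mh; apply: measurable_prod => j _; exact: measurableT_comp. Qed.

(** Independence is given for events only. The product mixes functions (s) and indicators (t) so
    that an induction can turn the indicators into functions one index at a time. *)
Lemma independent_prod_ge0 (s t : seq nat) (h : nat -> R -> R) (B : nat -> set R) (m : nat -> R) :
  uniq (s ++ t) -> (forall j, j \in s ++ t -> I j) ->
  (forall j, measurable_fun setT (h j)) -> (forall j x, 0 <= h j x) ->
  (forall j, measurable (B j)) ->
  (forall j, I j -> (\int[P]_x (h j (X j x))%:E = (m j)%:E)%E) ->
  (\int[P]_x (\prod_(j <- s) h j (X j x) * \prod_(j <- t) \1_(B j) (X j x))%:E =
    (\prod_(j <- s) m j * \prod_(j <- t) fine (P (X j @^-1` B j)))%:E)%E.
Proof.
move=> + + mh h0 + hm.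
have mXB j C : measurable C -> measurable (X j @^-1` C).
  by move=> mC; rewrite -[X in measurable X]setTI; exact: mX.
elim: s t B => [|j s IH] t B st stI mB.
  rewrite big_nil mul1r; under eq_integral do rewrite big_nil mul1r.
  have -> : (fun x => (\prod_(j <- t) \1_(B j) (X j x))%:E) =
      (fun x => (\1_[set w | forall j, j \in t -> B j (X j w)] x : R)%:E).
    apply/funext => x; congr EFin; rewrite indicE.
    have [hB|hB] := pselect (forall j, j \in t -> B j (X j x)).
      by rewrite mem_set//= big_seq big1// => j jt; rewrite indicE mem_set//; exact: hB.
    rewrite memNset//=; have [j jt jB] : exists2 j, j \in t & ~ B j (X j x).
      by apply: contra_notP hB => /forall2NP hB j jt; have [//|/contrapT] := hB j.
    by rewrite (big_rem j)//= indicE memNset// mul0r.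
  rewrite integral_indic// ?setIT.
    apply: (eq_trans (iX st stI mB)).
    rewrite -prodEFin; apply: eq_bigr => j _; rewrite fineK//; apply: fin_num_measure; exact: mXB.
  rewrite (_ : [set _ | _] = \bigcap_(j in [set` t]) (X j @^-1` B j)); last first.
    by apply/seteqP; split.
  by apply: fin_bigcap_measurable => // j _; exact: mXB.
have Ij : I j by apply: stI; rewrite inE eqxx.
rewrite big_cons -mulrA.
pose c := \prod_(j <- s) m j * \prod_(j <- t) fine (P (X j @^-1` B j)).
rewrite -/c.
have c0 : 0 <= c.
  apply: mulr_ge0; last by apply: prodr_ge0 => i _; exact: fine_ge0.
  rewrite big_seq; apply: prodr_ge0 => i si; rewrite -lee_fin -hm.
    by apply: integral_ge0 => x _; rewrite lee_fin.
  by apply: stI; rewrite inE mem_cat si orbT.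
pose W x := \prod_(j <- s) h j (X j x) * \prod_(j <- t) \1_(B j) (X j x).
have mW : measurable_fun setT W.
  apply: measurable_funM; first exact: measurable_prod_comp.
  apply: (@measurable_prod_comp (fun j => \1_(B j))) => i.
  exact: measurable_indic.
have W0 x : 0 <= W x by apply: mulr_ge0; apply: prodr_ge0 => i _.
have c00 (x : T) : 0 <= cst c x by [].
have mc : measurable_fun setT (cst c : T -> R) by exact: measurable_cst.
transitivity (\int[P]_x ((h j (X j x))%:E * (W x)%:E))%E.
  by apply: eq_integral => x _; rewrite -EFinM /W big_cons mulrA.
(* The weight W is replaced by the constant c; on indicators of [X j] this is the induction
   hypothesis with j moved into t. *)
rewrite (@weighted_transfer R _ _ P _ _ P (X j) W (X j) (cst c) (mX j) mW W0 (mX j) mc c00 _ (h j) (mh j) (h0 j)); last first.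
  move=> C mC /=.
  have jst : (j \notin s) /\ (j \notin t).
    by move: st; rewrite /= mem_cat negb_or => /andP[/andP[]].
  rewrite ge0_integralZr//; last by apply/measurable_EFinP; apply: measurableT_comp => //; exact: measurable_indic.
  pose B' i := if i == j then C else B i.
  have Bj : B' j = C by rewrite /B' eqxx.
  have eB i : i \in t -> B' i = B i.
    by rewrite /B'; case: eqVneq => // -> jt; move: jst.2; rewrite jt.
  transitivity (\int[P]_x (\prod_(j <- s) h j (X j x) * \prod_(j <- j :: t) \1_(B' j) (X j x))%:E)%E.
    apply: eq_integral => x _; rewrite -EFinM /W mulrCA big_cons Bj; congr ((_ * (_ * _))%:E).
    by apply: eq_big_seq => i it; rewrite eB.
  rewrite IH//; first last.
  - by move=> i; rewrite /B'; case: ifP.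
  - by move=> i; rewrite mem_cat inE => h'; apply: stI; rewrite inE mem_cat; case/or3P: h' => ->; rewrite ?orbT.
  - by rewrite uniq_catC/= mem_cat orbC -mem_cat uniq_catC; exact: st.
  - rewrite big_cons Bj mulrCA EFinM; congr (_ * _)%E.
      rewrite fineK ?fin_num_measure//; last exact: mXB.
      rewrite -[RHS]/(\int[P]_x ((\1_(X j @^-1` C) x : R)%:E))%E integral_indic ?setIT//; exact: mXB.
    by rewrite /c; congr (_ * _)%:E; apply: eq_big_seq => i it; rewrite eB.
rewrite /= ge0_integralZr//; first by rewrite hm// EFinM.
  by apply/measurable_EFinP; exact: measurableT_comp.
by move=> x _; rewrite lee_fin.
Qed.

Lemma independent_prod_integrable (s : seq nat) (h : nat -> R -> R) :
  uniq s -> (forall j, j \in s -> I j) -> (forall j, measurable_fun setT (h j)) ->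
  (forall j, I j -> P.-integrable setT (EFin \o (h j \o X j))) ->
  P.-integrable setT (EFin \o (fun x => \prod_(j <- s) h j (X j x))).
Proof.
move=> us sI mh hi; apply/integrableP; split.
  by apply/measurable_EFinP; exact: measurable_prod_comp.
pose h' j y := `|h j y|.
have mh' j : measurable_fun setT (h' j) by exact: measurableT_comp.
pose m' j := fine (\int[P]_x (h' j (X j x))%:E).
have hm' j : I j -> (\int[P]_x (h' j (X j x))%:E = (m' j)%:E)%E.
  move=> Ij; rewrite fineK//; apply: integrable_fin_num => //.
  exact: (integrable_abse (hi _ Ij)).
have h'0 j x : 0 <= h' j x by exact: normr_ge0.
have := @independent_prod_ge0 s [::] h' (fun=> setT) m'.
rewrite cats0 => /(_ us sI mh' h'0 (fun=> measurableT) hm').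
under eq_integral do rewrite big_nil mulr1.
move=> E; rewrite -[ltLHS]/(\int[P]_x `|\prod_(j <- s) h j (X j x)|%:E)%E.
under eq_integral do rewrite normr_prod.
by rewrite E ltry.
Qed.

(** Signs are removed one index at a time: [h j] is split into its positive and negative parts, and
    each of them lets j move from s to the nonnegative indices t. *)
Lemma independent_prod_aux (s t : seq nat) (h : nat -> R -> R) :
  uniq (s ++ t) -> (forall j, j \in s ++ t -> I j) -> (forall j, measurable_fun setT (h j)) ->
  (forall j, I j -> P.-integrable setT (EFin \o (h j \o X j))) ->
  (forall j, j \in t -> forall y, 0 <= h j y) ->
  \int[P]_x (\prod_(j <- s ++ t) h j (X j x)) = \prod_(j <- s ++ t) \int[P]_x h j (X j x).
Proof.
elim: s t h => [|j s IH] t h st stI mh hi ht.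
  pose h' j y := `|h j y|.
  have e x : \prod_(j <- [::] ++ t) h j (X j x) =
    (\prod_(j <- t) h' j (X j x) * \prod_(j <- [::]) \1_setT (X j x)).
    rewrite big_nil mulr1 /=; apply: eq_big_seq => j jt; rewrite /h' ger0_norm//; exact: ht.
  have mh' j : measurable_fun setT (h' j) by exact: measurableT_comp.
  have hm' j : I j -> (\int[P]_x (h' j (X j x))%:E = (\int[P]_x h' j (X j x))%:E)%E.
    move=> Ij; rewrite fineK//; apply: integrable_fin_num => //.
    exact: (integrable_abse (hi _ Ij)).
  have h'0 j x : 0 <= h' j x by exact: normr_ge0.
  have tt : uniq (t ++ [::]) by rewrite cats0.
  have tI j : j \in t ++ [::] -> I j by rewrite cats0; exact: stI.
  have := independent_prod_ge0 tt tI mh' h'0 (fun=> measurableT) hm'.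
  under eq_integral do rewrite -e.
  rewrite big_nil mulr1 /Rintegral => -> /=.
  apply: eq_big_seq => j jt; congr fine; apply: eq_integral => x _.
  by rewrite /h' ger0_norm//; exact: ht.
have Ij : I j by apply: stI; rewrite inE eqxx.
have jst : j \notin s ++ t by move: st => /andP[].
pose hs (g : R -> R) i := if i == j then g else h i.
(* The induction hypothesis with [h j] replaced by g, to be applied to the positive and the negative
   part. *)
have P0 (g : R -> R) :
    [/\ measurable_fun setT g, forall y, 0 <= g y & forall y, g y <= `|h j y|] ->
  [/\ P.-integrable setT (EFin \o (fun x => g (X j x) * \prod_(j <- s ++ t) h j (X j x))),
  \int[P]_x (g (X j x) * \prod_(j <- s ++ t) h j (X j x)) =
  (\int[P]_x g (X j x)) * \prod_(j <- s ++ t) \int[P]_x h j (X j x) &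
  P.-integrable setT (EFin \o (g \o X j))].
move=> [mg g0 gh].
have igj : P.-integrable setT (EFin \o (g \o X j)).
  apply: (le_integrable measurableT _ _ (hi j Ij)).
    by apply/measurable_EFinP; exact: measurableT_comp.
  by move=> x _ /=; rewrite lee_fin ger0_norm.
have hsj : hs g j = g by rewrite /hs eqxx.
have ehs i : i \in s ++ t -> hs g i = h i.
  by rewrite /hs; case: eqVneq => // ->; rewrite (negbTE jst).
have ep x : \prod_(i <- s ++ j :: t) hs g i (X i x) = g (X j x) * \prod_(i <- s ++ t) h i (X i x).
  rewrite (perm_big _ (permEl (perm_catCA s [:: j] t)))/= big_cons hsj; congr (_ * _).
  by apply: eq_big_seq => i /ehs ->.
have st' : uniq (s ++ j :: t) by rewrite uniq_catC/= mem_cat orbC -mem_cat uniq_catC; exact: st.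
have stI' i : i \in s ++ j :: t -> I i.
  by rewrite mem_cat inE => h'; apply: stI; rewrite inE mem_cat; case/or3P: h' => ->; rewrite ?orbT.
have mhs i : measurable_fun setT (hs g i) by rewrite /hs; case: ifP.
have ihs i : I i -> P.-integrable setT (EFin \o (hs g i \o X i)).
  by rewrite /hs; case: eqVneq => [->|_ /hi].
split.
  have := independent_prod_integrable st' stI' mhs ihs.
  by congr (P.-integrable _ (EFin \o _)); apply/funext.
  have := IH (j :: t) (hs g) st' stI' mhs ihs _.
  under eq_Rintegral do rewrite ep.
  move=> ->.
    rewrite (perm_big _ (permEl (perm_catCA s [:: j] t)))/= big_cons hsj; congr (_ * _).
    by apply: eq_big_seq => i /ehs ->.
  move=> i; rewrite inE => /orP[/eqP-> y|it y]; first by rewrite hsj.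
  by rewrite ehs ?ht// mem_cat it orbT.
by [].
have fg y : h j y = (h j)^\+ y - (h j)^\- y.
  by rewrite -[in LHS](funrposBneg (h j)).
have nD y : (h j)^\+ y + (h j)^\- y = `|h j y|.
  by have /(congr1 (fun u => u y)) := funrposDneg (h j).
have hf : [/\ measurable_fun setT (h j)^\+, forall y, 0 <= (h j)^\+ y & forall y, (h j)^\+ y <= `|h j y|].
  by split=> [|//|y]; [exact: measurable_funrpos|rewrite -nD lerDl].
have hg : [/\ measurable_fun setT (h j)^\-, forall y, 0 <= (h j)^\- y & forall y, (h j)^\- y <= `|h j y|].
  by split=> [|//|y]; [exact: measurable_funrneg|rewrite -nD lerDr].
have [if1 ef if2] := P0 _ hf; have [ig1 eg ig2] := P0 _ hg.
rewrite cat_cons !big_cons; under eq_Rintegral do rewrite big_cons fg mulrBl.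
rewrite RintegralB// ef eg -mulrBl; congr (_ * _).
by rewrite -RintegralB//; apply: eq_Rintegral => x _; rewrite fg.
Qed.

Lemma independent_prod (s : seq nat) (h : nat -> R -> R) :
  uniq s -> (forall j, j \in s -> I j) -> (forall j, measurable_fun setT (h j)) ->
  (forall j, I j -> P.-integrable setT (EFin \o (h j \o X j))) ->
  \int[P]_x (\prod_(j <- s) h j (X j x)) = \prod_(j <- s) \int[P]_x h j (X j x).
Proof. by move=> us sI mh hi; have := @independent_prod_aux s [::] h; rewrite cats0; exact. Qed.

End Independence.

Section DensityLaw.
Variables (R : realType) (p : R -> R).
Hypothesis mp : measurable_fun setT p.
Hypothesis p0 : forall x, 0 <= p x.
Context d (T : measurableType d) (P : probability T R) (Y : T -> R).
Hypothesis mY : measurable_fun setT Y.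
Hypothesis lawY : forall B : set R, measurable B ->
  (P (Y @^-1` B) = \int[lebesgue_measure]_(x in B) (p x)%:E)%E.

Lemma density_integral_ge0 (h : R -> R) : measurable_fun setT h -> (forall x, 0 <= h x) ->
  (\int[P]_w (h (Y w))%:E = \int[lebesgue_measure]_x (h x * p x)%:E)%E.
Proof.
move=> mh h0.
transitivity (\int[P]_w ((h (Y w))%:E * (cst 1 w)%:E))%E.
  by apply: eq_integral => w _; rewrite mule1.
apply: (eq_trans (@weighted_transfer R _ _ P _ _ (@lebesgue_measure R) Y (cst 1) idfun p mY
  (@measurable_cst _ _ _ _ setT (1 : R)) (fun=> ler01) (@measurable_id _ _ setT) mp p0 _ h mh h0)); last first.
  by apply: eq_integral => x _; rewrite -EFinM.
move=> B mB; under eq_integral do rewrite mule1.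
transitivity (P (Y @^-1` B)).
  rewrite -[LHS]/(\int[P]_w ((\1_(Y @^-1` B) w : R)%:E))%E integral_indic ?setIT//.
  by rewrite -[X in measurable X]setTI; exact: mY.
rewrite lawY// [LHS]integral_mkcond; apply: eq_integral => x _.
by rewrite epatch_indic muleC.
Qed.

Lemma density_integrable (h : R -> R) : measurable_fun setT h ->
  lebesgue_measure.-integrable setT (fun x => (h x * p x)%:E) ->
  P.-integrable setT (EFin \o (h \o Y)) /\
  \int[P]_w h (Y w) = fine (\int[lebesgue_measure]_x (h x * p x)%:E)%E.
Proof.
move=> mh hi.
have mhY : measurable_fun setT (h \o Y) by exact: measurableT_comp.
have iY : P.-integrable setT (EFin \o (h \o Y)).
  apply/integrableP; split; first exact/measurable_EFinP.
  rewrite -[ltLHS]/(\int[P]_w (`|h (Y w)|)%:E)%E.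
  rewrite (@density_integral_ge0 (fun y => `|h y|))//; last exact: measurableT_comp.
  have /integrableP[_] := hi; congr (_ < _)%E; apply: eq_integral => x _ /=.
  by rewrite normrM (ger0_norm (p0 x)).
split=> //.
have fg y : h y = h^\+ y - h^\- y by rewrite -[in LHS](funrposBneg h).
have nD y : h^\+ y + h^\- y = `|h y|.
  by have /(congr1 (fun u => u y)) := funrposDneg h.
have mf := measurable_funrpos mh; have mg := measurable_funrneg mh.
have dom (g : R -> R) : measurable_fun setT g -> (forall y, 0 <= g y) -> (forall y, g y <= `|h y|) ->
  P.-integrable setT (EFin \o (g \o Y)) /\ lebesgue_measure.-integrable setT (EFin \o (fun x => (g x * p x))).
  move=> mg' g0 gh; split.
    apply: (le_integrable measurableT _ _ iY); first exact/measurable_EFinP/measurableT_comp.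
    by move=> x _; rewrite /= lee_fin ger0_norm.
  apply: (le_integrable measurableT _ _ hi); first exact/measurable_EFinP/measurable_funM.
  by move=> x _; rewrite /= lee_fin !normrM ler_wpM2r// (ger0_norm (g0 _)).
have [if1 if2] := dom _ mf (fun y => funrpos_ge0 h y) (fun y => ltac:(rewrite -nD lerDl//)).
have [ig1 ig2] := dom _ mg (fun y => funrneg_ge0 h y) (fun y => ltac:(rewrite -nD lerDr//)).
under eq_Rintegral do rewrite fg.
rewrite RintegralB// /Rintegral !density_integral_ge0//.
under [in RHS]eq_integral do rewrite fg mulrBl.
by rewrite -[RHS]/(\int[lebesgue_measure]_x (h^\+ x * p x - h^\- x * p x)) RintegralB.
Qed.

End DensityLaw.

(** * Means and variances of random traces *)

Section Chebyshev.
Context d (T : measurableType d) (R : realType) (P : probability T R).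

Lemma chebyshev_bound (Y : T -> R) (e : R) : 0 < e -> measurable_fun setT Y ->
  P.-integrable setT (EFin \o (fun x => Y x ^+ 2)) ->
  measurable [set x | e <= `|Y x|] /\
  (P [set x | (e <= `|Y x|)%R] <= (e ^- 2 * \int[P]_x (Y x ^+ 2))%:E)%E.
Proof.
move=> e0 mY iY.
have mE : measurable [set x | e <= `|Y x|].
  have mnY : measurable_fun setT (fun x => `|Y x|) by exact: measurableT_comp.
  have := mnY measurableT _ (@measurable_itv _ `[e, +oo[).
  rewrite setTI (_ : _ @^-1` _ = [set x | e <= `|Y x|])//.
  by apply/seteqP; split=> x /=; rewrite in_itv/= andbT.
split=> //.
have -> : P [set x | e <= `|Y x|] = (\int[P]_x \1_[set x | e <= `|Y x|] x)%:E.
  by rewrite Rintegral_indicT// fineK// fin_num_measure.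
rewrite lee_fin -RintegralZl//.
apply: le_Rintegral => //.
- exact: indic_integrable.
- exact: integrable_scale.
- move=> x _; rewrite indicE; case: (boolP (x \in _)) => [|_]; last by rewrite mulr_ge0 ?invr_ge0 ?sqr_ge0.
  rewrite inE/= => ex; rewrite ler_pdivlMl ?exprn_gt0// mulr1 -[Y x ^+ 2]real_normK ?num_real//.
  by rewrite lerXn2r ?nnegrE ?(ltW e0).
Qed.

End Chebyshev.

Section IidMoments.
Variables (R : realType) (p : R -> R).
Hypothesis mp : measurable_fun setT p.
Hypothesis p0 : forall x, 0 <= p x.
Hypothesis ip : forall k : nat, lebesgue_measure.-integrable setT (fun x => (x ^+ k * p x)%:E).
Context d (T : measurableType d) (P : probability T R) (b : nat -> T -> R).
Hypothesis mb : forall j, measurable_fun setT (b j).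
Hypothesis lawb : forall j, (0 < j)%N -> forall B : set R, measurable B ->
  (P (b j @^-1` B) = \int[lebesgue_measure]_(x in B) (p x)%:E)%E.
Hypothesis ib : mutually_independent P [set j | (0 < j)%N] b.

Definition density_moment k : R := fine (\int[lebesgue_measure]_x (x ^+ k * p x)%:E)%E.

Let m := density_moment.

Lemma wprod_expectation (s : seq nat) :
  P.-integrable setT (EFin \o (fun w => wprod (b ^~ w) s)) /\
  \int[P]_w wprod (b ^~ w) s = ev m s.
Proof.
rewrite /ev; case: ifPn => s0.
  have e w : wprod (b ^~ w) s = 0 by rewrite wprodE s0.
  rewrite (_ : (fun w => _) = cst 0); last exact/funext.
  split; last by rewrite Rintegral_cstT.
  exact: integrable_cstT.
pose h j (y : R) := y ^+ count_mem j s.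
have e w : wprod (b ^~ w) s = \prod_(j <- undup s) h j (b j w) by rewrite wprodE (negbTE s0).
have mh j : measurable_fun setT (h j) by exact: measurable_funX.
have dI j : (0 < j)%N -> P.-integrable setT (EFin \o (h j \o b j)) /\
    \int[P]_w h j (b j w) = m (count_mem j s).
  by move=> j0; exact: (density_integrable mp p0 (mb j) (lawb j0) (mh j) (ip _)).
have us := undup_uniq s.
have sI j : j \in undup s -> [set j | (0 < j)%N] j.
  by rewrite mem_undup /= => js; rewrite lt0n; apply: contraNneq s0 => <-.
have iI j (j0 : [set j | (0 < j)%N] j) := (dI j j0).1.
rewrite (_ : (fun w => _) = (fun w => \prod_(j <- undup s) h j (b j w))); last exact/funext.
split; first exact: (independent_prod_integrable mb ib us sI mh iI).
by rewrite (independent_prod mb ib us sI mh iI); apply: eq_big_seq => j /sI /dI[_].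
Qed.

Lemma trace_expectation N k :
  P.-integrable setT (EFin \o (fun w => \tr (toeplitz N (b ^~ w) ^+ k))) /\
  \int[P]_w \tr (toeplitz N (b ^~ w) ^+ k) = tsum m k N.
Proof.
rewrite (_ : (fun w => _) = fun w => \sum_(v : walk N k | closed_walk v) wprod (b ^~ w) (wl v)); last first.
  by apply/funext => w; rewrite trace_walks.
have [|i ->] := @Rintegral_bigsum _ _ _ P _ (index_enum (walk N k)) (@closed_walk N k) (fun v w => wprod (b ^~ w) (wl v)).
  by move=> v _ _; exact: (wprod_expectation _).1.
by split=> //; apply: eq_bigr => v _; rewrite (wprod_expectation _).2.
Qed.

Lemma trace_variance N k :
  let Y w := \tr (toeplitz N (b ^~ w) ^+ k) - tsum m k N in
  P.-integrable setT (EFin \o (fun w => Y w ^+ 2)) /\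
  \int[P]_w (Y w ^+ 2) = tcov m k N.
Proof.
(* The product of two centred words, expanded and grouped into differences of integrable
   functions. *)
move=> Y; pose F (v v' : walk N k) w := (wprod (b ^~ w) (wl v ++ wl v') - ev m (wl v) * wprod (b ^~ w) (wl v'))
   - (ev m (wl v') * wprod (b ^~ w) (wl v) - ev m (wl v) * ev m (wl v')).
have -> : (fun w => Y w ^+ 2) =
  fun w => \sum_(v : walk N k | closed_walk v) \sum_(v' : walk N k | closed_walk v') F v v' w.
  apply/funext => w; rewrite /Y trace_walks /tsum -sumrB expr2 mulr_suml; apply: eq_bigr => v _.
  by rewrite mulr_sumr; apply: eq_bigr => v' _; rewrite /F wprod_cat; ring.
have iF v v' : P.-integrable setT (EFin \o F v v') /\
    \int[P]_w F v v' w = ev m (wl v ++ wl v') - ev m (wl v) * ev m (wl v').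
  have [i1 e1] := wprod_expectation (wl v ++ wl v').
  have [i2 e2] := wprod_expectation (wl v).
  have [i3 e3] := wprod_expectation (wl v').
  have i2' := integrable_scale (ev m (wl v')) i2.
  have i3' := integrable_scale (ev m (wl v)) i3.
  have ic := integrable_cstT P (ev m (wl v) * ev m (wl v')).
  have i4 := integrable_sub i1 i3'; have i5 := integrable_sub i2' ic.
  split; first exact: integrable_sub.
  rewrite RintegralB// RintegralB// RintegralB//.
  by rewrite Rintegral_cstT !RintegralZl// e1 e2 e3; ring.
have inn v : P.-integrable setT (EFin \o (fun w => \sum_(v' : walk N k | closed_walk v') F v v' w)) /\
    \int[P]_w (\sum_(v' : walk N k | closed_walk v') F v v' w) = \sum_(v' : walk N k | closed_walk v') \int[P]_w F v v' w.
  by apply: Rintegral_bigsum => v' _ _; exact: (iF _ _).1.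
have [|i ->] := @Rintegral_bigsum _ _ _ P _ (index_enum (walk N k)) (@closed_walk N k)
    (fun v w => \sum_(v' : walk N k | closed_walk v') F v v' w).
  by move=> v _ _; exact: (inn v).1.
split=> //; apply: eq_bigr => v _; rewrite (inn v).2; apply: eq_bigr => v' _.
by rewrite (iF _ _).2.
Qed.

End IidMoments.

(** * Convergence in probability of the empirical integrals *)

Section Empirical.
Variables (R : realType) (N : nat) (A : 'M[R]_N).

Lemma empirical_lin a f g : empirical_integral A (fun x => a * f x + g x) =
  a * empirical_integral A f + empirical_integral A g.
Proof. by rewrite /empirical_integral mulrCA -mulrDr [a * _]mulr_sumr -big_split. Qed.

Lemma empirical_dist f g h : (forall x, `|f x - g x| <= h x) ->
  `|empirical_integral A f - empirical_integral A g| <= empirical_integral A h.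
Proof.
move=> fgh; rewrite /empirical_integral -mulrBr -sumrB normrM ger0_norm ?invr_ge0//.
by rewrite ler_wpM2l ?invr_ge0// (le_trans (ler_norm_sum _ _ _))// ler_sum.
Qed.

Lemma empirical_cvg (f : nat -> R -> R) g : (forall x, (f ^~ x) @ \oo --> g x) ->
  (fun n => empirical_integral A (f n)) @ \oo --> empirical_integral A g.
Proof.
move=> fg; rewrite /empirical_integral; apply: cvgMr => //.
by apply: cvg_big => [|i _]; [exact: add_continuous|exact: fg].
Qed.

End Empirical.

Lemma poly_approx (R : realType) (f : R -> R) : continuous f ->
  exists q : nat -> {poly R}, forall x, (fun n => (q n).[x]) @ \oo --> f x.
Proof.
move=> cf; have h n : exists q : {poly R}, forall x : R, - n%:R <= x <= n%:R -> `|f x - q.[x]| <= n.+1%:R^-1.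
  by apply: weierstrass => //; rewrite invr_gt0.
have [q hq] := choice h; exists q => x; apply/cvgnP => e e0.
have [n0 hn0] := @inv_small R 1 e e0.
have [n1 hn1] : exists n1 : nat, `|x| <= n1%:R.
  by exists (Num.truncn `|x|).+1; rewrite ltW// truncnS_gt.
exists (maxn n0 n1) => n; rewrite geq_max => /andP[n0n n1n].
rewrite distrC (le_trans (hq n x _))//.
  by rewrite -ler_norml (le_trans hn1)// ler_nat.
by have [_] := hn0 n.+1 (leqW n0n); rewrite mul1r.
Qed.

Section InProbability.
Variables (R : realType) (d : measure_display) (T : measurableType d) (P : probability T R).
Variables (b : nat -> T -> R) (M : nat -> R) (mu : probability R R).
Hypothesis mb : forall j, measurable_fun setT (b j).

Lemma measurable_trace N k : measurable_fun setT (fun w => \tr (toeplitz N (b ^~ w) ^+ k)).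
Proof.
under eq_fun do rewrite trace_walks big_mkcond.
apply: measurable_sum => v; case: (closed_walk v) => //; apply: measurable_prod => j _.
by rewrite /offdiag; case: eqP.
Qed.

Lemma measurable_moment N k : measurable_fun setT (fun w => moment_AN k (toeplitz N (b ^~ w))).
Proof. by apply: measurable_funM => //; exact: measurable_trace. Qed.

(** The eigenvalue list is obtained by choice, so measurability cannot be read off it. Polynomials
    give combinations of traces, and a continuous f is a pointwise limit of polynomials. *)
Lemma measurable_empirical N f : continuous f ->
  measurable_fun setT (fun w => empirical_integral (toeplitz N (b ^~ w)) f).
Proof.
move=> /poly_approx[q hq].
apply: (@measurable_fun_cvg _ _ _ _ (fun n w => empirical_integral (toeplitz N (b ^~ w)) (horner (q n)))).
  move=> n; under eq_fun do rewrite empirical_poly.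
  by apply: measurable_sum => k; apply: measurable_funM => //; exact: measurable_moment.
by move=> w _; exact: empirical_cvg.
Qed.

(** Convergence in probability with an explicit measurable exceptional set: such sets can be united,
    and no measurability of the deviation event is required from members of the class. *)
Definition empirical_close (f : R -> R) :=
  mu.-integrable setT (EFin \o f) /\
  forall e h, 0 < e -> 0 < h -> exists N0, forall N, (N0 <= N)%N ->
    exists2 E, measurable E & (P E <= h%:E)%E /\ forall w, ~ E w ->
      `|empirical_integral (toeplitz N (b ^~ w)) f - \int[mu]_x f x| <= e.

Lemma empirical_close_lin a f g : empirical_close f -> empirical_close g ->
  empirical_close (fun x => a * f x + g x).
Proof.
move=> [i1 c1] [i2 c2]; have i1' := integrable_scale a i1; split; first exact: integrable_add.
move=> e h e0 h0.
(* The added 1 allows division also for a = 0. *)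
have a0 : 0 < `|a| + 1 by rewrite ltr_wpDl.
have [N1 h1] := c1 (e / 2 / (`|a| + 1)) (h / 2) ltac:(by rewrite !divr_gt0) ltac:(by rewrite divr_gt0).
have [N2 h2] := c2 (e / 2) (h / 2) ltac:(by rewrite divr_gt0) ltac:(by rewrite divr_gt0).
exists (maxn N1 N2) => N; rewrite geq_max => /andP[/h1[E1 mE1 [P1 b1]] /h2[E2 mE2 [P2 b2]]].
exists (E1 `|` E2); first exact: measurableU.
split.
  rewrite (le_trans (measureU2 _ _ _))//.
  by rewrite [in leRHS](splitr h) EFinD; exact: leeD.
move=> w /not_orP[/b1 l1 /b2 l2].
rewrite empirical_lin RintegralD// RintegralZl//.
set u := empirical_integral _ f in l1 *; set v := empirical_integral _ g in l2 *.
rewrite (_ : _ - _ = a * (u - \int[mu]_x f x) + (v - \int[mu]_x g x)); last by ring.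
rewrite (le_trans (ler_normD _ _))// [leRHS]splitr lerD// normrM.
rewrite -[leRHS](divfK (lt0r_neq0 a0)) mulrC ler_pM//.
by rewrite lerDl.
Qed.

Lemma empirical_close_sandwich f : has_moments M mu -> continuous f ->
  (forall q : {poly R}, empirical_close (horner q)) ->
  (forall e, 0 < e -> exists g (q : {poly R}),
    [/\ empirical_close g, forall x, `|f x - g x| <= q.[x] & mfun M q <= e]) ->
  empirical_close f.
Proof.
move=> hmu cf hp hs; have mf := continuous_measurable_fun cf.
split.
  have [g [q [[ig _] gq _]]] := hs 1 ltr01.
  exact: (close_integrable mf ig (has_moments_poly q hmu).1 gq).1.
move=> e h e0 h0.
(* The empirical integrals of f and g differ by at most M(q) + e/4 <= e/2; replacing g's empirical
   integral by its mean and then passing to f's mean cost e/4 each. *)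
have e4 : 0 < e / 4 by rewrite divr_gt0.
have h2' : 0 < h / 2 by rewrite divr_gt0.
have [g [q [[ig cg] gq qe]]] := hs _ e4.
have [iq mq] := has_moments_poly q hmu.
have [jf df] := close_integrable mf ig iq gq.
have [N1 h1] := cg _ _ e4 h2'; have [N2 h2] := (hp q).2 _ _ e4 h2'.
exists (maxn N1 N2) => N; rewrite geq_max => /andP[/h1[E1 mE1 [P1 b1]] /h2[E2 mE2 [P2 b2]]].
exists (E1 `|` E2); first exact: measurableU.
split.
  rewrite (le_trans (measureU2 _ _ _))//.
  by rewrite [in leRHS](splitr h) EFinD; exact: leeD.
move=> w /not_orP[/b1 l1 /b2 l2].
have l3 := empirical_dist (toeplitz N (b ^~ w)) gq.
move: l1 l2 l3 df qe; rewrite mq.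
set x1 := empirical_integral _ f; set x2 := empirical_integral _ g; set x3 := empirical_integral _ _.
set y1 := Rintegral _ _ f; set y2 := Rintegral _ _ g; set y3 := mfun _ _.
rewrite !ler_norml => /andP[? ?] /andP[? ?] /andP[? ?] /andP[? ?] ?.
by apply/andP; split; lra.
Qed.

(** Chebyshev's inequality: c N is the expected moment and v N its variance. *)
Lemma empirical_close_pow k (c v : nat -> R) :
  has_moments M mu ->
  (forall N, let Y w := moment_AN k (toeplitz N (b ^~ w)) - c N in
    P.-integrable setT (EFin \o (fun w => Y w ^+ 2)) /\ \int[P]_w (Y w ^+ 2) = v N) ->
  c @ \oo --> M k -> v @ \oo --> 0 ->
  empirical_close (fun x => x ^+ k).
Proof.
move=> hmu hv /cvgnP cM /cvgnP v0; split; first exact: (hmu k).1.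
move=> e h e0 h0; have e2 : 0 < e / 2 by rewrite divr_gt0.
have [N1 h1] := cM _ e2; have [N2 h2] := v0 (h * (e / 2) ^+ 2) ltac:(by rewrite mulr_gt0// exprn_gt0).
exists (maxn N1 N2) => N; rewrite geq_max => /andP[/h1 cN /h2 vN].
have [iY eY] := hv N.
have mY : measurable_fun setT (fun w => moment_AN k (toeplitz N (b ^~ w)) - c N).
  by apply: measurable_funB => //; exact: measurable_moment.
have [mE PE] := chebyshev_bound e2 mY iY.
eexists; first exact: mE; split.
  rewrite (le_trans PE)// lee_fin eY ler_pdivrMl ?exprn_gt0// mulrC.
  by move: vN; rewrite subr0 => /ler_normlP[].
move=> w /= /negP; rewrite -ltNge => lt1.
have -> : \int[mu]_x (x ^+ k) = M k by rewrite /Rintegral (hmu k).2.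
rewrite empirical_pow (_ : _ - _ = (moment_AN k (toeplitz N (b ^~ w)) - c N) + (c N - M k)); last by ring.
by rewrite (le_trans (ler_normD _ _))// [leRHS]splitr lerD// ltW.
Qed.

Lemma empirical_close_poly : (forall k, empirical_close (fun x => x ^+ k)) ->
  forall q : {poly R}, empirical_close (horner q).
Proof.
move=> hk q.
rewrite (_ : horner q = fun x => \sum_(i < size q) q`_i * x ^+ i); last first.
  by apply/funext => x; rewrite horner_coef.
elim: (size q) => [|n IH].
  rewrite (_ : (fun x => _) = fun x => -1 * x ^+ 0 + x ^+ 0); last first.
    by apply/funext => x; rewrite big_ord0 mulN1r addNr.
  exact: empirical_close_lin (hk _) (hk _).
rewrite (_ : (fun x => _) = fun x => q`_n * x ^+ n + \sum_(i < n) q`_i * x ^+ i); last first.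
  by apply/funext => x; rewrite big_ord_recr addrC.
exact: empirical_close_lin.
Qed.

Lemma empirical_close_prob f : continuous f -> empirical_close f -> forall eps, 0 < eps ->
  (fun N : nat => P [set w | eps < `|empirical_integral (toeplitz N (b ^~ w)) f - \int[mu]_x f x|])
    @ \oo --> 0%E.
Proof.
move=> cf [_ hc] eps eps0.
set F := fun N : nat => _.
have mF N : measurable [set w | eps < `|empirical_integral (toeplitz N (b ^~ w)) f - \int[mu]_x f x|].
  have mY : measurable_fun setT (fun w => `|empirical_integral (toeplitz N (b ^~ w)) f - \int[mu]_x f x|).
    apply: measurableT_comp => //; apply: measurable_funB => //; exact: measurable_empirical.
  have := mY measurableT _ (@measurable_itv _ `]eps, +oo[).
  rewrite setTI; congr measurable.
  by apply/seteqP; split=> x /=; rewrite in_itv/= andbT.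
have FE N : F N = (fine (F N))%:E by rewrite fineK// fin_num_measure.
rewrite (_ : F = EFin \o (fine \o F)); last exact/funext.
apply: cvg_EFin; first exact: nearW.
apply/cvgnP => h h0; have [N0 hN] := hc _ _ eps0 h0.
exists N0 => N /hN[E mE [PE bE]].
rewrite subr0 /= ger0_norm; last exact: fine_ge0.
rewrite -lee_fin -FE (le_trans _ PE)//.
apply: le_measure; rewrite ?inE//.
move=> w /= lt1; apply: contrapT => /bE; rewrite leNgt lt1.
by [].
Qed.

End InProbability.

(** * The limit law for an arbitrary admissible density *)

Lemma tmom0 (R : realType) : tmom R 0 = 1.
Proof.
apply/eqP; rewrite eq_le; have := @tmom_le R 0; have := @tmom_ge R 0.
by rewrite muln0 fact0 !expr0 mul1r divr1 => -> ->.
Qed.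

Theorem mainTheorem11 (R : realType) :
  exists (mu : probability R R) (M : nat -> R),
    (* unbounded support *)
    (forall r : R, exists x, msupport mu x /\ r < `|x|) /\
    (* finite moments M_k *)
    (forall k : nat, mu.-integrable setT (fun x => (x ^+ k)%:E) /\
       (\int[mu]_x (x ^+ k)%:E = (M k)%:E)%E) /\
    (* mu is uniquely determined by its moments *)
    (forall nu : probability R R,
       (forall k : nat, nu.-integrable setT (fun x => (x ^+ k)%:E) /\
          (\int[nu]_x (x ^+ k)%:E = (M k)%:E)%E) ->
       forall B : set R, measurable B -> (nu B = mu B)%E) /\
    (* for every admissible density p and every iid family with density p *)
    (forall (p : R -> R),
       measurable_fun setT p ->
       (forall x, 0 <= p x) ->
       (\int[lebesgue_measure]_x (p x)%:E = 1)%E ->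
       (forall k : nat,
          lebesgue_measure.-integrable setT (fun x => (x ^+ k * p x)%:E)) ->
       (\int[lebesgue_measure]_x (x * p x)%:E = 0)%E ->
       (\int[lebesgue_measure]_x (x ^+ 2 * p x)%:E = 1)%E ->
     forall (d : measure_display) (Omega : measurableType d)
            (P : probability Omega R) (b : nat -> Omega -> R),
       (forall j, measurable_fun setT (b j)) ->
       (forall j, (0 < j)%N -> forall B : set R, measurable B ->
          (P (b j @^-1` B) = \int[lebesgue_measure]_(x in B) (p x)%:E)%E) ->
       mutually_independent P [set j | (0 < j)%N] b ->
       (* M_k = lim_N M_k(N) *)
       (forall k : nat,
          (fun N : nat => (\int[P]_w (moment_AN k (toeplitz N (b ^~ w)))%:E)%E)
            @ \oo --> (M k)%:E) /\
       (* weak convergence in probability *)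
       (forall (f : R -> R) (eps : R),
          continuous f -> (exists C : R, forall x, `|f x| <= C) -> 0 < eps ->
          (fun N : nat =>
             P [set w | eps < Num.norm (empirical_integral (toeplitz N (b ^~ w)) f
                                      - Rintegral mu setT f)])
            @ \oo --> 0%E)).
Proof.
have B1 : 1 <= 8 :> R by rewrite ler1n.
(* The measure comes from random signs, before any density is introduced, and is therefore
   independent of p. *)
have [mu hmu] := @limit_moments R (tmom R) 8 B1 (@tmom_le R) (@tmom0 R) (@rad_functional R)
  (@rad_lin R) (@rad_pos R) (@rad_moment_cvg R).
exists mu, (tmom R); split; first exact: (unbounded_support hmu (@tmom_ge R)).
split; first exact: hmu.
split.
  move=> nu hnu; apply: eq_measure_bounded => f C cf fC.
  exact: (same_moments_bounded B1 (@tmom_le R) hmu hnu cf fC).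
move=> p mp p0 _ ip p1 p2 d Omega P b mb lawb ib.
pose m := density_moment p.
have m1 : m 1%N = 0.
  by rewrite /m /density_moment; under eq_integral do rewrite expr1; rewrite p1.
have m2 : m 2%N = 1 by rewrite /m /density_moment p2.
pose c k N : R := N%:R^-1 * (Num.sqrt N%:R) ^- k.
have hE k N := trace_expectation mp p0 ip mb lawb ib N k.
have hV k N := trace_variance mp p0 ip mb lawb ib N k.
split.
  move=> k.
  rewrite (_ : (fun N : nat => _) = EFin \o (fun N => c k N * tsum m k N)).
    by apply: cvg_EFin; [exact: nearW|exact: tsum_cvg].
  apply/funext => N /=; rewrite -(hE k N).2 -RintegralZl ?(hE k N).1//.
  rewrite fineK//; apply: integrable_fin_num => //.
  exact: integrable_scale (hE k N).1.
have hp : forall q : {poly R}, empirical_close P b mu (horner q).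
  apply: empirical_close_poly => k.
  apply: (@empirical_close_pow _ _ _ P b (tmom R) mu mb k (fun N => c k N * tsum m k N) (fun N => c k N ^+ 2 * tcov m k N) hmu).
  - move=> N Y; have [iV eV] := hV k N.
    have YE w : Y w ^+ 2 = c k N ^+ 2 * (\tr (toeplitz N (b ^~ w) ^+ k) - tsum m k N) ^+ 2.
      by rewrite /Y /moment_AN -/(c k N) -mulrBr exprMn.
    rewrite (_ : (fun w => Y w ^+ 2) = fun w => c k N ^+ 2 * (\tr (toeplitz N (b ^~ w) ^+ k) - tsum m k N) ^+ 2); last exact/funext.
    split; first exact: integrable_scale.
    by rewrite RintegralZl// eV.
  - exact: tsum_cvg.
  - exact: tcov_cvg.
move=> f eps cf [C fC] eps0.
apply: empirical_close_prob => //.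
apply: (@dense_bounded R (tmom R) 8 B1 (@tmom_le R) (empirical_close P b mu) hp _ _ f cf C fC).
  by move=> a g h; exact: empirical_close_lin.
by move=> g cg hg; exact: empirical_close_sandwich hmu cg hp hg.
Qed.
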